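(* Let $(Z_{m,n,p})$ be independent standard Gaussian random variables, indexed by all triplets $(m,n,p)$ of non-negative integers and defined on the same probability space $(\Omega,P)$. Then, $P$-almost surely, the series $$U_x=\sum_{m,n,p\ge 0} Z_{m,n,p}\,\sqrt{\tau_{m,n,p}}\;\psi_{m,n,p}(x)$$ converges to a finite limit $U_x\in\mathbb{R}$ for all $x\in\mathbb{R}^3$. The real-valued random field $(U_x)_{x\in\mathbb{R}^3}$ so defined is Gaussian with mean $0$ and covariance kernel $E(U_xU_y)=k(x,y)=\exp(-|x-y|^2)$ for all $x,y\in\mathbb{R}^3$. The function $x\mapsto U_x$ is $P$-almost surely in $L_2(\mathbb{R}^3,\theta)$ and is $P$-almost surely smooth (of class $C^\infty$) in $x\in\mathbb{R}^3$. Moreover, $P$-almost surely, the series also converges to $U$ in $L_2(\mathbb{R}^3,\theta)$-norm.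
   Context: Notation. $|x|$ is the Euclidean norm on $\mathbb{R}^3$. $\gamma$ is the measure on $\mathbb{R}$ with density $\frac{1}{\sqrt{\pi}}\exp(-t^2)$ with respect to Lebesgue measure, and $\theta=\gamma\otimes\gamma\otimes\gamma$ on $\mathbb{R}^3$. The Hermite polynomials $H_n$ are defined by $H_0(t)=1$ and $H_{n+1}(t)=2tH_n(t)-2nH_{n-1}(t)$ for $n\ge 0$ (so $H_1(t)=2t$). For $n\ge 0$ and $t\in\mathbb{R}$ put $$\lambda_n=a^{n+1/2},\qquad \phi_n(t)=\frac{b}{\sqrt{2^n n!}}\exp(-ct^2)H_n(ht),$$ where $a=\frac{1}{1+\frac{1+\sqrt5}{2}}=\frac{2}{3+\sqrt5}$, $b=5^{1/8}$, $c=\frac{\sqrt5-1}{2}$, $h=5^{1/4}$. (These are the eigenvalues and an orthonormal basis of eigenfunctions in $L_2(\mathbb{R},\gamma)$ of the integral operator with kernel $\exp(-(t-t')^2)$ with respect to $\gamma$.) For non-negative integers $m,n,p$ and $x=(x_1,x_2,x_3)\in\mathbb{R}^3$ put $$\tau_{m,n,p}=\lambda_m\lambda_n\lambda_p,\qquad \psi_{m,n,p}(x)=\phi_m(x_1)\phi_n(x_2)\phi_p(x_3).$$ Convergence of the triple series is understood as convergence, as $N\to\infty$, of the partial sums over $\{(m,n,p):\max(m,n,p)\le N\}$. A real-valued random field $(U_x)_{x\in\mathbb{R}^3}$ is Gaussian if $(U_{x(1)},\dots,U_{x(r)})$ is a Gaussian vector for every finite set of points $x(1),\dots,x(r)\in\mathbb{R}^3$.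 *)

(* Defs.v *)
From HB Require Import structures.
From mathcomp Require Import all_boot all_order all_algebra.
From mathcomp Require Import all_classical all_reals all_analysis.

Set Implicit Arguments.
Unset Strict Implicit.
Unset Printing Implicit Defensive.
Import Order.TTheory GRing.Theory Num.Theory.
Import numFieldNormedType.Exports.

Local Open Scope classical_set_scope.
Local Open Scope ring_scope.

Section gaussian_measure.
Context {R : realType}.

Definition gauss_density (t : R) : R := (Num.sqrt pi)^-1 * expR (- t ^+ 2).

Definition gamma (A : set (measurableTypeR R)) : \bar R :=
  (\int[lebesgue_measure]_(t in A) (gauss_density t)%:E)%E.

Lemma gauss_densityE : gauss_density = normal_pdf 0 (Num.sqrt 2)^-1.
Proof.
have s2 : (Num.sqrt 2 : R)^-1 ^+ 2 = 2^-1 by rewrite exprVn sqr_sqrtr.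
apply/funext => t; rewrite normal_pdfE ?invr_eq0 ?sqrtr_eq0 -?ltNge//.
rewrite /gauss_density /normal_peak /normal_fun s2 subr0; congr (_^-1 * expR _).
  by rewrite -mulr_natr mulrAC mulVf// mul1r.
by rewrite -mulr_natr mulVf// divr1.
Qed.

Lemma gammaE : gamma = normal_prob 0 (Num.sqrt 2)^-1.
Proof. by rewrite /gamma gauss_densityE. Qed.

Let gamma0 : gamma set0 = 0%E. Proof. by rewrite gammaE measure0. Qed.

Let gamma_ge0 A : (0 <= gamma A)%E. Proof. by rewrite gammaE measure_ge0. Qed.

Let gamma_sigma_additive : semi_sigma_additive gamma.
Proof. by rewrite gammaE; exact: measure_semi_sigma_additive. Qed.

HB.instance Definition _ := isMeasure.Build _ _ R gamma
  gamma0 gamma_ge0 gamma_sigma_additive.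

Let gamma_setT : gamma [set: _] = 1%E.
Proof. by rewrite gammaE probability_setT. Qed.

HB.instance Definition _ := @Measure_isProbability.Build _ _ R gamma gamma_setT.

Definition theta :
    {measure set (measurableTypeR R * measurableTypeR R * measurableTypeR R)
       -> \bar R} :=
  (gamma \x gamma \x gamma)%E.

End gaussian_measure.
Arguments gauss_density : clear implicits.
Arguments gamma : clear implicits.
Arguments theta : clear implicits.

Section eigenfunctions.
Variable R : realType.

Fixpoint hermite (n : nat) : {poly R} :=
  match n with
  | 0 => 1
  | m.+1 => 2 *: ('X * hermite m)
            - (2 * m)%:R *: (match m with 0 => 0 | k.+1 => hermite k end)
  end.

Lemma hermite1 : hermite 1 = 2 *: 'X.
Proof. by rewrite /= scaler0 subr0 mulr1. Qed.

Lemma hermiteSS n : hermite n.+2 =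
  2 *: ('X * hermite n.+1) - (2 * n.+1)%:R *: hermite n.
Proof. by []. Qed.

Definition eig_a : R := 2 / (3 + Num.sqrt 5).
Definition eig_b : R := 5 `^ 8^-1.
Definition eig_c : R := (Num.sqrt 5 - 1) / 2.
Definition eig_h : R := 5 `^ 4^-1.

Definition lambda (n : nat) : R := eig_a `^ (n%:R + 2^-1).

Definition phi (n : nat) (t : R) : R :=
  eig_b / Num.sqrt ((2 ^ n * n`!)%:R) * expR (- eig_c * t ^+ 2)
  * (hermite n).[eig_h * t].

Definition tau (i : nat * nat * nat) : R :=
  lambda i.1.1 * lambda i.1.2 * lambda i.2.

Definition psi (i : nat * nat * nat) (x : R * R * R) : R :=
  phi i.1.1 x.1.1 * phi i.1.2 x.1.2 * phi i.2 x.2.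

End eigenfunctions.

Section space.
Variable R : realType.

(* The library norm on a product is the sup norm. *)
Definition euclidean_norm (x : R * R * R) : R :=
  Num.sqrt (x.1.1 ^+ 2 + x.1.2 ^+ 2 + x.2 ^+ 2).

Definition gauss_kernel (x y : R * R * R) : R :=
  expR (- euclidean_norm (x - y) ^+ 2).

Definition basis_vector (i : 'I_3) : R * R * R :=
  ((i == 0 :> nat)%:R, (i == 1 :> nat)%:R, (i == 2 :> nat)%:R).

Fixpoint class_C (k : nat) (f : R * R * R -> R) : Prop :=
  continuous f /\
  match k with
  | 0 => True
  | k'.+1 => forall i : 'I_3,
      (forall x, derivable f x (basis_vector i)) /\
      class_C k' (fun x => 'D_(basis_vector i) f x)
  end.

Definition smooth (f : R * R * R -> R) : Prop := forall k, class_C k f.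

End space.

Section probability.
Context d (T : measurableType d) (R : realType) (P : probability T R).

Definition mutually_independent (I : eqType) (X : I -> {RV P >-> R}) : Prop :=
  forall (s : seq I) (A : I -> set R), uniq s ->
    (forall i, measurable (A i)) ->
    P (\bigcap_(i in [set` s]) (X i @^-1` A i)) =
    (\prod_(i <- s) P (X i @^-1` A i))%E.

(* [normal_prob m 0] is not the Dirac mass at [m], hence the case split.  Laws
   are compared on measurable sets only, since the values of a measure outside
   of the sigma-algebra are unspecified. *)
Definition gaussian_variable (X : T -> R) : Prop :=
  measurable_fun setT X /\
  exists m s : R, forall A : set R, measurable A ->
    P (X @^-1` A) = if s == 0 then \d_m A else normal_prob m s A.

Definition standard_gaussian (X : {RV P >-> R}) : Prop :=
  forall A : set R, measurable A -> distribution P X A = normal_prob 0 1 A.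

(* A vector is Gaussian when all the linear combinations of its coordinates
   are Gaussian (possibly degenerate). *)
Definition gaussian_vector (r : nat) (X : 'I_r -> T -> R) : Prop :=
  forall c : 'I_r -> R, gaussian_variable (fun w => \sum_(j < r) c j * X j w).

Definition gaussian_field (E : Type) (U : E -> T -> R) : Prop :=
  forall (r : nat) (x : 'I_r -> E), gaussian_vector (fun j => U (x j)).

Variable Z : nat * nat * nat -> {RV P >-> R}.

Definition partial_sum (N : nat) (x : R * R * R) (w : T) : R :=
  \sum_(m < N.+1) \sum_(n < N.+1) \sum_(p < N.+1)
    Z (m : nat, n : nat, p : nat) w * Num.sqrt (tau R (m : nat, n : nat, p : nat))
    * psi (m : nat, n : nat, p : nat) x.

(* Where the series diverges, [limn] is the default element [point] of [R]:
   a constant value on the exceptional event, so that measurability is kept. *)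
Definition series_field (x : R * R * R) (w : T) : R :=
  limn (fun N => partial_sum N x w).

End probability.

(* Main.v *)
(** The weighted eigenfunctions e_n = sqrt(lambda_n) phi_n satisfy
    sum_n e_n(s) e_n(t) = exp(-(s-t)^2) by Mehler's formula, and Mehler's formula
    on the diagonal also gives the global bound
    |e_n(t)| <= C (9/10)^n exp(t^2/4), whose right-hand side is square
    integrable for gamma.  The relation H_n' = 2n H_(n-1) propagates the geometric
    decay, locally uniformly, to all the derivatives of the e_n.  Since the
    random weight sum_(m,n,p) |Z_(m,n,p)| (19/20)^(m+n+p) has finite
    expectation, it is almost surely finite, and on that event all the pathwise
    claims (convergence everywhere, termwise differentiation,
    domination by an envelope in L_2(theta)) are deterministic.  Finite linear
    combinations of the field are almost sure limits of combinations of
    independent Gaussians, hence Gaussian, with variance the limit given by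
    Mehler's formula; the mean and the covariance follow by polarization. *)

Require Import Defs.
From HB Require Import structures.
From mathcomp Require Import all_boot all_order all_algebra.
From mathcomp Require Import all_classical all_reals all_analysis.
From mathcomp Require Import measurable_realfun ring lra.

Set Implicit Arguments.
Unset Strict Implicit.
Unset Printing Implicit Defensive.
Import Order.TTheory GRing.Theory Num.Theory.
Import numFieldNormedType.Exports.

Local Open Scope classical_set_scope.
Local Open Scope ring_scope.

(** * Power series with radius of convergence at least 1 *)

Section subexponential.
Context {R : realType}.
Implicit Types (u v : nat -> R) (s t r : R).

(** Two constraints fix the numerical constants. The diagonal of Mehler's formula is used at ratio
    1/2, above [eig_a] = (3 - sqrt 5)/2: since 2 [eig_a] < (9/10)^2 some geometric decay remains,
    while the squared bound grows at most like exp(t^2/2), which [gamma] integrates. The ratio 19/20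
    of the random weights exceeds 9/10 strictly, and this gap absorbs the factors in n produced by
    differentiation. Mehler's formula itself comes from a linear differential equation in the ratio:
    the three-term recurrence gives it coefficient by coefficient, and its solution is explicit.
    Laws are compared through integrals of continuous functions with values in [0, 1]: sums of
    independent Gaussians then reduce to completing a square in a double integral, and almost sure
    limits to dominated convergence. A centred law is written as the image of the standard one under
    scaling, which covers zero variance; this case does occur, since combinations of the field with
    repeated points may vanish. *)

Definition subexponential u :=
  forall s, 1 < s -> exists C, forall n, `|u n| <= C * s ^+ n.

Lemma ratio_bound u s (n0 : nat) : 0 < s -> (forall n, 0 <= u n) ->
  (forall n, (n0 <= n)%N -> u n.+1 <= s * u n) ->
  exists C, forall n, u n <= C * s ^+ n.
Proof.
move=> s0 u0 us.
have [C [C0 hC]] : exists C, 0 <= C /\ forall n, (n <= n0)%N -> u n <= C * s ^+ n.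
  elim: n0 {us} => [|k [C [C0 ih]]].
    by exists (u 0); split=> // n; rewrite leqn0 => /eqP ->; rewrite expr0 mulr1.
  exists (C + u k.+1 / s ^+ k.+1); split.
    by rewrite addr_ge0// divr_ge0// exprn_ge0// ltW.
  move=> n; rewrite leq_eqVlt => /orP[/eqP ->|nk].
    rewrite mulrDl divfK ?gt_eqF ?exprn_gt0// lerDr mulr_ge0// exprn_ge0//.
    exact: ltW.
  apply: (le_trans (ih _ nk)); apply: ler_wpM2r; first by rewrite exprn_ge0// ltW.
  by rewrite lerDl divr_ge0// exprn_ge0// ltW.
exists C; elim=> [|n ih]; first exact: hC.
have [nn0|n0n] := leqP n.+1 n0; first exact: hC.
by rewrite (le_trans (us _ _))// exprS mulrCA ler_pM2l.
Qed.

(** Bernoulli's inequality n (s - 1) <= s^n; the explicit constant serves again to absorb factors of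
    order sqrt n. *)
Lemma natr_le_geometric s (n : nat) : 1 < s -> n%:R <= (s - 1)^-1 * s ^+ n.
Proof.
move=> s1; have s10 : 0 < s - 1 by rewrite subr_gt0.
rewrite mulrC ler_pdivlMr//.
elim: n => [|n ih]; first by rewrite mul0r expr0.
rewrite -natr1 mulrDl mul1r exprS.
have : 1 <= s ^+ n by rewrite exprn_ege1// ltW.
nra.
Qed.

(** Each factor is bounded at ratio sqrt s, so that the product gets ratio s. *)
Lemma subexponentialM u v : subexponential u -> subexponential v ->
  subexponential (fun n => u n * v n).
Proof.
move=> hu hv s s1.
have s0 : 0 <= s by rewrite ltW// (lt_trans _ s1).
have rs : 1 < Num.sqrt s by rewrite -(sqrtr1 R) ltr_sqrt// (lt_trans _ s1).
have [C hC] := hu _ rs; have [D hD] := hv _ rs.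
exists (C * D) => n.
rewrite normrM (le_trans (ler_pM _ _ (hC n) (hD n)))// mulrACA -exprD addnn.
by rewrite -mul2n exprM sqr_sqrtr.
Qed.

Lemma subexponential_natr : subexponential (fun n => n%:R).
Proof.
move=> s s1; exists (s - 1)^-1 => n; rewrite normr_nat.
exact: natr_le_geometric.
Qed.

Lemma subexponential_shift u : subexponential u -> subexponential (fun n => u n.+1).
Proof.
move=> hu s s1; have [C hC] := hu s s1; exists (C * s) => n.
by rewrite -mulrA -exprS.
Qed.

Lemma subexponential_diffs u : subexponential u -> subexponential (pseries_diffs u).
Proof.
move=> hu; apply: (@subexponentialM (fun n => n.+1%:R)).
  exact: (subexponential_shift subexponential_natr).
exact: subexponential_shift.
Qed.

Lemma subexponential_cvg u r : subexponential u -> `|r| < 1 -> cvgn (pseries u r).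
Proof.
move=> hu r1.
(* Radii |r| < t < q < 1: growth at ratio q / t bounds |u n| t^n by C q^n, so the series converges
   absolutely at t, hence at the interior point r. *)
pose t := (1 + `|r|) / 2.
have t0 : 0 < t by rewrite /t; have := normr_ge0 r; lra.
have t1 : t < 1 by rewrite /t; lra.
have rt : `|r| < `|t| by rewrite (ger0_norm (ltW t0)) /t; lra.
apply: (is_cvg_pseries_inside _ rt).
pose q := (1 + t) / 2.
have q0 : 0 < q by rewrite /q; lra.
have q1 : q < 1 by rewrite /q; lra.
have tq : t < q by rewrite /q; lra.
have qt : 1 < q / t by rewrite ltr_pdivlMr// mul1r.
have [C hC] := hu _ qt.
apply: normed_cvg; rewrite /normed_series_of /=.
apply: (@series_le_cvg _ _ (geometric C q)) => //=.
- move=> n; rewrite mulr_ge0//; last by rewrite exprn_ge0// ltW.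
  by have := le_trans (normr_ge0 _) (hC 0); rewrite expr0 mulr1.
- move=> n; rewrite normrM (ger0_norm (exprn_ge0 n (ltW t0))).
  apply: (le_trans (ler_wpM2r _ (hC n))); first by rewrite exprn_ge0// ltW.
  by rewrite -mulrA -exprMn divfK ?gt_eqF.
- apply: is_cvg_geometric_series; by rewrite ger0_norm// ltW.
Qed.

End subexponential.

(** * Growth of the normalised Hermite polynomials *)

Section hermite_growth.
Context {R : realType}.
Implicit Types (x y r : R) (n : nat).

Lemma hermite_recurrence n x : (hermite R n.+2).[x] =
  2 * x * (hermite R n.+1).[x] - (2 * n.+1)%:R * (hermite R n).[x].
Proof.
by rewrite hermiteSS hornerD hornerN !hornerZ hornerM hornerX mulrA.
Qed.

Definition hermite_norm2 n : R := (2 ^ n * n`!)%:R.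

Lemma hermite_norm2S n : hermite_norm2 n.+1 = 2 * n.+1%:R * hermite_norm2 n.
Proof. by rewrite /hermite_norm2 expnS factS !natrM; ring. Qed.

Lemma hermite_norm2_gt0 n : 0 < hermite_norm2 n.
Proof. by rewrite ltr0n muln_gt0 expn_gt0 fact_gt0. Qed.

Definition nhermite n x := (hermite R n).[x] / Num.sqrt (hermite_norm2 n).

Lemma nhermite_recurrence n x : Num.sqrt n.+2%:R * nhermite n.+2 x =
  Num.sqrt 2 * x * nhermite n.+1 x - Num.sqrt n.+1%:R * nhermite n x.
Proof.
rewrite /nhermite hermite_recurrence !hermite_norm2S.
rewrite !(sqrtrM, mulr_ge0)//.
have s0 : Num.sqrt (hermite_norm2 n) != 0.
  by rewrite gt_eqF// sqrtr_gt0 hermite_norm2_gt0.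
have s1 : Num.sqrt n.+1%:R != 0 :> R by rewrite gt_eqF// sqrtr_gt0.
have s2 : Num.sqrt n.+2%:R != 0 :> R by rewrite gt_eqF// sqrtr_gt0.
have t2 : Num.sqrt 2 != 0 :> R by rewrite gt_eqF// sqrtr_gt0.
have -> : 2 * x = Num.sqrt 2 ^+ 2 * x by rewrite sqr_sqrtr.
have -> : (2 * n.+1)%:R = Num.sqrt 2 ^+ 2 * Num.sqrt n.+1%:R ^+ 2 :> R.
  by rewrite !sqr_sqrtr// natrM.
by field; rewrite s0 s1 s2 t2.
Qed.

(** Once the recurrence is solved for [nhermite n.+2 x], the factor of [nhermite n.+1 x] tends to 0
    and that of [nhermite n x] is at most 1 in absolute value, so the maximum of two consecutive
    terms eventually grows by a factor at most s. *)
Lemma nhermite_subexponential x : subexponential (nhermite ^~ x).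
Proof.
move=> s s1.
pose m n := Num.max `|nhermite n x| `|nhermite n.+1 x|.
have s10 : 0 < s - 1 by rewrite subr_gt0.
have s0 : 0 < s by rewrite (lt_trans _ s1).
(* As soon as sqrt(n + 2) >= K, the factor sqrt 2 |x| / sqrt(n + 2) is at most s - 1, and both terms
   together contribute at most s. *)
pose K := Num.sqrt 2 * `|x| / (s - 1).
have K0 : 0 <= K by rewrite divr_ge0 ?mulr_ge0 ?sqrtr_ge0// ltW.
have m0 n : 0 <= m n by rewrite le_max normr_ge0.
have ms n : ((Num.truncn (K ^+ 2)).+1 <= n)%N -> m n.+1 <= s * m n.
  move=> hn.
  have Kn : K <= Num.sqrt n.+2%:R.
    rewrite -[leLHS]ger0_norm// -sqrtr_sqr ler_sqrt// ltW//.
    apply: lt_le_trans (truncnS_gt _) _.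
    by rewrite ler_nat (leq_trans hn)// -addn2 leq_addr.
  have q0 : 0 < Num.sqrt n.+2%:R :> R by rewrite sqrtr_gt0.
  have mn1 : `|nhermite n.+1 x| <= m n by rewrite le_max lexx orbT.
  have mn0 : `|nhermite n x| <= m n by rewrite le_max lexx.
  have h2 : `|nhermite n.+2 x| <= s * m n.
    rewrite -(ler_pM2l q0) -{1}(ger0_norm (ltW q0)) -normrM nhermite_recurrence.
    apply: le_trans (ler_normB _ _) _.
    rewrite (normrM (Num.sqrt 2 * x)) (normrM (Num.sqrt 2)) (normrM (Num.sqrt n.+1%:R)).
    rewrite !(ger0_norm (sqrtr_ge0 _)).
    have e1 : Num.sqrt 2 * `|x| <= (s - 1) * Num.sqrt n.+2%:R.
      by rewrite [leRHS]mulrC -ler_pdivrMr.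
    have e2 : Num.sqrt n.+1%:R <= Num.sqrt n.+2%:R :> R by rewrite ler_sqrt// ler_nat.
    have e3 : 0 <= Num.sqrt n.+1%:R :> R by [].
    have e4 : 0 <= Num.sqrt 2 * `|x| by rewrite mulr_ge0.
    have := ler_pM e4 (normr_ge0 _) e1 mn1.
    have := ler_pM e3 (normr_ge0 _) e2 mn0.
    by lra.
  have -> : m n.+1 = Num.max `|nhermite n.+1 x| `|nhermite n.+2 x| by [].
  by rewrite ge_max h2 andbT (le_trans mn1)// ler_peMl// ltW.
have [C hC] := ratio_bound s0 m0 ms.
by exists C => n; apply: le_trans (hC n); rewrite le_max lexx.
Qed.

End hermite_growth.

(** * Mehler's formula: the recurrence of the coefficients *)

Section mehler.
Context {R : realType}.
Implicit Types (x y r : R) (n : nat).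

Definition mehler_coef x y n : R := nhermite n x * nhermite n y.

Lemma mehler_coef_subexponential x y : subexponential (mehler_coef x y).
Proof.
by apply: subexponentialM; exact: nhermite_subexponential.
Qed.

Lemma mehler_coefE x y n :
  mehler_coef x y n = (hermite R n).[x] * (hermite R n).[y] / hermite_norm2 n.
Proof.
rewrite /mehler_coef /nhermite mulrACA -invfM -expr2 sqr_sqrtr//.
Qed.

Local Notation u := (mehler_coef _ _).

Let hermiteE0 x : (hermite R 0).[x] = 1. Proof. by rewrite /= hornerC. Qed.
Let hermiteE1 x : (hermite R 1).[x] = 2 * x.
Proof. by rewrite hermite1 hornerZ hornerX. Qed.
Let norm2E0 : hermite_norm2 0 = 1 :> R. Proof. by rewrite /hermite_norm2. Qed.

(* The coefficient form of the differential equation, in the variable r,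
   (1 - r^2)^2 M' = (r (1 - r^2) + 2 x y (1 + r^2) - 2 r (x^2 + y^2)) M
   satisfied by both sides of Mehler's formula. *)
Lemma mehler_coef_rec x y n :
  n.+4%:R * mehler_coef x y n.+4 - 2 * n.+2%:R * mehler_coef x y n.+2
    + n%:R * mehler_coef x y n =
  mehler_coef x y n.+2 - mehler_coef x y n
  + 2 * x * y * (mehler_coef x y n.+3 + mehler_coef x y n.+1)
  - 2 * (x ^+ 2 + y ^+ 2) * mehler_coef x y n.+2.
Proof.
rewrite !mehler_coefE !hermite_norm2S.
rewrite !(hermite_recurrence n.+2) !(hermite_recurrence n.+1) !(hermite_recurrence n).
have := lt0r_neq0 (hermite_norm2_gt0 (R := R) n).
move: (hermite_norm2 n) (hermite R n.+1).[x] (hermite R n.+1).[y]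
  (hermite R n).[x] (hermite R n).[y] => N a b c e N0.
rewrite !natrM -[n.+4]addn4 -[n.+3]addn3 -[n.+2]addn2 -[n.+1]addn1 !natrD.
have n0 : 0 <= n%:R :> R by [].
move: (n%:R : R) n0 => k k0.
have k1 : k + 1 != 0 by rewrite gt_eqF//; lra.
have k2 : k + 2 != 0 by rewrite gt_eqF//; lra.
have k3 : k + 3 != 0 by rewrite gt_eqF//; lra.
have k4 : k + 4 != 0 by rewrite gt_eqF//; lra.
by field; rewrite N0 k1 k2 k3 k4.
Qed.

(** The differential equation in degrees 0, 1 and 2, where [mehler_coef_rec] would call for
    coefficients of negative index. *)
Lemma mehler_coef_small x y :
  [/\ mehler_coef x y 0 = 1, mehler_coef x y 1 = 2 * x * y,
   2 * mehler_coef x y 2 = mehler_coef x y 0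
     + 2 * x * y * mehler_coef x y 1 - 2 * (x ^+ 2 + y ^+ 2) * mehler_coef x y 0 &
   3 * mehler_coef x y 3 - 2 * mehler_coef x y 1 = mehler_coef x y 1
     + 2 * x * y * (mehler_coef x y 2 + mehler_coef x y 0)
     - 2 * (x ^+ 2 + y ^+ 2) * mehler_coef x y 1].
Proof.
rewrite !mehler_coefE !hermite_norm2S !(hermite_recurrence 1) !(hermite_recurrence 0).
rewrite !hermiteE1 !hermiteE0 norm2E0.
by split; field.
Qed.

(** The indices are such that every product with a power of r is cut at degree N + 3: the
    differential equation then holds exactly between partial sums, with no remainder and no Cauchy
    product. *)
Lemma mehler_partial x y r N :
  let A n := series (fun k => mehler_coef x y k * r ^+ k) n in
  let B n := series (fun k => pseries_diffs (mehler_coef x y) k * r ^+ k) n in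
  B N.+4 - 2 * r ^+ 2 * B N.+2 + r ^+ 4 * B N =
  r * A N.+3 - r ^+ 3 * A N.+1 + 2 * x * y * (A N.+4 + r ^+ 2 * A N.+2)
  - 2 * r * (x ^+ 2 + y ^+ 2) * A N.+3.
Proof.
move=> A B.
have AS n : A n.+1 = A n + mehler_coef x y n * r ^+ n.
  by rewrite /A /series/= big_nat_recr.
have BS n : B n.+1 = B n + n.+1%:R * mehler_coef x y n.+1 * r ^+ n.
  by rewrite /B /series/= big_nat_recr.
elim: N => [|N ih].
  have A0 : A 0 = 0 by rewrite /A /series/= big_geq.
  have B0 : B 0 = 0 by rewrite /B /series/= big_geq.
  have := mehler_coef_rec x y 0.
  have [u0 u1 u2 u3] := mehler_coef_small x y.
  rewrite [0%:R]mulr0n mul0r addr0 => u4.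
  rewrite !AS !BS A0 B0 !add0r.
  move: u0 u1 u2 u3 u4; move: (mehler_coef x y 0) (mehler_coef x y 1)
    (mehler_coef x y 2) (mehler_coef x y 3) (mehler_coef x y 4).
  move=> c0 c1 c2 c3 c4 -> -> u2 u3 u4.
  (* The identities of degrees 3, 2 and 1 are solved for c4, c3 and c2; what is left is a polynomial
     identity in x, y and r. *)
  have -> : c4 = (2 * 2 * c2 + (c2 - 1 + 2 * x * y * (c3 + 2 * x * y)
     - 2 * (x ^+ 2 + y ^+ 2) * c2)) / 4.
    by rewrite -[c4](mulKf (_ : 4 != 0))// mulrC; congr (_ * _); lra.
  have -> : c3 = (3 * (2 * x * y) + 2 * x * y * (c2 + 1)
     - 2 * (x ^+ 2 + y ^+ 2) * (2 * x * y)) / 3.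
    by rewrite -[c3](mulKf (_ : 3 != 0))// mulrC; congr (_ * _); lra.
  have -> : c2 = (1 + 2 * x * y * (2 * x * y) - 2 * (x ^+ 2 + y ^+ 2) * 1) / 2.
    by rewrite -[c2](mulKf (_ : 2 != 0))// mulrC; congr (_ * _); lra.
  by field.
move: ih; rewrite !AS !BS.
have := mehler_coef_rec x y N.+1.
move: (mehler_coef x y N.+1) (mehler_coef x y N.+2) (mehler_coef x y N.+3)
  (mehler_coef x y N.+4) => a b c e h.
have -> : N.+4.+1%:R * mehler_coef x y N.+4.+1 = 2 * N.+3%:R * c - N.+1%:R * a
  + (c - a + 2 * x * y * (e + b) - 2 * (x ^+ 2 + y ^+ 2) * c).
  by rewrite -h; ring.
rewrite !exprS.
move: (r ^+ N) (A N) (B N) => q A0 B0 ih.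
move: ih => /eqP; rewrite -subr_eq0 => /eqP ih.
by apply/eqP; rewrite -subr_eq0 -ih; apply/eqP; ring.
Qed.

End mehler.

(** * Mehler's formula: summation of the series *)

Section mehler_sum.
Context {R : realType}.
Variables x y : R.
Implicit Types r : R.

Let u := mehler_coef x y.
Let M r := limn (pseries u r).
Let M' r := limn (pseries (pseries_diffs u) r).
Let usub : subexponential u. Proof. exact: mehler_coef_subexponential. Qed.

Let cvgM0 r : `|r| < 1 -> pseries u r @ \oo --> M r.
Proof. by move=> r1; exact: (subexponential_cvg usub r1). Qed.

Let cvgM1 r : `|r| < 1 -> pseries (pseries_diffs u) r @ \oo --> M' r.
Proof. by move=> r1; exact: (subexponential_cvg (subexponential_diffs usub) r1). Qed.

Let derM r : `|r| < 1 -> is_derive r 1 M (M' r).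
Proof.
move=> r1; pose K := (1 + `|r|) / 2.
have r0 := normr_ge0 r.
have K0 : 0 <= K by rewrite /K; lra.
have K1 : `|K| < 1 by rewrite ger0_norm// /K; lra.
apply: (@pseries_snd_diffs _ u K).
- exact: subexponential_cvg.
- by apply: subexponential_cvg => //; exact: subexponential_diffs.
- by apply: subexponential_cvg => //; do 2 apply: subexponential_diffs.
- by rewrite (ger0_norm K0) /K; lra.
Qed.

Let ode r : `|r| < 1 -> (1 - r ^+ 2) ^+ 2 * M' r =
  (r * (1 - r ^+ 2) + 2 * x * y * (1 + r ^+ 2) - 2 * r * (x ^+ 2 + y ^+ 2)) * M r.
Proof.
move=> r1.
pose A n := pseries u r n; pose B n := pseries (pseries_diffs u) r n.
have sh (f : nat -> R) (l : R) : f @ \oo --> l -> (fun n => f n.+1) @ \oo --> l.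
  by move=> h; rewrite cvg_shiftS.
have A0 := cvgM0 r1; have B0 := cvgM1 r1.
have A1 := sh _ _ A0; have A2 := sh _ _ A1; have A3 := sh _ _ A2.
have A4 := sh _ _ A3.
have B2 := sh _ _ (sh _ _ B0); have B4 := sh _ _ (sh _ _ B2).
(* The limit of L is computed twice, from its definition and from [mehler_partial]; its uniqueness
   gives the equation. *)
pose L n := B n.+4 - 2 * r ^+ 2 * B n.+2 + r ^+ 4 * B n.
have L1 : L @ \oo --> M' r - 2 * r ^+ 2 * M' r + r ^+ 4 * M' r.
  apply: cvgD; [apply: cvgB|]; [exact: B4| |]; (apply: cvgM; first exact: cvg_cst).
    exact: B2.
  exact: B0.
have L2 : L @ \oo --> r * M r - r ^+ 3 * M r + 2 * x * y * (M r + r ^+ 2 * M r)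
  - 2 * r * (x ^+ 2 + y ^+ 2) * M r.
  have -> : L = fun n => r * A n.+3 - r ^+ 3 * A n.+1
      + 2 * x * y * (A n.+4 + r ^+ 2 * A n.+2)
      - 2 * r * (x ^+ 2 + y ^+ 2) * A n.+3.
    by apply/funext => n; exact: mehler_partial.
  apply: cvgB; [apply: cvgD; [apply: cvgB|]|].
  - by apply: cvgM; [exact: cvg_cst|exact: A3].
  - by apply: cvgM; [exact: cvg_cst|exact: A1].
  - apply: cvgM; first exact: cvg_cst.
    by apply: cvgD; [exact: A4|apply: cvgM; [exact: cvg_cst|exact: A2]].
  - by apply: cvgM; [exact: cvg_cst|exact: A3].
have := cvg_lim (@norm_hausdorff _ _) L1.
rewrite (cvg_lim (@norm_hausdorff _ _) L2) => h.
have -> : (1 - r ^+ 2) ^+ 2 * M' r = M' r - 2 * r ^+ 2 * M' r + r ^+ 4 * M' r by ring.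
by rewrite -h; ring.
Qed.

(** Exponent of the Mehler kernel. Its derivative in r accounts for the terms in x and y of the
    differential equation; the remaining term r (1 - r^2) comes from the factor (1 - r^2)^(-1/2). *)
Definition mehler_exponent r :=
  (2 * r * x * y - r ^+ 2 * (x ^+ 2 + y ^+ 2)) / (1 - r ^+ 2).

Let derQ r : `|r| < 1 -> is_derive r 1 mehler_exponent
  ((2 * x * y * (1 + r ^+ 2) - 2 * r * (x ^+ 2 + y ^+ 2)) / (1 - r ^+ 2) ^+ 2).
Proof.
move=> r1.
have r2 : r ^+ 2 < 1.
  by rewrite -real_normK ?num_real// expr_lt1// .
have d0 : 1 - r ^+ 2 != 0 by rewrite gt_eqF// subr_gt0.
have dP : is_derive r (1 : R) (fun r => 2 * r * x * y - r ^+ 2 * (x ^+ 2 + y ^+ 2))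
    (2 * x * y - 2 * r * (x ^+ 2 + y ^+ 2)).
  have -> : (fun r => 2 * r * x * y - r ^+ 2 * (x ^+ 2 + y ^+ 2)) =
    horner ((2 * x * y) *: 'X - (x ^+ 2 + y ^+ 2) *: 'X^2).
    apply/funext => t; rewrite !(hornerD, hornerN, hornerZ, hornerX, hornerXn); ring.
  apply: is_derive_eq; rewrite !(derivB, derivZ, derivX, derivXn, derivC, hornerD, hornerN, hornerMn, hornerZ, hornerX, hornerXn, hornerC)/=; ring.
have dD : is_derive r (1 : R) (fun r => 1 - r ^+ 2) (- (2 * r)).
  have -> : (fun r => 1 - r ^+ 2) = horner (1 - 'X^2 : {poly R}).
    by apply/funext => t; rewrite !(hornerD, hornerN, hornerXn, hornerC).
  apply: is_derive_eq; rewrite !(derivB, derivZ, derivX, derivXn, derivC, hornerD, hornerN, hornerMn, hornerZ, hornerX, hornerXn, hornerC)/=; ring.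
have dV := is_deriveV (f := fun r => 1 - r ^+ 2) d0 dD.
apply: (is_derive_eq (is_deriveM dP dV)).
rewrite /GRing.scale/=.
by field.
Qed.

(** By [ode], the quotient of M by the closed form has zero derivative, hence keeps its value at r =
    0. *)
Let mehler_const r : 0 <= r < 1 ->
  M r * (Num.sqrt (1 - r ^+ 2) * expR (- mehler_exponent r)) = 1.
Proof.
move=> /andP[r0 r1].
pose f t := M t * (Num.sqrt (1 - t ^+ 2) * expR (- mehler_exponent t)).
have df t : `|t| < 1 -> is_derive t (1 : R) f 0.
  move=> t1.
  have t2 : t ^+ 2 < 1 by rewrite -real_normK ?num_real// expr_lt1.
  have d0 : 0 < 1 - t ^+ 2 by rewrite subr_gt0.
  have dD : is_derive t (1 : R) (fun r => 1 - r ^+ 2) (- (2 * t)).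
    have -> : (fun r => 1 - r ^+ 2) = horner (1 - 'X^2 : {poly R}).
      by apply/funext => s; rewrite !(hornerD, hornerN, hornerXn, hornerC).
    apply: is_derive_eq; rewrite !(derivB, derivZ, derivX, derivXn, derivC, hornerD, hornerN, hornerMn, hornerZ, hornerX, hornerXn, hornerC)/=; ring.
  have dS := @is_derive1_comp _ Num.sqrt (fun r => 1 - r ^+ 2) t _ _
    (is_derive1_sqrt d0) dD.
  have dE := @is_derive1_comp _ expR (fun r => - mehler_exponent r) t _ _
    (is_derive_expR _) (is_deriveN (derQ t1)).
  apply: (is_derive_eq (is_deriveM (derM t1) (is_deriveM dS dE))).
  rewrite /GRing.scale/=.
  rewrite [X in X * M' t](_ : _ = Num.sqrt (1 - t ^+ 2) * expR (- mehler_exponent t))//.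
  have q0 : Num.sqrt (1 - t ^+ 2) != 0 by rewrite gt_eqF// sqrtr_gt0.
  have q2 : 1 - t ^+ 2 = Num.sqrt (1 - t ^+ 2) ^+ 2 by rewrite sqr_sqrtr// ltW.
  have -> : M' t = (t * (1 - t ^+ 2) + 2 * x * y * (1 + t ^+ 2)
    - 2 * t * (x ^+ 2 + y ^+ 2)) * M t / (1 - t ^+ 2) ^+ 2.
    by rewrite -(ode t1) mulrAC mulfV ?mul1r// expf_neq0// gt_eqF.
  move: (Num.sqrt _) q0 q2 (expR _) => q q0 -> E.
  by field.
have [] := @MVT_segment _ f (fun=> 0) 0 r r0.
- move=> t; rewrite in_itv/= => /andP[t0 tr]; apply: df.
  by rewrite ger0_norm ?ltW// (lt_trans tr).
- apply: derivable_within_continuous => t; rewrite in_itv/= => /andP[t0 tr].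
  have /df H : `|t| < 1 by rewrite ger0_norm// (le_lt_trans tr).
  exact: ex_derive.
move=> c _; rewrite mul0r => /eqP; rewrite subr_eq0 => /eqP fr.
rewrite -/(f r) fr /f /mehler_exponent.
have -> : M 0 = 1.
  (* The partial sum of index 0 is empty; all later ones equal the constant coefficient 1, because
     0^0 = 1. *)
  apply/cvg_lim => //; rewrite -cvg_shiftS /=.
  have -> : (fun n => pseries u 0 n.+1) = cst 1; last exact: cvg_cst.
  apply/funext => n; rewrite /pseries /series/= big_nat_recl// big1 => [|i _].
    by rewrite expr0 mulr1 addr0 /u; have [] := mehler_coef_small x y.
  by rewrite exprS mul0r mulr0.
by rewrite !(expr0n, mulr0, mul0r, subr0, oppr0, sqrtr1, expR0, mulr1).
Qed.

Lemma mehler r : 0 <= r < 1 -> pseries (mehler_coef x y) r @ \oo -->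
  (Num.sqrt (1 - r ^+ 2))^-1 * expR (mehler_exponent r).
Proof.
move=> /andP[r0 r1]; have /mehler_const h : 0 <= r < 1 by rewrite r0.
suff -> : (Num.sqrt (1 - r ^+ 2))^-1 * expR (mehler_exponent r) = M r.
  by apply: cvgM0; rewrite ger0_norm.
have q0 : Num.sqrt (1 - r ^+ 2) != 0.
  by rewrite gt_eqF// sqrtr_gt0 subr_gt0 expr_lt1.
have E0 : expR (- mehler_exponent r) != 0 by rewrite gt_eqF// expR_gt0.
by rewrite -[RHS](mulfK (mulf_neq0 q0 E0)) h mul1r invfM -expRN opprK.
Qed.

End mehler_sum.

(** * The constants and the expansion of the one-dimensional kernel *)

Section constants.
Context {R : realType}.
Local Notation w := (Num.sqrt 5 : R).
Local Notation a := (eig_a R).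
Local Notation b := (eig_b R).
Local Notation c := (eig_c R).
Local Notation h := (eig_h R).

Lemma sqrt5_sqr : w ^+ 2 = 5. Proof. by rewrite sqr_sqrtr. Qed.

Lemma sqrt5_bounds : 22 / 10 < w < 23 / 10.
Proof.
have w0 : 0 <= w by [].
have := sqrt5_sqr => w2.
by apply/andP; split; rewrite -(ltr_pXn2r (n := 2))// ?nnegrE//; lra.
Qed.

Lemma eig_aE : a = (3 - w) / 2.
Proof.
have /andP[w1 w2] := sqrt5_bounds; have w3 := sqrt5_sqr.
have w4 : 3 + w != 0 by apply: lt0r_neq0; lra.
rewrite /eig_a; apply/eqP; rewrite eqr_div//.
by apply/eqP; lra.
Qed.

Lemma eig_c_gt0 : 0 < c.
Proof. by have /andP[] := sqrt5_bounds; rewrite /eig_c; lra. Qed.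

(** As c is the square root of a, the half-integer powers in [lambda] become a^n c. *)
Lemma eig_c_sqr : c ^+ 2 = a.
Proof. by have := sqrt5_sqr; rewrite eig_aE /eig_c; lra. Qed.

Lemma eig_h_gt0 : 0 < h. Proof. by rewrite powR_gt0. Qed.

Lemma eig_b_gt0 : 0 < b. Proof. by rewrite powR_gt0. Qed.

Lemma eig_b_sqr : b ^+ 2 = h.
Proof.
rewrite /eig_b /eig_h -powR_mulrn ?powR_ge0// -powRrM; congr (_ `^ _).
by field.
Qed.

Lemma eig_h_sqr : h ^+ 2 = w.
Proof.
rewrite /eig_h -powR_mulrn ?powR_ge0// -powRrM -powR12_sqrt//; congr (_ `^ _).
by field.
Qed.

Lemma lambdaE n : lambda R n = a ^+ n * c.
Proof.
have a0 : 0 < a by rewrite -eig_c_sqr exprn_gt0// eig_c_gt0.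
rewrite /lambda powRD; last by rewrite (gt_eqF a0) implybT.
rewrite powR_mulrn ?ltW// powR12_sqrt ?ltW// -eig_c_sqr sqrtr_sqr ger0_norm//.
by rewrite ltW// eig_c_gt0.
Qed.

Lemma phiE n (t : R) : phi n t = b * expR (- c * t ^+ 2) * nhermite n (h * t).
Proof. by rewrite /phi /nhermite; rewrite -/(hermite_norm2 n); ring. Qed.

Lemma seriesZ (k : R) (f : nat -> R) (l : R) : series f @ \oo --> l ->
  series (fun n => k * f n) @ \oo --> k * l.
Proof.
move=> fl; have -> : series (fun n => k * f n) = fun n => k * series f n.
  by apply/funext => n; rewrite /series/= mulr_sumr.
by apply: cvgM => //; exact: cvg_cst.
Qed.

Lemma kernel_expansion (s t : R) :
  series (fun n => lambda R n * phi n s * phi n t) @ \oo --> expR (- (s - t) ^+ 2).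
Proof.
have /andP[w1 w2] := sqrt5_bounds; have w3 := sqrt5_sqr.
have c0 := eig_c_gt0; have h0 := eig_h_gt0.
have a01 : 0 <= a < 1 by rewrite eig_aE; apply/andP; split; lra.
have /(@seriesZ (c * h * expR (- c * s ^+ 2) * expR (- c * t ^+ 2)) _ _) :=
  @mehler _ (h * s) (h * t) _ a01.
(* Thanks to this identity the factor b^2 c = h c of the summands cancels the square root in
   Mehler's formula. *)
have a1 : 1 - a ^+ 2 = (h * c) ^+ 2.
  by rewrite [RHS]exprMn eig_h_sqr eig_c_sqr !eig_aE; lra.
rewrite a1 sqrtr_sqr ger0_norm; last by rewrite mulr_ge0 ?ltW.
set F := fun n => _; set G := fun n => _.
have -> : F = G.
  apply/funext => n; rewrite /F /G lambdaE !phiE /mehler_coef /=.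
  move: (nhermite n (h * s)) (nhermite n (h * t)) => x y.
  by rewrite -eig_b_sqr; ring.
set l := (X in _ --> X -> _); suff -> : l = expR (- (s - t) ^+ 2) by [].
have a0 : a != 0 by rewrite -eig_c_sqr expf_neq0// gt_eqF.
have wn0 : w != 0 by apply: lt0r_neq0; lra.
(* Since h^2 = sqrt 5 and (h c)^2 = a sqrt 5, the Mehler exponent is 2 s t - a (s^2 + t^2), and a +
   c = 1 completes the square. *)
have -> : - (s - t) ^+ 2 = - c * s ^+ 2 + - c * t ^+ 2
    + mehler_exponent (h * s) (h * t) a.
  rewrite /mehler_exponent a1 [(h * c) ^+ 2]exprMn eig_c_sqr.
  have -> : 2 * a * (h * s) * (h * t) - a ^+ 2 * ((h * s) ^+ 2 + (h * t) ^+ 2) =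
    a * h ^+ 2 * (2 * s * t - a * (s ^+ 2 + t ^+ 2)) by ring.
  rewrite eig_h_sqr [w * a]mulrC mulrAC mulfV ?mulf_neq0// mul1r eig_aE /eig_c.
  by field.
rewrite !expRD /l.
move: (expR _) (expR _) (expR _) => A B C; field.
by rewrite !gt_eqF.
Qed.

(** On the diagonal the summands of Mehler's formula are nonnegative, so a single one is at most the
    sum. Ratio 1/2 bounds the squared normalised Hermite polynomial at h t by D 2^n exp((2/3) sqrt 5
    t^2); the constants of the statement then follow from 2 a <= (9/10)^2 and (2/3) sqrt 5 - 2 c <=
    1/2. *)
Lemma weighted_phi_bound : exists2 C : R, 0 <= C & forall n (t : R),
  Num.sqrt (lambda R n) * `|phi n t| <= C * (9 / 10) ^+ n * expR (t ^+ 2 / 4).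
Proof.
have /andP[w1 w2] := sqrt5_bounds; have w3 := sqrt5_sqr.
have c0 := eig_c_gt0; have h0 := eig_h_gt0; have b0 := eig_b_gt0.
pose D : R := (Num.sqrt (1 - 2^-1 ^+ 2))^-1.
have D0 : 0 <= D by rewrite invr_ge0.
have nh n t : nhermite n (h * t) ^+ 2 <= D * 2 ^+ n * expR (2 / 3 * w * t ^+ 2).
  have r01 : 0 <= (2^-1 : R) < 1 by apply/andP; split; lra.
  have := @mehler _ (h * t) (h * t) _ r01.
  have -> : mehler_exponent (h * t) (h * t) 2^-1 = 2 / 3 * w * t ^+ 2.
    have d : 1 - 2^-1 ^+ 2 = 3 / 4 :> R by field.
    by rewrite /mehler_exponent -eig_h_sqr d; field.
  rewrite -/D => hM.
  have nd : nondecreasing_seq (pseries (mehler_coef (h * t) (h * t)) 2^-1).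
    apply/nondecreasing_seqP => k; rewrite /pseries /series/= big_nat_recr//=.
    by rewrite lerDl mulr_ge0// /mehler_coef -expr2 sqr_ge0.
  have := nondecreasing_cvgn_le nd (cvgP _ hM) n.+1.
  rewrite (cvg_lim _ hM)// => hl.
  rewrite mulrAC -ler_pdivrMr ?exprn_gt0//; apply: le_trans hl.
  rewrite /pseries /series/= big_nat_recr//= /mehler_coef -expr2 -exprVn.
  rewrite lerDr sumr_ge0// => k _.
  by rewrite mulr_ge0// -expr2 sqr_ge0.
have K0 : 0 <= c * h * D by apply: mulr_ge0 => //; apply: mulr_ge0; exact: ltW.
exists (Num.sqrt (c * h * D)) => [|n t]; first exact: sqrtr_ge0.
have lam0 : 0 <= lambda R n by rewrite powR_ge0.
rewrite -(ler_pXn2r (n := 2))// ?nnegrE ?mulr_ge0 ?exprn_ge0 ?expR_ge0//.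
have -> : (Num.sqrt (lambda R n) * `|phi n t|) ^+ 2 =
    a ^+ n * c * (h * expR (2%:R * (- c * t ^+ 2)) * nhermite n (h * t) ^+ 2).
  rewrite [LHS]exprMn sqr_sqrtr// real_normK ?num_real// lambdaE phiE.
  move: (nhermite n (h * t)) => x.
  by rewrite -eig_b_sqr expRM_natl; ring.
have -> : (Num.sqrt (c * h * D) * (9 / 10) ^+ n * expR (t ^+ 2 / 4)) ^+ 2 =
    c * h * D * (9 / 10) ^+ n ^+ 2 * expR (2%:R * (t ^+ 2 / 4)).
  by rewrite -[in RHS](sqr_sqrtr K0) expRM_natl; ring.
have e1 : (expR (2%:R * (- c * t ^+ 2)) * expR (2 / 3 * w * t ^+ 2) <=
  expR (2%:R * (t ^+ 2 / 4)) :> R).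
  rewrite -expRD ler_expR /eig_c.
  by have := sqr_ge0 t; nra.
have e2 : (a * 2) ^+ n <= (9 / 10) ^+ n ^+ 2 :> R.
  by rewrite -exprM mulnC exprM; apply: lerXn2r; rewrite ?nnegrE ?eig_aE; lra.
have e3 := nh n t.
have a0 : 0 <= a by rewrite eig_aE; lra.
rewrite [(a * 2) ^+ n]exprMn in e2.
have an0 : 0 <= a ^+ n by rewrite exprn_ge0.
have tn0 : 0 <= 2 ^+ n :> R by rewrite exprn_ge0.
move: e1 e2 e3 K0 (expR_ge0 (2%:R * (- c * t ^+ 2))) (expR_ge0 (2 / 3 * w * t ^+ 2)).
move: (expR (2%:R * (- c * t ^+ 2))) (expR (2 / 3 * w * t ^+ 2)) (expR (2%:R * (t ^+ 2 / 4)))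
  (nhermite _ _ ^+ 2) (a ^+ n) ((9 / 10) ^+ n ^+ 2)
  (2 ^+ n) an0 tn0 => E1 E2 E3 x p q r p0 r0 e1 e2 e3 K0 E10 E20.
apply: (@le_trans _ _ (p * c * (h * E1 * (D * r * E2)))).
  apply: ler_wpM2l; first by rewrite mulr_ge0// ltW.
  by apply: ler_wpM2l => //; rewrite mulr_ge0// ltW.
have -> : p * c * (h * E1 * (D * r * E2)) = c * h * D * ((p * r) * (E1 * E2)) by ring.
rewrite -[leRHS]mulrA; apply: ler_wpM2l => //.
by apply: ler_pM => //; exact: mulr_ge0.
Qed.

End constants.

(** * Differentiation of Hermite polynomials and of Gaussians times polynomials *)

Section hermite_derivative.
Context {R : realType}.

Lemma deriv_hermite n : (hermite R n.+1)^`() = (2 * n.+1)%:R *: hermite R n.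
Proof.
have step m : (hermite R m.+2)^`() = 2 *: (hermite R m.+1 + 'X * (hermite R m.+1)^`())
    - (2 * m.+1)%:R *: (hermite R m)^`().
  by rewrite hermiteSS derivB !derivZ derivM derivX mul1r.
(* Two consecutive indices are carried together, since the recurrence has order 2. *)
suff : (hermite R n.+1)^`() = (2 * n.+1)%:R *: hermite R n /\
  (hermite R n.+2)^`() = (2 * n.+2)%:R *: hermite R n.+1 by case.
have h0 : (hermite R 1)^`() = (2 * 1)%:R *: hermite R 0.
  by rewrite hermite1 derivZ derivX muln1.
elim: n => [|n [ih1 ih2]]; split => //.
- rewrite step h0 derivC scaler0 subr0 hermite1 -!mul_polyC !polyC_natr.
  by move: ('X : {poly R}) => X; rewrite /= mulr1; ring.
- rewrite step ih1 ih2 (hermiteSS R n) -!mul_polyC !polyC_natr.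
  move: ('X : {poly R}) (hermite R n.+1) (hermite R n) => X p q.
  rewrite !natrM -[n.+3]addn3 -[n.+2]addn2 -[n.+1]addn1 !natrD.
  by move: (n%:R : {poly R}) => m; ring.
Qed.

End hermite_derivative.

Section gauss_deriv.
Context {R : realType} (c : R).
Implicit Types (p q : {poly R}) (t : R) (k : nat).

(* The operator D with (exp(-c t^2) p(t))' = exp(-c t^2) (D p)(t). *)
Definition gauss_deriv p : {poly R} := p^`() - (2 * c) *: ('X * p).

Lemma gauss_derivZ (x : R) p : gauss_deriv (x *: p) = x *: gauss_deriv p.
Proof.
rewrite /gauss_deriv derivZ scalerBr -scalerAr !scalerA.
by rewrite (mulrC x).
Qed.

Lemma gauss_derivB p q : gauss_deriv (p - q) = gauss_deriv p - gauss_deriv q.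
Proof. by rewrite /gauss_deriv derivB mulrBr scalerBr !opprB addrACA [RHS]addrACA; congr (_ + _); rewrite addrC. Qed.

Lemma iter_gauss_derivB k p q : iter k gauss_deriv (p - q) =
  iter k gauss_deriv p - iter k gauss_deriv q.
Proof. by elim: k => //= k ->; rewrite gauss_derivB. Qed.

Lemma iter_gauss_derivZ k (x : R) p :
  iter k gauss_deriv (x *: p) = x *: iter k gauss_deriv p.
Proof. by elim: k => //= k ->; rewrite gauss_derivZ. Qed.

Lemma gauss_derivXM p : gauss_deriv ('X * p) = p + 'X * gauss_deriv p.
Proof.
rewrite /gauss_deriv derivM derivX mul1r mulrBr addrA; congr (_ - _).
by rewrite -scalerAr.
Qed.

Lemma gauss_derivD p q : gauss_deriv (p + q) = gauss_deriv p + gauss_deriv q.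
Proof. by rewrite /gauss_deriv derivD mulrDr scalerDr opprD addrACA. Qed.

(** The operator D = [gauss_deriv] and the multiplication X by the variable satisfy D X - X D = 1;
    iterating this commutation relation produces the factor k + 1. *)
Lemma iter_gauss_derivXM k p : iter k.+1 gauss_deriv ('X * p) =
  'X * iter k.+1 gauss_deriv p + k.+1%:R *: iter k gauss_deriv p.
Proof.
elim: k => [|k ih]; first by rewrite /= gauss_derivXM scale1r addrC.
rewrite iterS ih gauss_derivD gauss_derivXM gauss_derivZ -!iterS.
by rewrite -[k.+2%:R]nat1r scalerDl scale1r -addrA addrCA.
Qed.

Lemma is_derive_gauss_poly p t : is_derive t 1 (fun t => expR (- c * t ^+ 2) * p.[t])
  (expR (- c * t ^+ 2) * (gauss_deriv p).[t]).
Proof.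
have dE : is_derive t (1 : R) (fun t => - c * t ^+ 2) (- c * (2 * t)).
  have -> : (fun t => - c * t ^+ 2) = horner (- c *: 'X^2).
    by apply/funext => s; rewrite !(hornerZ, hornerXn).
  by apply: is_derive_eq; rewrite !(derivZ, derivXn, hornerZ, hornerMn, hornerXn)/=; ring.
have dX := @is_derive1_comp _ expR _ t _ _ (is_derive_expR _) dE.
apply: (is_derive_eq (is_deriveM dX (is_derive_poly p t))).
rewrite /GRing.scale/= /gauss_deriv hornerD hornerN hornerZ hornerM hornerX.
ring.
Qed.

End gauss_deriv.

(** * Derivatives of the eigenfunctions and their geometric decay *)

Section eigenfunction_derivatives.
Context {R : realType}.
Local Notation c := (eig_c R).
Local Notation h := (eig_h R).
Local Notation gauss_deriv := (gauss_deriv c).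
Implicit Types (s t T : R) (k n : nat).

(** The polynomial factor of sqrt(lambda_n) phi_n, the other factor being exp(-c t^2): all the
    derivatives are then computed on polynomials. *)
Definition eigen_poly n : {poly R} :=
  (Num.sqrt (lambda R n) * eig_b R / Num.sqrt (hermite_norm2 n)) *:
  (hermite R n \Po (h *: 'X)).

(* The k-th derivative of sqrt(lambda_n) phi_n. *)
Definition eigen k n t : R :=
  expR (- c * t ^+ 2) * (iter k gauss_deriv (eigen_poly n)).[t].

Lemma eigen0 n t : eigen 0 n t = Num.sqrt (lambda R n) * phi n t.
Proof.
rewrite /eigen /eigen_poly /= hornerZ horner_comp hornerZ hornerX /phi.
rewrite -/(hermite_norm2 n); ring.
Qed.

Lemma is_derive_eigen k n t : is_derive t 1 (eigen k n) (eigen k.+1 n t).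
Proof. exact: is_derive_gauss_poly. Qed.

(** The factor of [eigen_poly n] is h sqrt(lambda_(n+1) / lambda_n) 2 (n + 1) / sqrt(2 (n + 1)), in
    which the first root is sqrt a = c. *)
Lemma gauss_deriv_eigen_polyS n : gauss_deriv (eigen_poly n.+1) =
  (c * h * Num.sqrt (2 * n.+1%:R)) *: eigen_poly n -
  (2 * c) *: ('X * eigen_poly n.+1).
Proof.
rewrite /gauss_deriv; congr (_ - _).
rewrite /eigen_poly derivZ deriv_comp deriv_hermite derivZ derivX.
rewrite comp_polyZ !scalerA -scalerAr mulr1 !scalerA; congr (_ *: _).
rewrite !lambdaE exprS -eig_c_sqr hermite_norm2S.
have c0 := @eig_c_gt0 R; have c20 : 0 <= c ^+ 2 by exact: sqr_ge0.
have N0 := hermite_norm2_gt0 (R := R) n.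
have k0 : 0 <= 2 * n.+1%:R :> R by rewrite mulr_ge0.
rewrite -[c ^+ 2 * _ * c]mulrA (sqrtrM _ c20) (sqrtrM _ k0) sqrtr_sqr (ger0_norm (ltW c0)).
have -> : (2 * n.+1)%:R = Num.sqrt (2 * n.+1%:R) ^+ 2 :> R.
  by rewrite sqr_sqrtr// natrM.
have q0 : Num.sqrt (2 * n.+1%:R) != 0 :> R by rewrite gt_eqF// sqrtr_gt0 mulr_gt0.
have M0 : Num.sqrt (hermite_norm2 n) != 0 :> R by rewrite gt_eqF// sqrtr_gt0.
move: (Num.sqrt (2 * _)) (Num.sqrt (hermite_norm2 n)) (Num.sqrt (_ * c)) q0 M0 => x y z x0 y0.
by field; rewrite x0 y0.
Qed.

Lemma horner_lin (x y z : R) (p q r : {poly R}) t :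
  (x *: p - y *: ('X * q + z *: r)).[t] = x * p.[t] - y * (t * q.[t] + z * r.[t]).
Proof. by rewrite hornerD hornerN !hornerZ hornerD hornerM hornerX hornerZ. Qed.

Lemma eigen1 n t : eigen 1 n.+1 t =
  c * h * Num.sqrt (2 * n.+1%:R) * eigen 0 n t - 2 * c * (t * eigen 0 n.+1 t).
Proof.
have := horner_lin (c * h * Num.sqrt (2 * n.+1%:R)) (2 * c) 0 (eigen_poly n)
  (eigen_poly n.+1) 0 t.
rewrite scale0r addr0 mul0r addr0 -gauss_deriv_eigen_polyS /eigen /= => ->.
by ring.
Qed.

(** One more derivative costs a factor of order sqrt n, a factor t, and a term of lower order that
    comes from differentiating this t. *)
Lemma eigenSS k n t : eigen k.+2 n.+1 t =
  c * h * Num.sqrt (2 * n.+1%:R) * eigen k.+1 n t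
  - 2 * c * (t * eigen k.+1 n.+1 t + k.+1%:R * eigen k n.+1 t).
Proof.
rewrite /eigen iterSr gauss_deriv_eigen_polyS iter_gauss_derivB.
rewrite (iter_gauss_derivZ _ _ (c * h * _)) (iter_gauss_derivZ _ _ (2 * c)).
rewrite iter_gauss_derivXM horner_lin.
by ring.
Qed.

Lemma eigen_bound0 T s : 9 / 10 < s -> exists C : R, forall n t, `|t| <= T ->
  `|eigen 0 n t| <= C * s ^+ n.
Proof.
move=> s9; have [C C0 hC] := @weighted_phi_bound R.
exists (C * expR (T ^+ 2 / 4)) => n t tT.
rewrite eigen0 normrM ger0_norm//; apply: (le_trans (hC n t)).
rewrite [leRHS]mulrAC; apply: ler_pM.
- by rewrite mulr_ge0// exprn_ge0//; lra.
- exact: expR_ge0.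
- apply: ler_wpM2l => //; apply: lerXn2r; rewrite ?nnegrE; lra.
- rewrite ler_expR ler_pM2r ?invr_gt0// -(real_normK (num_real t)).
  by apply: lerXn2r; rewrite ?nnegrE// (le_trans _ tT).
Qed.

(** A slightly larger ratio absorbs the square root: the root is at most 2 (n + 1), and
    [natr_le_geometric] applies with ratio s' / s. *)
Lemma sqrt_geometric_bound (x s s' : R) : 0 <= x -> 0 < s -> s < s' ->
  exists2 C : R, 0 <= C & forall n, x * Num.sqrt (2 * n.+1%:R) * s ^+ n <= C * s' ^+ n.+1.
Proof.
move=> x0 s0 ss'.
have r1 : 1 < s' / s by rewrite ltr_pdivlMr// mul1r.
exists (2 * x / s * (s' / s - 1)^-1).
  rewrite mulr_ge0// ?invr_ge0; last by lra.
  by rewrite divr_ge0// ?mulr_ge0// ltW.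
move=> n.
have e1 : Num.sqrt (2 * n.+1%:R) <= 2 * n.+1%:R :> R.
  rewrite -[leRHS]ger0_norm// -sqrtr_sqr; apply: ler_wsqrtr.
  have : 1 <= n.+1%:R :> R by rewrite ler1n.
  by nra.
have e2 := natr_le_geometric n.+1 r1.
have -> : s' ^+ n.+1 = s * s ^+ n * (s' / s) ^+ n.+1.
  by rewrite -exprS -exprMn mulrC divfK// gt_eqF.
have sn0 : 0 < s ^+ n by rewrite exprn_gt0.
apply: (@le_trans _ _ (x * (2 * n.+1%:R) * s ^+ n)).
  by rewrite ler_pM2r// ler_wpM2l.
have -> : 2 * x / s * (s' / s - 1)^-1 * (s * s ^+ n * (s' / s) ^+ n.+1) =
  x * 2 * s ^+ n * ((s' / s - 1)^-1 * (s' / s) ^+ n.+1).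
  by move: (_ ^+ n.+1) (s' / s - 1)^-1 => u v; field; rewrite gt_eqF.
have -> : x * (2 * n.+1%:R) * s ^+ n = x * 2 * s ^+ n * n.+1%:R by ring.
by rewrite ler_wpM2l// !mulr_ge0// ltW.
Qed.

(** All ratios s > 9/10 are treated at once: each derivative calls for the bound of the previous
    order at a smaller ratio s', and the open range of ratios leaves room for it. *)
Lemma eigen_bound k T s : 9 / 10 < s -> exists C : R, forall n t, `|t| <= T ->
  `|eigen k n t| <= C * s ^+ n.
Proof.
move: s; have [T0|T0] := ltP T 0.
  by move=> s _; exists 0 => n t tT; have := le_trans (normr_ge0 _) tT; lra.
have c0 := @eig_c_gt0 R; have h0 := @eig_h_gt0 R.
(* Both recurrences [eigen1] and [eigenSS] have this shape: v stands for the derivative of order j -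
   1, and for 0 when j = 0. *)
have step j (x y z : R) (v : nat -> R -> R) : 0 <= x -> 0 <= y ->
  (forall n t, eigen j.+1 n.+1 t = x * Num.sqrt (2 * n.+1%:R) * eigen j n t
    - y * (t * eigen j n.+1 t + z * v n.+1 t)) ->
  (forall s, 9 / 10 < s -> exists C : R, forall n t, `|t| <= T ->
     `|eigen j n t| <= C * s ^+ n) ->
  (forall s, 9 / 10 < s -> exists C : R, forall n t, `|t| <= T ->
     `|v n t| <= C * s ^+ n) ->
  (exists C, forall t, `|t| <= T -> `|eigen j.+1 0 t| <= C) ->
  forall s, 9 / 10 < s -> exists C : R, forall n t, `|t| <= T ->
    `|eigen j.+1 n t| <= C * s ^+ n.
  move=> x0 y0 rec hj hv [C3 h3] s s9.
  pose s' := (9 / 10 + s) / 2.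
  have s'9 : 9 / 10 < s' by rewrite /s'; lra.
  have s's : s' < s by rewrite /s'; lra.
  have s'0 : 0 < s' by lra.
  have s0 : 0 < s by lra.
  have [C1 h1] := hj _ s'9; have [C1' h1'] := hj _ s9.
  have [C2 h2] := hv _ s9; have [G G0 hG] := sqrt_geometric_bound x0 s'0 s's.
  exists (`|C3| + `|C1| * G + y * (T * `|C1'| + `|z| * `|C2|)) => n t tT.
  have sn n0 : 0 < s ^+ n0 by rewrite exprn_gt0.
  have Q0 : 0 <= y * (T * `|C1'| + `|z| * `|C2|).
    by rewrite mulr_ge0 ?addr_ge0 ?mulr_ge0.
  case: n => [|n].
    rewrite expr0 mulr1 (le_trans (h3 _ tT))// (le_trans (ler_norm _))//.
    by rewrite -addrA lerDl addr_ge0// mulr_ge0.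
  rewrite rec; apply: (le_trans (ler_normB _ _)).
  rewrite [leRHS]mulrDl; apply: lerD.
    rewrite [leRHS]mulrDl; apply: ler_wpDl; first by rewrite mulr_ge0// ltW.
    have g0 : 0 <= x * Num.sqrt (2 * n.+1%:R) by rewrite mulr_ge0.
    rewrite normrM (ger0_norm g0).
    apply: (@le_trans _ _ (x * Num.sqrt (2 * n.+1%:R) * (`|C1| * s' ^+ n))).
      apply: ler_wpM2l => //; apply: (le_trans (h1 _ _ tT)).
      by rewrite ler_pM2r ?exprn_gt0// ler_norm.
    by rewrite mulrCA -[leRHS]mulrA; apply: ler_wpM2l.
  rewrite normrM (ger0_norm y0).
  rewrite -[leRHS]mulrA; apply: ler_wpM2l => //.
  apply: (le_trans (ler_normD _ _)); rewrite mulrDl (normrM t) (normrM z) -!mulrA.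
  apply: lerD.
    apply: ler_pM => //; apply: (le_trans (h1' _ _ tT)).
    by rewrite ler_pM2r// ler_norm.
  apply: ler_wpM2l => //; apply: (le_trans (h2 _ _ tT)).
  by rewrite ler_pM2r// ler_norm.
have ch0 : 0 <= c * h by apply: mulr_ge0; exact: ltW.
have c20 : 0 <= 2 * c by apply: mulr_ge0 => //; exact: ltW.
(* The recurrences only reach the indices n + 1; at index 0, a polynomial times a Gaussian at most 1
   is bounded on [-T, T]. *)
have base j : exists C, forall t, `|t| <= T -> `|eigen j 0 t| <= C.
  pose p := iter j gauss_deriv (eigen_poly 0).
  exists (\sum_(i < size p) `|p`_i| * T ^+ i) => t tT.
  rewrite /eigen normrM ger0_norm ?expR_ge0// -/p horner_coef.
  apply: (@le_trans _ _ (1 * `|\sum_(i < size p) p`_i * t ^+ i|)).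
    apply: ler_wpM2r => //; rewrite -expR0 ler_expR mulNr oppr_le0.
    by rewrite mulr_ge0 ?sqr_ge0// ltW.
  rewrite mul1r; apply: (le_trans (ler_norm_sum _ _ _)).
  apply: ler_sum => i _; rewrite normrM normrX ler_wpM2l//.
  by apply: lerXn2r; rewrite ?nnegrE.
suff : (forall s, 9 / 10 < s -> exists C : R, forall n t, `|t| <= T ->
    `|eigen k n t| <= C * s ^+ n) /\ (forall s, 9 / 10 < s -> exists C : R,
    forall n t, `|t| <= T -> `|eigen k.+1 n t| <= C * s ^+ n) by case.
elim: k => [|k [ih1 ih2]]; split => //.
- exact: eigen_bound0.
- apply: (step 0 (c * h) (2 * c) 0 (fun _ _ => 0)) => //.
  + by move=> n t; rewrite mulr0 addr0 eigen1.
  + exact: eigen_bound0.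
  + by move=> s _; exists 0 => n t _; rewrite normr0 mul0r.
- apply: (step k.+1 (c * h) (2 * c) k.+1%:R (eigen k)) => //.
  by move=> n t; rewrite eigenSS.
Qed.

End eigenfunction_derivatives.

(** * Cube sums and dominated families *)

Section cube_sums.
Context {R : realType}.
Notation I := (nat * nat * nat)%type.
Implicit Types (g u v w : I -> R) (C : R) (N M : nat).

Definition cube g N : R :=
  \sum_(m < N.+1) \sum_(n < N.+1) \sum_(p < N.+1) g (m : nat, n : nat, p : nat).

Lemma cubeD g u N : cube (fun i => g i + u i) N = cube g N + cube u N.
Proof.
rewrite /cube -big_split/=; apply: eq_bigr => m _.
by rewrite -big_split/=; apply: eq_bigr => n _; rewrite -big_split.
Qed.

Lemma cubeZ (a : R) g N : cube (fun i => a * g i) N = a * cube g N.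
Proof.
rewrite /cube mulr_sumr; apply: eq_bigr => m _.
by rewrite mulr_sumr; apply: eq_bigr => n _; rewrite mulr_sumr.
Qed.

Lemma eq_cube g u N : g =1 u -> cube g N = cube u N.
Proof. by move=> gu; rewrite (funext gu). Qed.

Lemma cube_ge0 g N : (forall i, 0 <= g i) -> 0 <= cube g N.
Proof.
by move=> g0; do 3! (apply: sumr_ge0 => ? _).
Qed.

Lemma cube_nondecreasing g : (forall i, 0 <= g i) -> nondecreasing_seq (cube g).
Proof.
move=> g0; apply/nondecreasing_seqP => N; rewrite /cube [leRHS]big_ord_recr/=.
rewrite ler_wpDr//; first by do 2! (apply: sumr_ge0 => ? _).
apply: ler_sum => m _; rewrite [leRHS]big_ord_recr/= ler_wpDr//.
  by apply: sumr_ge0 => ? _.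
by apply: ler_sum => n _; rewrite [leRHS]big_ord_recr/= ler_wpDr.
Qed.

Variable wt : I -> R.
Hypothesis cvg_wt : cvgn (cube wt).

Definition dominated C g := forall i, `|g i| <= C * wt i.

(* Both C wt + g and C wt - g have nonnegative terms, hence nondecreasing
   cube sums. *)
Lemma dominated_diff C g N M : dominated C g -> (N <= M)%N ->
  `|cube g M - cube g N| <= C * (cube wt M - cube wt N).
Proof.
move=> Cg NM.
have h (e : R) : `|e| <= 1 -> e * (cube g M - cube g N) <= C * (cube wt M - cube wt N).
  move=> e1; rewrite -subr_ge0.
  have /(_ _ _ NM) : nondecreasing_seq (cube (fun i => C * wt i + (- e) * g i)).
    apply: cube_nondecreasing => i; rewrite mulNr subr_ge0.
    apply: le_trans (ler_norm _) _; rewrite normrM.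
    by apply: le_trans (Cg i); rewrite ler_piMl.
  rewrite !cubeD !cubeZ -subr_ge0; congr (0 <= _).
  by move: (cube _ _) (cube _ _) => x y; ring.
rewrite ler_norml; apply/andP; split.
  by have := h (-1); rewrite normrN normr1 lexx => /(_ isT); lra.
by have := h 1; rewrite normr1 lexx => /(_ isT); lra.
Qed.

(** The terms C wt + g lie between 0 and 2 C wt, so their cube sums are nondecreasing and bounded;
    subtracting C wt leaves g. *)
Lemma cube_dominated_cvg C g : dominated C g -> cvgn (cube g).
Proof.
move=> Cg.
have cC : cvgn (fun N => C * cube wt N) by apply: is_cvgM => //; exact: is_cvg_cst.
have cD : cvgn (cube (fun i => C * wt i + g i)).
  apply: nondecreasing_is_cvgn.
    apply: cube_nondecreasing => i; have := Cg i.
    by rewrite ler_norml => /andP[]; lra.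
  have cC2 : cvgn (fun N => 2 * (C * cube wt N)).
    by apply: is_cvgM => //; exact: is_cvg_cst.
  exists (limn (fun N => 2 * (C * cube wt N))) => _ [N _ <-].
  have nd : nondecreasing_seq (fun N => 2 * (C * cube wt N)).
    move=> n m nm; rewrite ler_pM2l// -!cubeZ; move: n m nm.
    by apply: cube_nondecreasing => i; exact: le_trans (Cg i).
  apply: le_trans (nondecreasing_cvgn_le nd cC2 N).
  rewrite cubeD cubeZ mulr_natl mulr2n lerD2l -cubeZ -subr_ge0.
  have <- : cube (fun i => C * wt i + (-1) * g i) N =
      cube (fun i => C * wt i) N - cube g N by rewrite cubeD !cubeZ mulN1r.
  apply: cube_ge0 => i; have := Cg i.
  by rewrite ler_norml => /andP[]; lra.
have -> : cube g = fun N => cube (fun i => C * wt i + g i) N - C * cube wt N.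
  by apply/funext => N; rewrite cubeD cubeZ addrC addKr.
exact: is_cvgB.
Qed.

(** The tail bound depends on g only through C, so a family with a common C converges uniformly; for
    the paths, C carries the envelope. *)
Lemma dominated_lim C g N : dominated C g ->
  `|limn (cube g) - cube g N| <= C * (limn (cube wt) - cube wt N).
Proof.
move=> Cg; have cg := cube_dominated_cvg Cg.
have h1 : `|cube g M - cube g N| @[M --> \oo] --> `|limn (cube g) - cube g N|.
  by apply: cvg_norm; apply: cvgB => //; exact: cvg_cst.
have h2 : C * (cube wt M - cube wt N) @[M --> \oo] --> C * (limn (cube wt) - cube wt N).
  apply: cvgM; first exact: cvg_cst.
  by apply: cvgB => //; exact: cvg_cst.
apply: (ler_cvg_to h1 h2); near=> M.
by apply: dominated_diff => //; near: M; exact: nbhs_infty_ge.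
Unshelve. all: by end_near. Qed.

Lemma dominated_lim_le C g : dominated C g ->
  `|limn (cube g)| <= C * limn (cube wt).
Proof.
move=> Cg; have h := dominated_lim 0 Cg.
have h0 : `|cube g 0| <= C * cube wt 0 by rewrite /cube !big_ord1.
rewrite -[limn (cube g)](subrK (cube g 0)); apply: (le_trans (ler_normD _ _)).
by rewrite mulrBr in h; lra.
Qed.

(** The combination is a first-order Taylor remainder: g and u are the values at two points, v is
    the derivative. *)
Lemma lim_cube_affine (e : R) g u v :
  cvgn (cube g) -> cvgn (cube u) -> cvgn (cube v) ->
  limn (cube g) - limn (cube u) - e * limn (cube v) =
  limn (cube (fun i => g i - u i - e * v i)).
Proof.
move=> cg cu cv.
apply/esym/cvg_lim => //.
have -> : cube (fun i => g i - u i - e * v i) =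
    fun N => cube g N - cube u N - e * cube v N.
  apply/funext => N.
  rewrite -[cube u N]mul1r -!mulNr -!cubeZ -!cubeD; apply: eq_cube => i.
  by rewrite !mulNr mul1r.
by apply: cvgB; [exact: cvgB|apply: cvgM => //; exact: cvg_cst].
Qed.

End cube_sums.

(** * Taylor estimates and criteria of smoothness *)

Section one_variable.
Context {R : realType}.
Implicit Types (f : R -> R) (s t T M : R).

Lemma norm_between t s x T : `|t| <= T -> `|s| <= T -> t <= x <= s -> `|x| <= T.
Proof. by rewrite !ler_norml; lra. Qed.

Lemma lipschitz_of_derivative f f' T M : (forall t, is_derive t 1 f (f' t)) ->
  (forall t, `|t| <= T -> `|f' t| <= M) ->
  forall s t, `|s| <= T -> `|t| <= T -> `|f s - f t| <= M * `|s - t|.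
Proof.
move=> df bf s t; wlog ts : s t / t <= s => [wl sT tT|sT tT].
  have [ts|/ltW st] := leP t s; first exact: wl.
  by rewrite distrC (distrC s); exact: wl.
have [|x xts ->] := @MVT_segment _ f f' t s ts (fun x _ => df x).
  apply: derivable_within_continuous => x _; exact: ex_derive.
rewrite normrM ler_wpM2r// bf// (norm_between tT sT)//.
Qed.

(** The mean value theorem is applied to f x - x f'(t), whose derivative f'(x) - f'(t) is at most M
    |e| between t and e + t; hence the constant M in place of the sharp M / 2. *)
Lemma taylor2 f f' f'' T M : (forall t, is_derive t 1 f (f' t)) ->
  (forall t, is_derive t 1 f' (f'' t)) ->
  (forall t, `|t| <= T -> `|f'' t| <= M) ->
  forall t e, `|t| <= T -> `|e + t| <= T ->
  `|f (e + t) - f t - e * f' t| <= M * e ^+ 2.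
Proof.
move=> df df' bf t e tT etT.
pose g x := f x - x * f' t.
have dg x : is_derive x (1 : R) g (f' x - f' t).
  have di : is_derive x (1 : R) (fun x => x * f' t) (f' t).
    have -> : (fun x => x * f' t) = horner (f' t *: 'X).
      by apply/funext => y; rewrite hornerZ hornerX mulrC.
    by apply: is_derive_eq; rewrite derivZ derivX hornerZ hornerC mulr1.
  exact: is_deriveB.
have -> : f (e + t) - f t - e * f' t = g (e + t) - g t by rewrite /g; ring.
pose T' := `|e|.
have lip x : `|x - t| <= `|e| -> `|x| <= T -> `|f' x - f' t| <= M * `|e|.
  move=> xe xT; apply: le_trans (lipschitz_of_derivative df' bf xT tT) _.
  by apply: ler_wpM2l => //; exact: le_trans (normr_ge0 _) (bf _ tT).
have main a b : a <= b -> `|a| <= T -> `|b| <= T ->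
    (forall x, a <= x <= b -> `|x - t| <= `|e|) -> b - a = `|e| ->
    `|g b - g a| <= M * e ^+ 2.
  move=> ab aT bT he ba.
  have [|x xab ->] := @MVT_segment _ g (fun x => f' x - f' t) a b ab (fun x _ => dg x).
    by apply: derivable_within_continuous => x _; exact: ex_derive.
  rewrite in_itv/= in xab.
  rewrite ba normrM normr_id -(real_normK (num_real e)) expr2 mulrA ler_wpM2r// lip//.
    exact: he.
  exact: norm_between xab.
have [e0|/ltW e0] := leP 0 e.
  apply: main => //; first by rewrite lerDr.
    by move=> x xt; rewrite ger0_norm ?(ger0_norm e0); lra.
  by rewrite addrK ger0_norm.
rewrite distrC; apply: main => //; first by rewrite gerDr.
  by move=> x xt; rewrite ler0_norm ?(ler0_norm e0); lra.
by rewrite ler0_norm// opprD addrC subrK.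
Qed.

End one_variable.

Section smoothness_criteria.
Context {R : realType}.

(** A quadratic remainder is an inequality, so it passes from the terms of a series to its sum; the
    derivative of the sum is then read off the estimate. *)
Lemma is_derive_quadratic (V : normedModType R) (f : V -> R) (x v : V) (l K d : R) :
  0 < d -> (forall e, `|e| < d -> `|f (e *: v + x) - f x - e * l| <= K * e ^+ 2) ->
  is_derive x v f l.
Proof.
move=> d0 fK.
have h : e^-1 *: (f (e *: v + x) - f x) @[e --> 0^'] --> l.
  apply/cvgrPdist_le => eps eps0.
  have K1 : 0 < `|K| + 1 by rewrite ltr_wpDl.
  near=> e.
  have e0 : e != 0 by near: e; exact: nbhs_dnbhs_neq.
  have ed : `|e| < d.
    near: e; apply: (@dnbhs0_lt R R).
    done.
  have ee : `|e| < eps / (`|K| + 1).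
    near: e; apply: (@dnbhs0_lt R R); by rewrite divr_gt0.
  have -> : l - e^-1 *: (f (e *: v + x) - f x) =
      - (e^-1 * (f (e *: v + x) - f x - e * l)).
    by rewrite /GRing.scale/= [in RHS]mulrBr mulKf// opprB.
  rewrite normrN normrM normfV ler_pdivrMl ?normr_gt0//.
  apply: le_trans (fK _ ed) _.
  rewrite -(real_normK (num_real e)) mulrC expr2 -mulrA.
  apply: ler_wpM2l => //.
  move: ee; rewrite ltr_pdivlMr//; have := ler_norm K; have := normr_ge0 e.
  nra.
apply: DeriveDef; last exact: cvg_lim.
by apply/cvg_ex; exists l.
Unshelve. all: by end_near. Qed.

Implicit Types (x y : R * R * R) (T : R).

Definition box T x := [/\ `|x.1.1| <= T, `|x.1.2| <= T & `|x.2| <= T].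

Lemma continuous_of_box_lipschitz (f : R * R * R -> R) :
  (forall T, exists K, forall x y, box T x -> box T y ->
    `|f x - f y| <= K * (`|x.1.1 - y.1.1| + `|x.1.2 - y.1.2| + `|x.2 - y.2|)) ->
  continuous f.
Proof.
move=> lip x; apply/cvgrPdist_le => eps eps0.
pose T := `|x.1.1| + `|x.1.2| + `|x.2| + 1.
have [K hK] := lip T.
have K1 : 0 < `|K| + 1 by rewrite ltr_wpDl.
(* The bound 1 keeps y in the box of size T; the other one makes 3 (|K| + 1) d at most eps. *)
pose d := Num.min 1 (eps / (3 * (`|K| + 1))).
have d0 : 0 < d by rewrite lt_min ltr01 divr_gt0// mulr_gt0.
have c1 : (fun y : R * R * R => y.1.1) y @[y --> x] --> x.1.1.
  by apply: cvg_comp; [exact: cvg_fst|exact: cvg_fst].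
have c2 : (fun y : R * R * R => y.1.2) y @[y --> x] --> x.1.2.
  by apply: cvg_comp; [exact: cvg_fst|exact: cvg_snd].
have c3 : (fun y : R * R * R => y.2) y @[y --> x] --> x.2 by exact: cvg_snd.
near=> y.
have y1 : `|x.1.1 - y.1.1| < d by near: y; by move/cvgrPdist_lt: c1; exact.
have y2 : `|x.1.2 - y.1.2| < d by near: y; by move/cvgrPdist_lt: c2; exact.
have y3 : `|x.2 - y.2| < d by near: y; by move/cvgrPdist_lt: c3; exact.
have dle1 : d <= 1 by rewrite ge_min lexx.
have dle : d <= eps / (3 * (`|K| + 1)) by rewrite ge_min lexx orbT.
have n1 := normr_ge0 x.1.1; have n2 := normr_ge0 x.1.2; have n3 := normr_ge0 x.2.
have tri (a b : R) : `|b| <= `|a| + `|a - b|.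
  by rewrite -[X in `|X| <= _](subKr a) (le_trans (ler_normB _ _)).
have bx : box T x by rewrite /T; split; lra.
have by_ : box T y.
  have t1 := tri x.1.1 y.1.1; have t2 := tri x.1.2 y.1.2; have t3 := tri x.2 y.2.
  by rewrite /T; split; lra.
apply: (le_trans (hK _ _ bx by_)).
move: dle; rewrite ler_pdivlMr ?mulr_gt0// => dle.
have := ler_norm K; have := normr_ge0 K.
have := normr_ge0 (x.1.1 - y.1.1); have := normr_ge0 (x.1.2 - y.1.2).
have := normr_ge0 (x.2 - y.2).
move: (`|x.1.1 - y.1.1|) (`|x.1.2 - y.1.2|) (`|x.2 - y.2|) y1 y2 y3 => a b c.
move=> ad bd cd c0 b0 a0 k0 Kk.
apply: (@le_trans _ _ (`|K| * (a + b + c))).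
  by apply: ler_wpM2r => //; lra.
apply: (@le_trans _ _ (`|K| * (3 * d))); last by lra.
by apply: ler_wpM2l => //; lra.
Unshelve. all: by end_near. Qed.

End smoothness_criteria.

(** * Termwise differentiation of the series when the weights are summable *)

Section eigen_series.
Context {R : realType}.
Notation I := (nat * nat * nat)%type.
Variable z : I -> R.
Local Notation q := (19 / 20 : R).

(** The ratio 19/20 exceeds 9/10, so [eigen_bound] applies at this ratio to the derivatives of every
    order. *)
Definition weight (i : I) : R := `|z i| * (q ^+ i.1.1 * q ^+ i.1.2 * q ^+ i.2).

Hypothesis cvg_weight : cvgn (cube weight).

Implicit Types (x y : R * R * R) (T : R) (al : nat * nat * nat).

(** The multi-index [al] gives the orders of differentiation in the three variables. *)
Definition eterm al x (i : I) : R :=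
  z i * (eigen al.1.1 i.1.1 x.1.1 * eigen al.1.2 i.1.2 x.1.2 * eigen al.2 i.2 x.2).

Definition eigen_sum al x : R := limn (cube (eterm al x)).

Lemma product_dominated (a b c A B C : R) (i : I) :
  `|a| <= A * q ^+ i.1.1 -> `|b| <= B * q ^+ i.1.2 -> `|c| <= C * q ^+ i.2 ->
  `|z i * (a * b * c)| <= A * B * C * weight i.
Proof.
move=> hA hB hC; rewrite /weight !normrM.
have -> : A * B * C * (`|z i| * (q ^+ i.1.1 * q ^+ i.1.2 * q ^+ i.2)) =
  `|z i| * ((A * q ^+ i.1.1) * (B * q ^+ i.1.2) * (C * q ^+ i.2)) by ring.
by apply: ler_wpM2l => //; rewrite !ler_pM// mulr_ge0.
Qed.

Let q9 : 9 / 10 < q. Proof. lra. Qed.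

Lemma eterm_dominated al T : exists C, forall x, box T x ->
  dominated weight C (eterm al x).
Proof.
have [A hA] := eigen_bound al.1.1 T q9.
have [B hB] := eigen_bound al.1.2 T q9.
have [C hC] := eigen_bound al.2 T q9.
exists (A * B * C) => x [x1 x2 x3] i.
by apply: product_dominated; [exact: hA|exact: hB|exact: hC].
Qed.

Let box_norm x : box (`|x.1.1| + `|x.1.2| + `|x.2|) x.
Proof.
have n1 := normr_ge0 x.1.1; have n2 := normr_ge0 x.1.2; have n3 := normr_ge0 x.2.
by split; lra.
Qed.

Lemma eterm_cvg al x : cvgn (cube (eterm al x)).
Proof.
have [C hC] := eterm_dominated al (`|x.1.1| + `|x.1.2| + `|x.2|).
have h := hC x (box_norm x).
exact: cube_dominated_cvg h.
Qed.

Lemma eigen_sum_bound al T : exists C, forall x, box T x -> `|eigen_sum al x| <= C.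
Proof.
have [C hC] := eterm_dominated al T; exists (C * limn (cube weight)) => x /hC h.
exact: dominated_lim_le.
Qed.

Let taylor k T : exists2 C, 0 <= C & forall n t e, `|t| <= T -> `|e + t| <= T ->
  `|eigen k n (e + t) - eigen k n t - e * eigen k.+1 n t| <= C * e ^+ 2 * q ^+ n.
Proof.
have [C hC] := eigen_bound (R := R) k.+2 T q9; exists `|C| => // n t e tT etT.
have h s : `|s| <= T -> `|eigen k.+2 n s| <= `|C| * q ^+ n.
  by move=> sT; apply: (le_trans (hC _ _ sT)); rewrite ler_wpM2r// ler_norm.
rewrite mulrAC.
exact: (taylor2 (@is_derive_eigen _ k n) (@is_derive_eigen _ k.+1 n) h tT etT).
Qed.

(** Only one of the three factors varies, so the remainder of a term is the remainder of this factor
    times the other two; it is dominated by e^2 times the weights, uniformly on the box. *)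
Lemma eigen_sum_quadratic1 al T : exists K, forall x e, box T x -> `|e + x.1.1| <= T ->
  `|eigen_sum al (e + x.1.1, x.1.2, x.2) - eigen_sum al x
    - e * eigen_sum (al.1.1.+1, al.1.2, al.2) x| <= K * e ^+ 2.
Proof.
have [A _ hA] := taylor al.1.1 T.
have [B hB] := eigen_bound al.1.2 T q9.
have [C hC] := eigen_bound al.2 T q9.
exists (A * B * C * limn (cube weight)) => x e [x1 x2 x3] ex.
rewrite /eigen_sum lim_cube_affine; [|exact: eterm_cvg..].
have -> : A * B * C * limn (cube weight) * e ^+ 2 =
  A * e ^+ 2 * B * C * limn (cube weight) by ring.
apply: dominated_lim_le => // i.
have -> : eterm al (e + x.1.1, x.1.2, x.2) i - eterm al x i -
    e * eterm (al.1.1.+1, al.1.2, al.2) x i =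
  z i * ((eigen al.1.1 i.1.1 (e + x.1.1) - eigen al.1.1 i.1.1 x.1.1
    - e * eigen al.1.1.+1 i.1.1 x.1.1) * eigen al.1.2 i.1.2 x.1.2 * eigen al.2 i.2 x.2).
  by rewrite /eterm/=; ring.
by apply: product_dominated; [exact: hA|exact: hB|exact: hC].
Qed.

Lemma eigen_sum_quadratic2 al T : exists K, forall x e, box T x -> `|e + x.1.2| <= T ->
  `|eigen_sum al (x.1.1, e + x.1.2, x.2) - eigen_sum al x
    - e * eigen_sum (al.1.1, al.1.2.+1, al.2) x| <= K * e ^+ 2.
Proof.
have [A hA] := eigen_bound al.1.1 T q9.
have [B _ hB] := taylor al.1.2 T.
have [C hC] := eigen_bound al.2 T q9.
exists (A * B * C * limn (cube weight)) => x e [x1 x2 x3] ex.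
rewrite /eigen_sum lim_cube_affine; [|exact: eterm_cvg..].
have -> : A * B * C * limn (cube weight) * e ^+ 2 =
  A * (B * e ^+ 2) * C * limn (cube weight) by ring.
apply: dominated_lim_le => // i.
have -> : eterm al (x.1.1, e + x.1.2, x.2) i - eterm al x i -
    e * eterm (al.1.1, al.1.2.+1, al.2) x i =
  z i * (eigen al.1.1 i.1.1 x.1.1 * (eigen al.1.2 i.1.2 (e + x.1.2)
    - eigen al.1.2 i.1.2 x.1.2 - e * eigen al.1.2.+1 i.1.2 x.1.2) * eigen al.2 i.2 x.2).
  by rewrite /eterm/=; ring.
by apply: product_dominated; [exact: hA|exact: hB|exact: hC].
Qed.

Lemma eigen_sum_quadratic3 al T : exists K, forall x e, box T x -> `|e + x.2| <= T ->
  `|eigen_sum al (x.1.1, x.1.2, e + x.2) - eigen_sum al x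
    - e * eigen_sum (al.1.1, al.1.2, al.2.+1) x| <= K * e ^+ 2.
Proof.
have [A hA] := eigen_bound al.1.1 T q9.
have [B hB] := eigen_bound al.1.2 T q9.
have [C _ hC] := taylor al.2 T.
exists (A * B * C * limn (cube weight)) => x e [x1 x2 x3] ex.
rewrite /eigen_sum lim_cube_affine; [|exact: eterm_cvg..].
have -> : A * B * C * limn (cube weight) * e ^+ 2 =
  A * B * (C * e ^+ 2) * limn (cube weight) by ring.
apply: dominated_lim_le => // i.
have -> : eterm al (x.1.1, x.1.2, e + x.2) i - eterm al x i -
    e * eterm (al.1.1, al.1.2, al.2.+1) x i =
  z i * (eigen al.1.1 i.1.1 x.1.1 * eigen al.1.2 i.1.2 x.1.2 *
    (eigen al.2 i.2 (e + x.2) - eigen al.2 i.2 x.2 - e * eigen al.2.+1 i.2 x.2)).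
  by rewrite /eterm/=; ring.
by apply: product_dominated; [exact: hA|exact: hB|exact: hC].
Qed.

(** One of the two powers of |e| in the remainder is at most 2 T, which leaves a bound linear in
    |e|. *)
Let lipschitz_of_quadratic (a b l e C K T : R) : `|e| <= 2 * T -> `|l| <= C ->
  `|a - b - e * l| <= K * e ^+ 2 -> `|a - b| <= (C + `|K| * (2 * T)) * `|e|.
Proof.
move=> eT lC h.
rewrite -[a - b](subrK (e * l)); apply: (le_trans (ler_normD _ _)).
rewrite mulrDl addrC normrM; apply: lerD.
  by rewrite mulrC ler_wpM2r.
apply: (le_trans h); rewrite -(real_normK (num_real e)) expr2 mulrA ler_wpM2r//.
by rewrite (le_trans (ler_wpM2r _ (ler_norm K)))// ler_wpM2l.
Qed.

Lemma eigen_sum_continuous al : continuous (eigen_sum al).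
Proof.
apply: continuous_of_box_lipschitz => T.
have [K1 h1] := eigen_sum_quadratic1 al T; have [K2 h2] := eigen_sum_quadratic2 al T.
have [K3 h3] := eigen_sum_quadratic3 al T.
have [C1 b1] := eigen_sum_bound (al.1.1.+1, al.1.2, al.2) T.
have [C2 b2] := eigen_sum_bound (al.1.1, al.1.2.+1, al.2) T.
have [C3 b3] := eigen_sum_bound (al.1.1, al.1.2, al.2.+1) T.
pose L (C K : R) : R := C + `|K| * (2 * T).
exists (`|L C1 K1| + `|L C2 K2| + `|L C3 K3|) => x y [x1 x2 x3] [y1 y2 y3].
have dT (a b : R) : `|a| <= T -> `|b| <= T -> `|a - b| <= 2 * T.
  by move=> aT bT; apply: (le_trans (ler_normB _ _)); lra.
(* From y to x one coordinate at a time; the intermediate points stay in the box. *)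
have s1 : `|eigen_sum al (x.1.1, y.1.2, y.2) - eigen_sum al y|
    <= L C1 K1 * `|x.1.1 - y.1.1|.
  have := h1 y (x.1.1 - y.1.1); rewrite subrK => /(_ (And3 y1 y2 y3) x1).
  by apply: lipschitz_of_quadratic; [exact: dT|exact: b1].
have s2 : `|eigen_sum al (x.1.1, x.1.2, y.2) - eigen_sum al (x.1.1, y.1.2, y.2)|
    <= L C2 K2 * `|x.1.2 - y.1.2|.
  have := h2 (x.1.1, y.1.2, y.2) (x.1.2 - y.1.2).
  rewrite /= subrK => /(_ (And3 x1 y2 y3) x2).
  by apply: lipschitz_of_quadratic; [exact: dT|exact: b2].
have s3 : `|eigen_sum al x - eigen_sum al (x.1.1, x.1.2, y.2)|
    <= L C3 K3 * `|x.2 - y.2|.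
  have := h3 (x.1.1, x.1.2, y.2) (x.2 - y.2).
  rewrite /= subrK -!surjective_pairing => /(_ (And3 x1 x2 y3) x3).
  by apply: lipschitz_of_quadratic; [exact: dT|exact: b3].
have -> : eigen_sum al x - eigen_sum al y =
  (eigen_sum al x - eigen_sum al (x.1.1, x.1.2, y.2)) +
  (eigen_sum al (x.1.1, x.1.2, y.2) - eigen_sum al (x.1.1, y.1.2, y.2)) +
  (eigen_sum al (x.1.1, y.1.2, y.2) - eigen_sum al y) by ring.
apply: (le_trans (ler_normD _ _)); apply: (le_trans (lerD (ler_normD _ _) (lexx _))).
have := ler_norm (L C1 K1); have := ler_norm (L C2 K2); have := ler_norm (L C3 K3).
have := normr_ge0 (L C1 K1); have := normr_ge0 (L C2 K2); have := normr_ge0 (L C3 K3).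
have := normr_ge0 (x.1.1 - y.1.1); have := normr_ge0 (x.1.2 - y.1.2).
have := normr_ge0 (x.2 - y.2).
move: s1 s2 s3; move: (`|x.1.1 - y.1.1|) (`|x.1.2 - y.1.2|) (`|x.2 - y.2|).
move: (`|L C1 K1|) (`|L C2 K2|) (`|L C3 K3|) (L C1 K1) (L C2 K2) (L C3 K3).
move=> l1 l2 l3 m1 m2 m3 a b c s1 s2 s3 c0 b0 a0 l30 l20 l10 ml3 ml2 ml1.
have := ler_wpM2r a0 ml1; have := ler_wpM2r b0 ml2; have := ler_wpM2r c0 ml3.
have := mulr_ge0 l10 b0; have := mulr_ge0 l10 c0; have := mulr_ge0 l20 a0.
have := mulr_ge0 l20 c0; have := mulr_ge0 l30 a0; have := mulr_ge0 l30 b0.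
lra.
Qed.

Definition shift_index al (i : 'I_3) : nat * nat * nat :=
  (al.1.1 + (i == 0 :> nat), al.1.2 + (i == 1 :> nat), al.2 + (i == 2 :> nat))%N.

Lemma eigen_sum_is_derive al (i : 'I_3) x :
  is_derive x (basis_vector R i) (eigen_sum al) (eigen_sum (shift_index al i) x).
Proof.
pose T := `|x.1.1| + `|x.1.2| + `|x.2| + 1.
have n1 := normr_ge0 x.1.1; have n2 := normr_ge0 x.1.2; have n3 := normr_ge0 x.2.
have bx : box T x by rewrite /T; split; lra.
have eT (e t : R) : `|t| <= T - 1 -> `|e| < 1 -> `|e + t| <= T.
  by move=> tT e1; apply: (le_trans (ler_normD _ _)); lra.
have E1 (e t : R) : e * 1 + t = e + t by rewrite mulr1.
have E0 (e t : R) : e * 0 + t = t by rewrite mulr0 add0r.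
case: i => -[|[|[|//]]] hi.
- have [K h] := eigen_sum_quadratic1 al T.
  apply: (@is_derive_quadratic _ _ _ _ _ _ K 1) => // e e1.
  have -> : e *: basis_vector R (Ordinal hi) + x = (e + x.1.1, x.1.2, x.2).
    case: x {bx h n1 n2 n3} @T eT => -[a b] c T _.
    by congr (_, _, _); solve [exact: E1 | exact: E0].
  rewrite /shift_index/= addn1 !addn0.
  by apply: h => //; apply: eT => //; rewrite /T; lra.
- have [K h] := eigen_sum_quadratic2 al T.
  apply: (@is_derive_quadratic _ _ _ _ _ _ K 1) => // e e1.
  have -> : e *: basis_vector R (Ordinal hi) + x = (x.1.1, e + x.1.2, x.2).
    case: x {bx h n1 n2 n3} @T eT => -[a b] c T _.
    by congr (_, _, _); solve [exact: E1 | exact: E0].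
  rewrite /shift_index/= addn1 !addn0.
  by apply: h => //; apply: eT => //; rewrite /T; lra.
- have [K h] := eigen_sum_quadratic3 al T.
  apply: (@is_derive_quadratic _ _ _ _ _ _ K 1) => // e e1.
  have -> : e *: basis_vector R (Ordinal hi) + x = (x.1.1, x.1.2, e + x.2).
    case: x {bx h n1 n2 n3} @T eT => -[a b] c T _.
    by congr (_, _, _); solve [exact: E1 | exact: E0].
  rewrite /shift_index/= addn1 !addn0.
  by apply: h => //; apply: eT => //; rewrite /T; lra.
Qed.

(** Induction on the order for all multi-indices at once: the functions [eigen_sum al] are
    continuous, and a partial derivative of one of them is another one. *)
Lemma eigen_sum_smooth al : smooth (eigen_sum al).
Proof.
move=> k; elim: k al => [|k ih] al; split => //; try exact: eigen_sum_continuous.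
move=> i; split=> [x|]; first by have [] := eigen_sum_is_derive al i x.
have -> : (fun x => 'D_(basis_vector R i) (eigen_sum al) x) =
    eigen_sum (shift_index al i).
  by apply/funext => x; have [] := eigen_sum_is_derive al i x.
exact: ih.
Qed.

End eigen_series.

(** * Finite measures determined by continuous functions *)

Section continuous_test_functions.
Context {R : realType}.
Local Notation T := (measurableTypeR R).

(* Continuous functions increasing with n to the indicator of ]x, +oo[. *)
Let test (x : R) (n : nat) (y : R) : R := 1 - expR (- (n%:R * (y - x + `|y - x|))).

Let test_continuous x n : continuous (test x n).
Proof.
move=> y; apply: cvgB; first exact: cvg_cst.
apply: continuous_comp; last exact: continuous_expR.
apply: cvgN; apply: cvgM; first exact: cvg_cst.
have h : (fun y => y - x) y @[y --> y] --> y - x.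
  by apply: cvgB; [exact: cvg_id|exact: cvg_cst].
by apply: cvgD => //; exact: cvg_norm.
Qed.

Let test01 x n y : 0 <= test x n y <= 1.
Proof.
have h : 0 <= n%:R * (y - x + `|y - x|).
  by apply: mulr_ge0 => //; have := ler_norm (- (y - x)); rewrite normrN; lra.
rewrite /test subr_ge0 lerBlDr lerDl expR_ge0 andbT.
by rewrite -[leRHS](@expR0 R) ler_expR oppr_le0.
Qed.

Let test_homo x y : {homo (test x ^~ y) : n m / (n <= m)%N >-> n <= m}.
Proof.
move=> n m nm; rewrite lerD2l lerN2 ler_expR lerN2; apply: ler_wpM2r.
  by have := ler_norm (- (y - x)); rewrite normrN; lra.
by rewrite ler_nat.
Qed.

Let test_cvg x y : test x n y @[n --> \oo] --> (\1_(`]x, +oo[%classic : set R) y : R).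
Proof.
rewrite indicE; have [xy|yx] := ltP x y.
  rewrite mem_set/= ?in_itv/= ?xy//.
  have h : 0 < y - x by rewrite subr_gt0.
  have -> : (test x ^~ y) = fun n => 1 - expR (- ((y - x) *+ 2)) ^+ n.
    apply/funext => n; rewrite /test -expRM_natl (ger0_norm (ltW h)).
    by rewrite mulr2n mulrN.
  rewrite -[X in _ --> X](subr0 1); apply: cvgB; first exact: cvg_cst.
  apply: cvg_expr; rewrite ger0_norm ?expR_ge0// -expR0 ltr_expR oppr_lt0.
  by rewrite pmulrn_lgt0.
rewrite memNset/=; last by rewrite in_itv/= andbT ltNge yx.
have -> : (test x ^~ y) = fun=> 0.
  apply/funext => n; rewrite /test ler0_norm ?subr_le0// subrr mulr0 oppr0 expR0.
  by rewrite subrr.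
exact: cvg_cst.
Qed.

(** The half-lines ]x, +oo[ are stable under intersection and generate the Borel sets, and monotone
    convergence along [test] recovers their measures. *)
Lemma measure_eq_continuous (m1 m2 : {measure set T -> \bar R}) :
  (m1 setT < +oo)%E ->
  (forall f : R -> R, continuous f -> (forall x, 0 <= f x <= 1) ->
    (\int[m1]_x (f x)%:E = \int[m2]_x (f x)%:E)%E) ->
  forall A, measurable A -> m1 A = m2 A.
Proof.
move=> m1oo m12.
have key (m : {measure set T -> \bar R}) x :
    (\int[m]_y (test x n y)%:E @[n --> \oo] --> m `]x, +oo[%classic)%E.
  have -> : m `]x, +oo[%classic = (\int[m]_y (\1_(`]x, +oo[%classic : set R) y)%:E)%E.
    by rewrite integral_indic// setIT.
  have -> : (\int[m]_y (\1_(`]x, +oo[%classic : set R) y)%:E =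
      \int[m]_y limn (fun n => (test x n y)%:E))%E.
    apply: eq_integral => y _; apply/esym/cvg_lim => //.
    by apply: cvg_EFin; [exact: nearW|exact: test_cvg].
  apply: cvg_monotone_convergence => //.
  - move=> n; apply/measurable_EFinP; apply: continuous_measurable_fun.
    exact: test_continuous.
  - by move=> n y _; rewrite lee_fin; have /andP[] := test01 x n y.
  - by move=> y _ n m' nm; rewrite lee_fin; exact: test_homo.
move=> A mA.
have mE : @measurable _ T = <<s (@RGenOInfty.G R) >> by exact: RGenOInfty.measurableE.
have := @measure_unique _ R T (@RGenOInfty.G R) (fun n => `](- n%:R), +oo[%classic) mE.
move=> /(_ _ _ _ m1 m2 _ _ A mA); apply.
- move=> _ _ [a ->] [b ->]; exists (Num.max a b); apply/seteqP; split => y /=.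
    by rewrite !in_itv/= !andbT gt_max => -[-> ->].
  by rewrite !in_itv/= !andbT gt_max => /andP[-> ->].
- by move=> n; eexists; reflexivity.
- apply/seteqP; split => // y _; exists (Num.truncn `|y|).+1 => //=.
  rewrite in_itv/= andbT ltrNl; apply: le_lt_trans (truncnS_gt _).
  by rewrite -normrN ler_norm.
- move=> _ [x ->].
  have := key m1 x; have := key m2 x.
  have -> : (fun n => \int[m2]_y (test x n y)%:E)%E =
            (fun n => \int[m1]_y (test x n y)%:E)%E.
    by apply/funext => n; rewrite m12//; exact: test_continuous.
  move=> h2 h1; have := cvg_lim (@ereal_hausdorff _) h1.
  by rewrite (cvg_lim (@ereal_hausdorff _) h2) => ->.
- move=> n; apply: le_lt_trans m1oo; by apply: le_measure => //; rewrite ?inE//=; exact: measurable_itv.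
Qed.

End continuous_test_functions.

(** * Integrals against the normal law *)

Section normal_integral.
Context {R : realType}.
Local Notation T := (measurableTypeR R).
Local Notation mu := (@lebesgue_measure R).
Local Open Scope ereal_scope.
Import HBNNSimple.

Lemma ge0_integral_normal_prob (m s : R) (f : T -> \bar R) :
  measurable_fun setT f -> (forall x, 0 <= f x) ->
  \int[normal_prob m s]_x f x = \int[mu]_x (f x * (normal_pdf m s x)%:E).
Proof.
move=> mf f0.
have p0 x : 0 <= (normal_pdf m s x)%:E by rewrite lee_fin normal_pdf_ge0.
have mp : measurable_fun setT (fun x : T => (normal_pdf m s x)%:E).
  by apply/measurable_EFinP; exact: measurable_normal_pdf.
pose h := nnsfun_approx measurableT mf.
have simple (g : {nnsfun T >-> R}) : \int[normal_prob m s]_x (g x)%:E =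
    \int[mu]_x ((g x)%:E * (normal_pdf m s x)%:E).
  rewrite integralT_nnsfun sintegralE.
  under [RHS]eq_integral => x _.
    rewrite fimfunE -fsumEFin// ge0_mule_fsuml; last first.
      by move=> y; exact: nnfun_muleindic_ge0.
    over.
  rewrite ge0_integral_fsum//=; last 2 first.
  - move=> y; apply: emeasurable_funM => //.
    by apply/measurable_EFinP; apply: measurable_funM.
  - by move=> y x _; rewrite mule_ge0// nnfun_muleindic_ge0.
  apply: eq_fsbigr => y /set_mem [x _ xy].
  under eq_integral => z _ do rewrite EFinM -muleA.
  have y0 : (0 <= y)%R by rewrite -xy.
  rewrite ge0_integralZl//=; last 2 first.
  - by apply: emeasurable_funM => //; exact/measurable_EFinP.
  - by move=> z _; rewrite mule_ge0// lee_fin.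
  congr (_ * _); rewrite /normal_prob integral_mkcond.
  apply: eq_integral => z _; rewrite patchE indicE.
  by case: ifPn => _; rewrite ?mul1e ?mul0e.
transitivity (limn (fun n => \int[normal_prob m s]_x (h n x)%:E)).
  have fE x : f x = limn (fun n => (h n x)%:E).
    by apply/esym/cvg_lim => //; exact: cvg_nnsfun_approx.
  under eq_integral => x _ do rewrite fE.
  apply: monotone_convergence => //.
  - by move=> n; exact/measurable_EFinP.
  - by move=> n x _; rewrite lee_fin.
  - by move=> x _ a b ab; rewrite lee_fin; exact/lefP/nd_nnsfun_approx.
have -> : (fun n => \int[normal_prob m s]_x (h n x)%:E) =
    (fun n => \int[mu]_x ((h n x)%:E * (normal_pdf m s x)%:E)).
  by apply/funext => n; exact: simple.
have fE x : f x * (normal_pdf m s x)%:E =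
    limn (fun n => (h n x)%:E * (normal_pdf m s x)%:E).
  by apply/esym/cvg_lim => //; apply: cvgeZr => //; exact: cvg_nnsfun_approx.
under [RHS]eq_integral => x _ do rewrite fE.
apply/esym; apply: monotone_convergence => //.
- by move=> n; apply: emeasurable_funM => //; exact/measurable_EFinP.
- by move=> n x _; rewrite mule_ge0// lee_fin.
- move=> x _ a b ab; rewrite lee_wpmul2r// lee_fin.
  exact/lefP/nd_nnsfun_approx.
Qed.

(** The substitution u = s x + e turns the standard density into that of mean e and standard
    deviation s. *)
Lemma normal_prob_affine (s e : R) (f : R -> R) : (0 < s)%R -> continuous f ->
  (forall x, 0 <= f x)%R ->
  \int[normal_prob 0 1]_x (f (s * x + e)%R)%:E =
  \int[mu]_u (f u * normal_pdf e s u)%:E.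
Proof.
move=> s0 cf f0.
have cF : continuous (fun x : R => s * x + e)%R.
  move=> x; apply: cvgD; last exact: cvg_cst.
  by apply: cvgM; [exact: cvg_cst|exact: cvg_id].
have cfF : continuous (fun x : R => f (s * x + e)%R).
  by move=> x; apply: continuous_comp; [exact: cF|exact: cf].
have dF (x : R) : is_derive x (1%R : R) (fun x : R => s * x + e)%R s.
  have -> : (fun x : R => s * x + e)%R = horner (s *: 'X + e%:P)%R.
    by apply/funext => t; rewrite hornerD hornerZ hornerX hornerC.
  apply: is_derive_eq; rewrite derivD derivZ derivX derivC addr0 hornerZ hornerC.
  by rewrite mulr1.
have dFE : (fun x : R => s * x + e)%R^`()%classic = cst s.
  by apply/funext => x; rewrite derive1E; exact: derive_val.
rewrite ge0_integral_normal_prob; last 2 first.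
- by apply/measurable_EFinP; exact: continuous_measurable_fun.
- by move=> x; rewrite lee_fin.
rewrite (@increasing_ge0_integration_by_substitutionT R (fun x => s * x + e)%R
  (fun u => f u * normal_pdf e s u)%R).
- apply: eq_integral => x _; rewrite -EFinM; congr (_%:E).
  rewrite [RHS](_ : _ = f (s * x + e) * normal_pdf e s (s * x + e) *
    (fun x : R => s * x + e)^`()%classic x)%R// dFE /=.
  rewrite !normal_pdfE ?oner_eq0 ?gt_eqF// /normal_fun addrK subr0 -mulrA.
  congr (_ * _)%R; rewrite /normal_peak expr1n mul1r.
  have -> : (- (s * x) ^+ 2 / (s ^+ 2 *+ 2) = - x ^+ 2 / (1 *+ 2))%R.
    by field; rewrite gt_eqF.
  rewrite mulrAC; congr (_ * _)%R.
  rewrite -mulrnAr sqrtrM ?sqr_ge0// sqrtr_sqr (ger0_norm (ltW s0)) invfM.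
  by rewrite mulrAC mulVf ?mul1r// gt_eqF.
- by move=> x y xy; rewrite ltrD2r ltr_pM2l.
- by rewrite dFE => x; exact: cvg_cst.
- by rewrite dFE; exact: is_cvg_cst.
- by rewrite dFE; exact: is_cvg_cst.
- by move=> x; exact: ex_derive.
- apply: (cvg_comp _ (fun x => x + e)%R); last exact: cvg_addrr_Ny.
  by apply/gt0_cvgMrNy => //; exact: cvg_id.
- apply: (cvg_comp _ (fun x => x + e)%R); last exact: cvg_addrr.
  by apply/gt0_cvgMry => //; exact: cvg_id.
- move=> x; apply: cvgM; first exact: cf.
  by apply: continuous_normal_pdf; rewrite gt_eqF.
- by move=> x; rewrite mulr_ge0// normal_pdf_ge0.
Qed.

(** Serves for scale factors of negative sign and for the vanishing of the mean of a centred law. *)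
Lemma normal_prob_sym (f : R -> R) : measurable_fun (setT : set T) f ->
  (forall x, 0 <= f x)%R ->
  \int[normal_prob 0 1]_x (f (- x)%R)%:E = \int[normal_prob 0 1]_x (f x)%:E.
Proof.
move=> mf f0.
have mN : measurable_fun (setT : set T) (-%R : T -> T) by exact: oppr_measurable.
have mp : measurable_fun (setT : set T) (normal_pdf 0 1 : T -> R).
  exact: measurable_normal_pdf.
rewrite !ge0_integral_normal_prob; last 4 first.
- exact/measurable_EFinP.
- by move=> x; rewrite lee_fin.
- by apply/measurable_EFinP; apply: (measurableT_comp (f := f)).
- by move=> x; rewrite lee_fin.
pose g (x : T) := (f x)%:E * (normal_pdf 0 1 x)%:E.
have mg : measurable_fun setT g by apply: emeasurable_funM; exact/measurable_EFinP.
have g0 : {in setT, forall x, 0 <= g x}.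
  by move=> x _; rewrite mule_ge0// lee_fin// normal_pdf_ge0.
transitivity (\int[mu]_(x in (-%R : T -> T) @^-1` setT) (g \o -%R) x).
  rewrite preimage_setT; apply: eq_integral => x _; congr (_ * _%:E).
  by rewrite !normal_pdfE ?oner_eq0// /normal_fun !subr0 sqrrN.
rewrite -(ge0_integral_pushforward mN mu measurableT mg g0).
by apply: eq_measure_integral => A mA _; exact: lebesgue_measureN.
Qed.

(* Completing the square in y. *)
Lemma normal_pdf_product (s t y u : R) : (0 < s)%R ->
  (normal_pdf 0 1 y * normal_pdf (t * y) s u =
   normal_pdf 0 (Num.sqrt (s ^+ 2 + t ^+ 2)) u *
   normal_pdf (u * t / (s ^+ 2 + t ^+ 2)) (s / Num.sqrt (s ^+ 2 + t ^+ 2)) y)%R.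
Proof.
move=> s0.
have q0 : (0 < s ^+ 2 + t ^+ 2)%R by rewrite ltr_wpDr ?sqr_ge0// exprn_gt0.
have r0 : (0 < Num.sqrt (s ^+ 2 + t ^+ 2))%R by rewrite sqrtr_gt0.
have rr : (Num.sqrt (s ^+ 2 + t ^+ 2) ^+ 2 = s ^+ 2 + t ^+ 2)%R by rewrite sqr_sqrtr// ltW.
rewrite !normal_pdfE ?oner_eq0 ?gt_eqF ?divr_gt0// /normal_fun /normal_peak.
rewrite mulrACA [RHS]mulrACA -!expRD; congr (_ * expR _)%R.
  rewrite -!invfM -!sqrtrM; last 2 first.
  - by rewrite mulrn_wge0// mulr_ge0 ?pi_ge0// sqr_ge0.
  - by rewrite mulrn_wge0// mulr_ge0 ?pi_ge0// sqr_ge0.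
  congr ((Num.sqrt _)^-1)%R; rewrite rr exprMn exprVn rr.
  by field; rewrite gt_eqF.
rewrite rr exprMn exprVn rr.
by field; rewrite !gt_eqF.
Qed.

End normal_integral.

Section normal_integral2.
Context {R : realType}.
Local Notation T := (measurableTypeR R).
Local Notation mu := (@lebesgue_measure R).
Local Open Scope ereal_scope.

(** The integral in x becomes one against the density of mean t y and deviation s at u; after the
    exchange of integrals, completing the square leaves a normal density in y, of integral 1. *)
Lemma normal_prob_convolution (s t : R) (f : R -> R) : continuous f ->
  (forall x, 0 <= f x)%R -> (0 <= s)%R ->
  \int[normal_prob 0 1]_y \int[normal_prob 0 1]_x (f (s * x + t * y)%R)%:E =
  \int[normal_prob 0 1]_x (f (Num.sqrt (s ^+ 2 + t ^+ 2) * x)%R)%:E.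
Proof.
move=> cf f0; rewrite le_eqVlt => /predU1P[<-|s0].
  (* For s = 0 there is no density; the inner integrand is constant in x, and only the sign of t
     remains to be removed. *)
  have cft (a : R) : continuous (fun x : R => f (a * x)%R).
    move=> x; apply: continuous_comp; last exact: cf.
    by apply: cvgM; [exact: cvg_cst|exact: cvg_id].
  rewrite expr0n/= add0r sqrtr_sqr.
  under eq_integral => y _.
    under eq_integral => x _ do rewrite mul0r add0r.
    rewrite integral_cst//= probability_setT mule1; over.
  have [t0|t0] := leP 0%R t; first by rewrite ger0_norm.
  rewrite ltr0_norm// -[RHS]normal_prob_sym//.
  - by apply: eq_integral => x _; rewrite mulrNN.
  - exact: continuous_measurable_fun.
have q0 : (0 < s ^+ 2 + t ^+ 2)%R by rewrite ltr_wpDr ?sqr_ge0// exprn_gt0.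
have r0 : (0 < Num.sqrt (s ^+ 2 + t ^+ 2))%R by rewrite sqrtr_gt0.
under eq_integral => y _ do rewrite normal_prob_affine//.
have mf : measurable_fun (setT : set T) f by exact: continuous_measurable_fun.
have mH : measurable_fun setT (fun z : T * T =>
    (f z.2 * normal_pdf (t * z.1) s z.2)%:E).
  apply/measurable_EFinP; apply: measurable_funM.
    by apply: (measurableT_comp (f := f)); [exact: mf|exact: measurable_snd].
  have -> : (fun z : T * T => normal_pdf (t * z.1) s z.2) = (fun z : T * T =>
      normal_peak s * expR (- (z.2 - t * z.1) ^+ 2 / (s ^+ 2 *+ 2)))%R.
    by apply/funext => z; rewrite normal_pdfE// gt_eqF.
  apply: measurable_funM => //; apply: measurableT_comp => //.
  apply: measurable_funM => //; apply: measurableT_comp => //.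
  apply: measurable_funX; apply: measurable_funB; first exact: measurable_snd.
  by apply: measurable_funM => //; exact: measurable_fst.
have H0 (z : T * T) : 0 <= (f z.2 * normal_pdf (t * z.1) s z.2)%:E.
  by rewrite lee_fin mulr_ge0// normal_pdf_ge0.
have mp : measurable_fun (setT : set T) (fun y : T => (normal_pdf 0 1 y)%:E).
  by apply/measurable_EFinP; exact: measurable_normal_pdf.
have mG : measurable_fun setT (fun z : T * T =>
    (f z.2 * normal_pdf (t * z.1) s z.2)%:E * (normal_pdf 0 1 z.1)%:E).
  apply: emeasurable_funM => //.
  by apply: (measurableT_comp (f := fun y : T => (normal_pdf 0 1 y)%:E)).
have p0 y : 0 <= (normal_pdf 0 1 y)%:E :> \bar R by rewrite lee_fin normal_pdf_ge0.
have G0 (z : T * T) : 0 <= (f z.2 * normal_pdf (t * z.1) s z.2)%:E * (normal_pdf 0 1 z.1)%:E.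
  by rewrite mule_ge0.
have mF : measurable_fun (setT : set T)
    (fun y : T => \int[mu]_u (f u * normal_pdf (t * y) s u)%:E).
  exact (@measurable_fun_fubini_tonelli_F _ _ T T R mu _ mH H0).
rewrite [LHS]ge0_integral_normal_prob; last 2 first.
- exact: mF.
- by move=> y; apply: integral_ge0 => u _; exact: (H0 (y, u)).
transitivity (\int[mu]_y \int[mu]_u ((f u * normal_pdf (t * y) s u)%:E *
    (normal_pdf 0 1 y)%:E)).
  apply: eq_integral => y _; rewrite ge0_integralZr//.
  - exact: (measurableT_comp (f := fun z : T * T =>
      (f z.2 * normal_pdf (t * z.1) s z.2)%:E) mH (measurable_pair1 y)).
  - by move=> u _; exact: (H0 (y, u)).
rewrite (fubini_tonelli (fun z : T * T =>
    (f z.2 * normal_pdf (t * z.1) s z.2)%:E * (normal_pdf 0 1 z.1)%:E))//=.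
have <- : \int[normal_prob 0 1]_x (f (Num.sqrt (s ^+ 2 + t ^+ 2) * x + 0)%R)%:E =
    \int[normal_prob 0 1]_x (f (Num.sqrt (s ^+ 2 + t ^+ 2) * x)%R)%:E.
  by apply: eq_integral => x _; rewrite addr0.
rewrite normal_prob_affine//; apply: eq_integral => u _.
under eq_integral => y _.
  rewrite -EFinM -mulrA [X in (_ * X)%R]mulrC normal_pdf_product// mulrA EFinM; over.
rewrite ge0_integralZl//=.
- by rewrite integral_normal_pdf mule1.
- by apply/measurable_EFinP; exact: measurable_normal_pdf.
- by move=> y _; rewrite lee_fin normal_pdf_ge0.
- by rewrite lee_fin mulr_ge0// normal_pdf_ge0.
Qed.

(** The fundamental theorem on [-(n + 1), n + 1], then dominated convergence; n + 1 keeps the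
    interval nondegenerate. *)
Lemma integral_primitive (f F : R -> R) (l : R) : continuous f ->
  (forall x, is_derive x (1 : R)%R F (f x)) -> mu.-integrable setT (EFin \o f) ->
  (F n.+1%:R - F (- n.+1%:R))%R @[n --> \oo] --> l ->
  \int[mu]_x (f x)%:E = l%:E.
Proof.
move=> cf dF intf Fl.
pose A (n : nat) : set R := `[(- n.+1%:R)%R, (n.+1%:R)%R]%classic.
pose fn n x : \bar R := (f x * \1_(A n) x)%:E.
have mA n : measurable (A n : set T) by exact: measurable_itv.
have mf : measurable_fun (setT : set T) f by exact: continuous_measurable_fun.
have cF : continuous F.
  by move=> x; apply/differentiable_continuous/derivable1_diffP.
have fnE n : \int[mu]_x fn n x = (F n.+1%:R - F (- n.+1%:R))%:E.
  transitivity (\int[mu]_(x in A n) (f x)%:E).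
    rewrite [RHS]integral_mkcond; apply: eq_integral => x _.
    rewrite patchE /fn indicE; case: ifPn => _; first by rewrite mulr1.
    by rewrite mulr0.
  rewrite /A (@continuous_FTC2 R f F) ?EFinB//.
  - by apply: (@lt_trans _ _ 0%R); rewrite ?oppr_lt0.
  - exact: continuous_subspaceT.
  - split.
    + by move=> x _; exact: (@ex_derive _ _ _ _ _ _ _ (dF x)).
    + by apply: cvg_at_right_filter; exact: cF.
    + by apply: cvg_at_left_filter; exact: cF.
  - by move=> x _; rewrite derive1E; exact: (@derive_val _ _ _ _ _ _ _ (dF x)).
have h1 n : measurable_fun (setT : set T) (fn n).
  by apply/measurable_EFinP; apply: measurable_funM => //; exact: measurable_indic.
have h2 : measurable_fun (setT : set T) (EFin \o f) by exact/measurable_EFinP.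
have h3 : {ae mu, forall x, setT x -> fn ^~ x @ \oo --> (EFin \o f) x}.
  apply: nearW => x _ /=; apply: cvg_near_cst; near=> n.
  rewrite /fn indicE mem_set ?mulr1// /A/= in_itv/= -ler_norml ltW//.
  apply: lt_le_trans (truncnS_gt _) _; rewrite ler_nat ltnS.
  by near: n; exact: nbhs_infty_ge.
have h4 : mu.-integrable setT (fun x => `|(EFin \o f) x|) by exact: integrable_abse.
have h5 : {ae mu, forall x n, setT x -> `|fn n x| <= `|(EFin \o f) x|}.
  apply: nearW => x n _ /=; rewrite lee_fin normrM ler_piMr//.
  by rewrite indicE; case: (_ \in _); rewrite ?normr1 ?normr0.
have [_ _ h6] := dominated_convergence measurableT h1 h2 h3 h4 h5.
have h7 : \int[mu]_x fn n x @[n --> \oo] --> l%:E.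
  under eq_fun do rewrite fnE.
  by apply: cvg_EFin => //; exact: nearW.
by rewrite -(cvg_lim (@ereal_hausdorff R) h6) (cvg_lim (@ereal_hausdorff R) h7).
Unshelve. all: by end_near. Qed.

Let pdfE (x : R) : (normal_pdf 0 1 x = normal_peak 1 * expR (- (x ^+ 2 / 2)))%R.
Proof.
rewrite normal_pdfE ?oner_eq0// /normal_fun subr0 expr1n; congr (_ * expR _)%R.
by rewrite mulNr.
Qed.

Let is_derive_pdf (x : R) : is_derive x (1%R : R) (normal_pdf 0 1) (- x * normal_pdf 0 1 x)%R.
Proof.
have dQ : is_derive x (1%R : R) (fun x : R => - (x ^+ 2 / 2))%R (- x)%R.
  have -> : (fun x : R => - (x ^+ 2 / 2))%R = horner (- 2^-1 *: 'X^2)%R.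
    by apply/funext => y; rewrite hornerZ hornerXn mulNr mulrC.
  apply: is_derive_eq; rewrite derivZ derivXn hornerZ hornerMn hornerXn /=.
  by rewrite -mulr_natr; field.
have dE := @is_derive1_comp _ expR _ x _ _ (is_derive_expR _) dQ.
have -> : normal_pdf 0 1 = (fun x : R => normal_peak 1 * expR (- (x ^+ 2 / 2)))%R.
  by apply/funext => y; rewrite pdfE.
apply: (is_derive_eq (is_deriveZ (normal_peak 1 : R) dE)).
by rewrite /GRing.scale/=; ring.
Qed.

(** In the splitting x^2/2 = x^2/8 + 3 x^2/8, the second part absorbs the factor x^2 and the first
    gives the density of standard deviation 2, an integrable majorant. *)
Let second_moment_bound (x : R) :
  (x ^+ 2 * normal_pdf 0 1 x <= 8 * normal_peak 1 / normal_peak 2 * normal_pdf 0 2 x)%R.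
Proof.
have p2 : (0 < normal_peak 2 :> R)%R by rewrite normal_peak_gt0.
have p1 : (0 < normal_peak 1 :> R)%R by rewrite normal_peak_gt0 ?oner_eq0.
have -> : (normal_pdf 0 2 x = normal_peak 2 * expR (- (x ^+ 2 / 8)))%R.
  rewrite normal_pdfE// /normal_fun subr0 mulNr; congr (_ * expR (- (_ / _)))%R.
  by rewrite -natrX -mulrnA.
rewrite pdfE [leRHS]mulrA divfK ?gt_eqF// mulrCA [leRHS]mulrAC [leRHS]mulrC ler_pM2l//.
have -> : (- (x ^+ 2 / 2) = - (x ^+ 2 / 8) + - (3 / 8 * x ^+ 2))%R by field.
rewrite expRD mulrCA [leRHS]mulrC ler_wpM2l ?expR_ge0//.
rewrite [expR (- (3 / _ * _))%R]expRN ler_pdivrMr ?expR_gt0//.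
have := expR_ge1Dx (3 / 8 * x ^+ 2)%R; have := sqr_ge0 x.
by move: (x ^+ 2)%R (expR _) => u v; lra.
Qed.

Let second_moment_integrable :
  mu.-integrable setT (fun x : T => (x ^+ 2 * normal_pdf 0 1 x)%:E).
Proof.
have mx : measurable_fun (setT : set T) (fun x : T => (x ^+ 2 * normal_pdf 0 1 x)%R).
  by apply: measurable_funM; [exact: measurable_funX|exact: measurable_normal_pdf].
apply: (@le_integrable _ _ _ mu setT measurableT _
  (fun x : T => (8 * normal_peak 1 / normal_peak 2)%:E * (normal_pdf 0 2 x)%:E)).
- exact/measurable_EFinP.
- move=> x _; rewrite -EFinM /= lee_fin.
  rewrite !ger0_norm ?second_moment_bound//.
    by rewrite !mulr_ge0// ?invr_ge0 ?normal_peak_ge0 ?normal_pdf_ge0.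
  by rewrite mulr_ge0 ?sqr_ge0 ?normal_pdf_ge0.
- by apply: integrableZl => //; exact: integrable_normal_pdf.
Qed.

(** With p the standard density, (x^2 - 1) p(x) has the primitive - x p(x), which vanishes at
    infinity. *)
Lemma normal_second_moment : \int[normal_prob 0 1]_x ((x : R) ^+ 2)%:E = 1.
Proof.
rewrite ge0_integral_normal_prob; last 2 first.
- by apply/measurable_EFinP; exact: measurable_funX.
- by move=> x; rewrite lee_fin sqr_ge0.
have i1 := second_moment_integrable.
have i2 := @integrable_normal_pdf R 0 1.
have h : \int[mu]_x ((x ^+ 2 * normal_pdf 0 1 x - normal_pdf 0 1 x)%R)%:E = 0%:E.
  apply: (@integral_primitive _ (fun x : R => - x * normal_pdf 0 1 x)%R).
  - move=> x; apply: cvgB; last exact: continuous_normal_pdf (oner_neq0 R) x.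
    apply: cvgM; last exact: continuous_normal_pdf (oner_neq0 R) x.
    exact: sqr_continuous.
  - move=> x; have dN : is_derive x (1%R : R) (fun x : R => - x)%R (-1)%R by exact: is_deriveNid.
    apply: (is_derive_eq (is_deriveM dN (is_derive_pdf x))).
    by rewrite /GRing.scale/=; ring.
  - exact: (integrableB measurableT i1 i2).
  - have -> : (fun n => - n.+1%:R * normal_pdf 0 1 n.+1%:R
        - - - n.+1%:R * normal_pdf 0 1 (- n.+1%:R))%R =
        (fun n => - (2 * normal_peak 1) * (n.+1%:R * expR (- (n.+1%:R ^+ 2 / 2))))%R :> (nat -> R).
      by apply/funext => n; rewrite !pdfE sqrrN; ring.
    rewrite -[X in _ --> X](mulr0 (- (2 * normal_peak 1))%R).
    apply: cvgM; first exact: cvg_cst.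
    apply: (@squeeze_cvgr _ _ _ _ (fun=> 0%R) (fun n => 2 * harmonic n)%R).
    + near=> n; rewrite mulr_ge0 ?expR_ge0//= expRN ler_pdivrMr ?expR_gt0//.
      rewrite /harmonic/=.
      have := expR_ge1Dx (n.+1%:R ^+ 2 / 2 : R)%R.
      have : (0 < n.+1%:R :> R)%R by [].
      move: (n.+1%:R : R) (expR _) => x v x0 hv.
      by rewrite mulrAC ler_pdivlMr//; move: hv; rewrite expr2; lra.
    + exact: cvg_cst.
    + rewrite -[X in _ --> X](mulr0 2%R); apply: cvgM; first exact: cvg_cst.
      exact: cvg_harmonic.
have e : (fun x : T => ((x ^+ 2 * normal_pdf 0 1 x - normal_pdf 0 1 x)%R)%:E) =
  (fun x : T => (x ^+ 2 * normal_pdf 0 1 x)%:E - (normal_pdf 0 1 x)%:E) by [].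
move: h; rewrite e (integralB measurableT i1 i2) integral_normal_pdf => h.
under eq_integral => x _ do rewrite -EFinM.
have fi : \int[mu]_x (x ^+ 2 * normal_pdf 0 1 x)%:E \is a fin_num.
  exact: integrable_fin_num.
by move: h; rewrite -(fineK fi) -EFinB => -[] /eqP; rewrite subr_eq0 => /eqP ->.
Unshelve. all: by end_near. Qed.

End normal_integral2.

(** * Centred Gaussian laws: moments, sums and limits *)

Section gaussian_law.
Context {R : realType}.
Local Notation RT := (measurableTypeR R).
Local Notation N01 := (normal_prob (0 : R) 1).
Local Open Scope ereal_scope.

Lemma measurable_mulr (s : R) : measurable_fun (setT : set RT) (fun z : RT => s * z : RT)%R.
Proof. exact: measurable_funM. Qed.

(* The centred Gaussian law of standard deviation [s >= 0], degenerate at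
   [s = 0], is the image of the standard one under multiplication by [s]. *)
Definition gaussian_law d (T : measurableType d) (Q : set T -> \bar R)
    (X : T -> R) (s : R) : Prop :=
  forall A : set RT, measurable A -> Q (X @^-1` A) = N01 ((fun z : R => s * z)%R @^-1` A).

Lemma gaussian_lawP d (T : measurableType d) (Q : {measure set T -> \bar R})
    (X : T -> R) (s : R) : measurable_fun (setT : set T) (X : T -> RT) ->
  (forall f : R -> R, continuous f -> (forall x, 0 <= f x <= 1)%R ->
    \int[Q]_w (f (X w))%:E = \int[N01]_z (f (s * z)%R)%:E) ->
  gaussian_law Q X s.
Proof.
move=> mX QN A mA.
have mS := measurable_mulr s.
pose Xm : {mfun T >-> RT} := HB.pack X (@isMeasurableFun.Build _ _ T RT X mX).
pose Sm : {mfun RT >-> RT} := HB.pack (fun z : RT => s * z : RT)%R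
  (@isMeasurableFun.Build _ _ RT RT _ mS).
have fin : pushforward N01 Sm setT < +oo.
  by rewrite (_ : pushforward N01 Sm setT = 1) ?ltry//; exact: probability_setT.
suff h : forall f : R -> R, continuous f -> (forall x, 0 <= f x <= 1)%R ->
    \int[pushforward N01 Sm]_x (f x)%:E = \int[pushforward Q Xm]_x (f x)%:E.
  have := @measure_eq_continuous R (pushforward N01 Sm) (pushforward Q Xm) fin h A mA.
  by move=> e; exact: esym (e mS mX).
move=> f cf f01.
have mf : measurable_fun (setT : set RT) (fun x : RT => (f x)%:E).
  by apply/measurable_EFinP; exact: continuous_measurable_fun.
have f0 : {in setT, forall x : RT, 0 <= (f x)%:E}.
  by move=> x _; rewrite lee_fin; have /andP[] := f01 x.
have := ge0_integral_pushforward mS N01 measurableT mf f0.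
rewrite preimage_setT => ->.
have := ge0_integral_pushforward mX Q measurableT mf f0.
by rewrite preimage_setT => ->; rewrite -QN.
Qed.

Lemma ge0_integral_gaussian_law d (T : measurableType d) (Q : {measure set T -> \bar R})
    (X : T -> R) (s : R) (f : R -> \bar R) :
  measurable_fun (setT : set T) (X : T -> RT) -> gaussian_law Q X s ->
  measurable_fun (setT : set RT) f -> (forall x, 0 <= f x) ->
  \int[Q]_w f (X w) = \int[N01]_z f (s * z)%R.
Proof.
move=> mX QX mf f0; have mS := measurable_mulr s.
have f0' : {in setT, forall x : RT, 0 <= f x} by move=> x _; exact: f0.
have := ge0_integral_pushforward mX Q measurableT mf f0'.
rewrite preimage_setT => <-.
have := ge0_integral_pushforward mS N01 measurableT mf f0'.
rewrite preimage_setT => <-.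
by apply: eq_measure_integral => A mA _; exact: QX.
Qed.

Lemma integral_gaussian_law d (T : measurableType d) (P : probability T R)
    (X : T -> R) (s : R) :
  measurable_fun (setT : set T) (X : T -> RT) -> gaussian_law P X s ->
  [/\ \int[P]_w (X w ^+ 2)%:E = (s ^+ 2)%:E,
      P.-integrable setT (fun w => (X w ^+ 2)%:E),
      P.-integrable setT (fun w => (X w)%:E) & \int[P]_w (X w)%:E = 0].
Proof.
move=> mX QX.
have mX2 : measurable_fun (setT : set T) (fun w => (X w ^+ 2)%:E).
  by apply/measurable_EFinP; exact: measurable_funX.
have m2 : measurable_fun (setT : set RT) (fun x : RT => ((x : R) ^+ 2)%:E).
  by apply/measurable_EFinP; exact: measurable_funX.
have e2 : \int[P]_w (X w ^+ 2)%:E = (s ^+ 2)%:E.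
  rewrite (ge0_integral_gaussian_law mX QX m2) => [|x]; last by rewrite lee_fin sqr_ge0.
  under eq_integral => x _ do rewrite exprMn EFinM.
  rewrite ge0_integralZl//; last 2 first.
  - by move=> x _; rewrite lee_fin sqr_ge0.
  - by rewrite lee_fin sqr_ge0.
  by rewrite normal_second_moment mule1.
have i2 : P.-integrable setT (fun w => (X w ^+ 2)%:E).
  apply/integrableP; split => //.
  by under eq_integral => w _ do rewrite gee0_abs ?lee_fin ?sqr_ge0//; rewrite e2 ltry.
(* Integrable because |X| <= 1 + X^2. *)
have i1 : P.-integrable setT (fun w => (X w)%:E).
  apply: (@le_integrable _ _ _ P setT measurableT _ (fun w => (1 + X w ^+ 2)%:E)).
  - exact/measurable_EFinP.
  - move=> w _; rewrite /= lee_fin [leRHS]ger0_norm ?addr_ge0 ?sqr_ge0//.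
    rewrite -(real_normK (num_real (X w))); have := normr_ge0 (X w); nra.
  - have -> : (fun w => (1 + X w ^+ 2)%:E) = (cst 1 \+ (fun w => (X w ^+ 2)%:E)) by [].
    apply: integrableD => //; exact: finite_measure_integrable_cst.
split => //.
have mXE : measurable_fun (setT : set T) (fun w => (X w)%:E) by exact/measurable_EFinP.
have mmax (e : R) : measurable_fun (setT : set RT) (fun x : RT => (Num.max (e * x) 0)%:E).
  apply/measurable_EFinP; apply: measurable_maxr; last exact: measurable_cst.
  exact: measurable_funM.
have pos (e : R) : \int[P]_w (Num.max (e * X w) 0)%:E =
    \int[N01]_z (Num.max (e * (s * z)) 0)%:E.
  apply: (ge0_integral_gaussian_law mX QX (mmax e)) => x.
  by rewrite lee_fin le_max lexx orbT.
rewrite integralE.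
have -> : \int[P]_w (fun w => (X w)%:E)^\+ w = \int[P]_w (Num.max (1 * X w) 0)%:E.
  by apply: eq_integral => w _; rewrite funeposE mul1r EFin_max.
have -> : \int[P]_w (fun w => (X w)%:E)^\- w = \int[P]_w (Num.max (- 1 * X w) 0)%:E.
  by apply: eq_integral => w _; rewrite funenegE mulN1r EFin_max.
(* The mean vanishes: by symmetry of the standard law, the positive and negative parts of X have
   equal integrals. *)
have eN : \int[P]_w (Num.max (- 1 * X w) 0)%:E = \int[P]_w (Num.max (1 * X w) 0)%:E.
  rewrite !pos -[RHS](normal_prob_sym (f := fun z => Num.max (1 * (s * z)) 0)%R).
  - by apply: eq_integral => z _; rewrite mul1r mulN1r mulrN.
  - apply: measurable_maxr; last exact: measurable_cst.
    by apply: measurable_funM => //; exact: measurable_funM.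
  - by move=> x; rewrite le_max lexx orbT.
rewrite eN subee//.
apply: integrable_fin_num => //.
apply: (@le_integrable _ _ _ P setT measurableT _ (fun w => (X w)%:E)) => //.
- apply/measurable_EFinP; apply: measurable_maxr; last exact: measurable_cst.
  by apply: measurable_funM.
- move=> w _; rewrite /= lee_fin mul1r ger0_norm ?le_max ?lexx ?orbT//.
  by rewrite ge_max ler_norm normr_ge0.
Qed.

Lemma gaussian_law_normal d (T : measurableType d) (P : probability T R)
    (X : T -> R) (s : R) : (0 <= s)%R ->
  measurable_fun (setT : set T) (X : T -> RT) -> gaussian_law P X s ->
  gaussian_variable P X.
Proof.
move=> s0 mX PX; split; first exact: mX.
exists 0%R, s => A mA; rewrite PX//.
have [->|sn0] := eqVneq s 0%R.
  rewrite diracE; have [A0|A0] := boolP (0%R \in A).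
    have -> : (fun z : R => 0 * z)%R @^-1` A = setT.
      by apply/seteqP; split => // z _ /=; rewrite mul0r; exact: set_mem.
    by rewrite probability_setT.
  have -> : (fun z : R => 0 * z)%R @^-1` A = set0.
    by apply/seteqP; split => // z /=; rewrite mul0r => /mem_set; rewrite (negbTE A0).
  by rewrite measure0.
have sp : (0 < s)%R by rewrite lt_neqAle eq_sym sn0.
apply/esym.
have h : gaussian_law (normal_prob 0 s) (fun x : RT => x : R) s.
  apply: gaussian_lawP; first exact: measurable_id.
  move=> f cf f01.
  have f0 x : (0 <= f x)%R by have /andP[] := f01 x.
  have -> : \int[N01]_z (f (s * z)%R)%:E = \int[N01]_z (f (s * z + 0)%R)%:E.
    by apply: eq_integral => z _; rewrite addr0.
  rewrite normal_prob_affine// ge0_integral_normal_prob//.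
  by apply/measurable_EFinP; exact: continuous_measurable_fun.
exact: h.
Qed.

(** By the product formula on rectangles, the law of (X, Y) is a product measure, to which
    [normal_prob_convolution] applies. A general measure Q makes room for P conditioned on an
    event. *)
Lemma gaussian_law_add d (T : measurableType d) (Q : {measure set T -> \bar R})
    (X Y : T -> R) (c s : R) :
  (0 <= s)%R -> measurable_fun (setT : set T) (X : T -> RT) ->
  measurable_fun (setT : set T) (Y : T -> RT) ->
  (forall A B : set RT, measurable A -> measurable B ->
    Q (X @^-1` A `&` Y @^-1` B) = N01 ((fun z : R => s * z)%R @^-1` A) * N01 B) ->
  gaussian_law Q (fun w => X w + c * Y w)%R (Num.sqrt (s ^+ 2 + c ^+ 2)).
Proof.
move=> s0 mX mY QXY.
have mS := measurable_mulr s.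
have mXY : measurable_fun setT (fun w => (X w : RT, Y w : RT)) by exact: measurable_fun_pair.
pose Sm : {mfun RT >-> RT} := HB.pack (fun z : RT => s * z : RT)%R
  (@isMeasurableFun.Build _ _ RT RT _ mS).
pose XY : {mfun T >-> (RT * RT)%type} := HB.pack (fun w => (X w : RT, Y w : RT))
  (@isMeasurableFun.Build _ _ T (RT * RT)%type _ mXY).
apply: gaussian_lawP.
  by apply: measurable_funD => //; apply: measurable_funM.
move=> f cf f01.
have f0 x : (0 <= f x)%R by have /andP[] := f01 x.
have mf : measurable_fun (setT : set RT) (f : RT -> RT) by exact: continuous_measurable_fun.
pose g (z : RT * RT) := (f (z.1 + c * z.2)%R)%:E.
have mg : measurable_fun setT g.
  apply/measurable_EFinP; apply: (measurableT_comp (f := f : RT -> RT)) => //.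
  apply: measurable_funD; first exact: measurable_fst.
  by apply: measurable_funM => //; exact: measurable_snd.
have g0 z : 0 <= g z by rewrite lee_fin.
have g0' : {in setT, forall z : RT * RT, 0 <= g z} by move=> z _.
transitivity (\int[Q]_w (g \o (fun w => (X w : RT, Y w : RT))) w) => //.
have := ge0_integral_pushforward mXY Q measurableT mg g0'.
rewrite preimage_setT => <-.
transitivity (\int[(distribution N01 Sm \x N01)%E]_z g z).
  apply: eq_measure_integral => A mA _.
  have rect (B C : set RT) : measurable B -> measurable C ->
      pushforward Q XY (B `*` C) = distribution N01 Sm B * N01 C.
    by move=> mB mC; exact: QXY.
  have e := @product_measure_unique _ _ RT RT R (distribution N01 Sm) N01
    (pushforward Q XY).
  by first [exact: esym (e mXY rect A mA) | exact: (e mXY rect A mA)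
    | exact: esym (e rect A mA mXY)].
rewrite (@fubini_tonelli2 _ _ RT RT R (distribution N01 Sm) N01 g mg g0).
rewrite -(@normal_prob_convolution R s c f cf f0 s0).
apply: eq_integral => y _; rewrite /fubini_G.
have mgy : measurable_fun (setT : set RT) (fun x : RT => g (x, y)).
  exact: (measurableT_comp mg (measurable_pair2 y)).
have gy0 : {in setT, forall x : RT, 0 <= g (x, y)} by move=> z _.
have := ge0_integral_pushforward mS N01 measurableT mgy gy0.
by rewrite preimage_setT => ->.
Qed.

(** For bounded continuous f, dominated convergence applies on both sides: along [X n] under P, and
    along the scalings [s n] under the standard law. A zero limit of the scalings is no special
    case. *)
Lemma gaussian_law_limit d (T : measurableType d) (P : probability T R)
    (X : nat -> T -> R) (Y : T -> R) (s : nat -> R) (l : R) :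
  (forall n, measurable_fun (setT : set T) (X n : T -> RT)) ->
  measurable_fun (setT : set T) (Y : T -> RT) ->
  (forall n, gaussian_law P (X n) (s n)) ->
  {ae P, forall w, X n w @[n --> \oo] --> Y w} -> s @ \oo --> l ->
  gaussian_law P Y l.
Proof.
move=> mX mY PX XY sl; apply: gaussian_lawP => // f cf f01.
have f0 x : (0 <= f x)%R by have /andP[] := f01 x.
have mf : measurable_fun (setT : set RT) (f : RT -> RT) by exact: continuous_measurable_fun.
have f1 x : `|(f x)%:E| <= 1.
  by rewrite /= lee_fin ger0_norm//; have /andP[] := f01 x.
have [_ _ h1] := @dominated_convergence _ T R P setT measurableT
  (fun n w => (f (X n w))%:E) (fun w => (f (Y w))%:E) (cst 1)
  (fun n => proj2 (measurable_EFinP _ _) (measurableT_comp mf (mX n)))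
  (proj2 (measurable_EFinP _ _) (measurableT_comp mf mY))
  ltac:(by apply: filterS XY => w h _; apply: cvg_EFin; [exact: nearW|
    apply: (cvg_comp _ f h); exact: cf])
  (finite_measure_integrable_cst P 1%R measurableT) ltac:(by apply: nearW => w n _; exact: f1).
have mS (r : R) := measurableT_comp mf (measurable_mulr r).
have [_ _ h2] := @dominated_convergence _ RT R N01 setT measurableT
  (fun n z => (f (s n * z)%R)%:E) (fun z => (f (l * z)%R)%:E) (cst 1)
  (fun n => proj2 (measurable_EFinP _ _) (mS (s n)))
  (proj2 (measurable_EFinP _ _) (mS l))
  ltac:(by apply: nearW => z _; apply: cvg_EFin; [exact: nearW|
    apply: (cvg_comp _ f _ (cf _)); apply: cvgM => //; exact: cvg_cst])
  (finite_measure_integrable_cst N01 1%R measurableT) ltac:(by apply: nearW => w n _; exact: f1).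
have mfE : measurable_fun (setT : set RT) (fun x : RT => (f x)%:E).
  by apply/measurable_EFinP; exact: continuous_measurable_fun.
have e : (fun n => \int[P]_w (f (X n w))%:E) = (fun n => \int[N01]_z (f (s n * z)%R)%:E).
  apply/funext => n; apply: (@ge0_integral_gaussian_law _ T P (X n) (s n)
    (fun x => (f x)%:E) (mX n) (PX n) mfE) => x.
  by rewrite lee_fin.
have h1' : (fun n => \int[P]_w (f (X n w))%:E) @ \oo --> \int[P]_w (f (Y w))%:E := h1.
rewrite e in h1'.
by rewrite -(cvg_lim (@ereal_hausdorff R) h1') -(cvg_lim (@ereal_hausdorff R) h2).
Qed.

End gaussian_law.

(** * Measurability of pointwise limits *)

Section measurability_of_limits.
Context d (X : measurableType d) {R : realType}.
Local Notation RT := (measurableTypeR R).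

(* The convergence set is described by the Cauchy criterion. *)
Lemma measurable_cvgn (u : nat -> X -> R) :
  (forall n, measurable_fun (setT : set X) (u n : X -> RT)) ->
  measurable [set x | cvgn (u ^~ x)].
Proof.
move=> mu.
have -> : [set x | cvgn (u ^~ x)] = \bigcap_k \bigcup_N \bigcap_n
    [set x | `|u N x - u (N + n)%N x| <= k.+1%:R^-1].
  apply/seteqP; split => x /=.
    move=> /cvgrPdist_le ux k _.
    have k0 : 0 < (k.+1%:R^-1 / 2 : R) by rewrite divr_gt0// invr_gt0.
    have [N _ hN] := ux _ k0; exists N => // n _ /=.
    have h1 := hN N (leqnn N); have h2 := hN (N + n)%N (leq_addr n N).
    rewrite -(subrKA (limn (u ^~ x))); apply: (le_trans (ler_normD _ _)).
    by rewrite distrC in h1; rewrite [leRHS]splitr lerD.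
  move=> h; apply/cauchy_cvgP; apply: cauchy_exP => e e0.
  have [N _ hN] := h (Num.truncn e^-1) I.
  exists (u N x); exists N => // n /= Nn; rewrite -ball_normE /ball_/=.
  have := hN (n - N)%N I; rewrite /= subnKC// => h1.
  apply: (le_lt_trans h1); rewrite invf_plt ?posrE//.
  exact: truncnS_gt.
apply: bigcap_measurable => [|k _]; first by exists 0%N.
apply: bigcup_measurable => N _.
apply: bigcap_measurable => [|n _]; first by exists 0%N.
have mD : measurable_fun (setT : set X) (fun x => `|u N x - u (N + n)%N x| : RT).
  by apply: measurableT_comp => //; apply: measurable_funB; exact: mu.
have -> : [set x | `|u N x - u (N + n)%N x| <= k.+1%:R^-1] =
    setT `&` (fun x => `|u N x - u (N + n)%N x| : RT) @^-1` `]-oo, k.+1%:R^-1]%classic.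
  by rewrite setTI; apply/seteqP; split => x /=; rewrite in_itv.
by apply: mD => //; exact: measurable_itv.
Qed.

(** The limit is the upper limit on the convergence set and the default value [point] elsewhere;
    gluing along a measurable set preserves measurability. *)
Lemma measurable_limn (u : nat -> X -> R) :
  (forall n, measurable_fun (setT : set X) (u n : X -> RT)) ->
  measurable_fun (setT : set X) ((fun x => limn (u ^~ x)) : X -> RT).
Proof.
move=> mu; have mC := measurable_cvgn mu; set C := [set x | _] in mC.
have -> : (fun x => limn (u ^~ x)) = (fun x => \1_C x *
    fine (limn_esup (fun n => (u n x)%:E)) + (1 - \1_C x) * (point : R)).
  apply/funext => x; rewrite indicE; have [xC|xC] := boolP (x \in C).
    have cx : cvgn (u ^~ x) by exact: set_mem xC.
    rewrite mul1r subrr mul0r addr0.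
    have h : (u n x)%:E @[n --> \oo] --> (limn (u ^~ x))%:E.
      by apply: cvg_EFin; [exact: nearW|exact: cx].
    rewrite is_cvg_limn_esupE; last by apply/cvg_ex; eexists; exact: h.
    by rewrite (cvg_lim (@ereal_hausdorff R) h).
  rewrite mul0r add0r subr0 mul1r; apply: dvgP => cx.
  by move/negP: xC; apply; exact: mem_set.
have m1 : measurable_fun (setT : set X) (\1_C : X -> RT) by exact: measurable_indic.
apply: measurable_funD; apply: measurable_funM => //.
  apply: measurableT_comp; first exact: fine_measurable.
  by apply: measurable_fun_limn_esup => n; apply/measurable_EFinP; exact: mu.
exact: measurable_funB.
Qed.

End measurability_of_limits.

(** * Cubes of indices, kernel and variance *)

Section cube_combinatorics.
Context {R : realType}.
Implicit Types (N : nat).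

(** The cube as a list without repetition, the form in which [mutually_independent] takes its
    indices. *)
Definition cube_seq N : seq (nat * nat * nat) :=
  [seq (mn, p) | mn <- [seq (m, n) | m <- iota 0 N.+1, n <- iota 0 N.+1], p <- iota 0 N.+1].

Lemma cube_seq_uniq N : uniq (cube_seq N).
Proof.
rewrite allpairs_uniq ?iota_uniq// => [|[a b] [c e] _ _ [-> ->]//].
by rewrite allpairs_uniq ?iota_uniq// => -[a b] [c e] _ _ [-> ->].
Qed.

Lemma cubeE (g : nat * nat * nat -> R) N : cube g N = \sum_(i <- cube_seq N) g i.
Proof.
rewrite /cube_seq !big_allpairs/= /cube -(big_mkord xpredT (fun m =>
  \sum_(n < N.+1) \sum_(p < N.+1) g (m, n : nat, p : nat))) /index_iota subn0.
apply: eq_bigr => m _; rewrite -(big_mkord xpredT (fun n =>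
  \sum_(p < N.+1) g (m, n, p : nat))) /index_iota subn0.
by apply: eq_bigr => n _; rewrite -(big_mkord xpredT (fun p => g (m, n, p)))
  /index_iota subn0.
Qed.

Lemma cube_product (f g h : nat -> R) N :
  cube (fun i => f i.1.1 * g i.1.2 * h i.2) N =
  series f N.+1 * series g N.+1 * series h N.+1.
Proof.
rewrite /cube /series/= !big_mkord -mulrA mulr_suml; apply: eq_bigr => m _.
rewrite [X in _ = _ * X]big_distrlr/= mulr_sumr; apply: eq_bigr => n _.
by rewrite mulr_sumr; apply: eq_bigr => p _; rewrite mulrA.
Qed.

Definition coef (x : R * R * R) (i : nat * nat * nat) : R :=
  Num.sqrt (tau R i) * psi i x.

Lemma tau_sqrt (i : nat * nat * nat) : Num.sqrt (tau R i) =
  Num.sqrt (lambda R i.1.1) * Num.sqrt (lambda R i.1.2) * Num.sqrt (lambda R i.2).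
Proof. by rewrite /tau !sqrtrM ?mulr_ge0 ?powR_ge0. Qed.

Lemma coef_eigen x i : coef x i =
  eigen 0 i.1.1 x.1.1 * eigen 0 i.1.2 x.1.2 * eigen 0 i.2 x.2.
Proof. by rewrite /coef /psi tau_sqrt !eigen0; ring. Qed.

Lemma gauss_kernelE (x y : R * R * R) : gauss_kernel x y =
  expR (- (x.1.1 - y.1.1) ^+ 2) * expR (- (x.1.2 - y.1.2) ^+ 2) *
  expR (- (x.2 - y.2) ^+ 2).
Proof.
rewrite /gauss_kernel /euclidean_norm sqr_sqrtr ?addr_ge0 ?sqr_ge0// -!expRD.
by congr expR; rewrite /=; ring.
Qed.

(** On cubes, a sum of products of functions of m, n and p factors into one-variable partial sums,
    so [kernel_expansion] applies to each coordinate. *)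
Lemma kernel_cube (x y : R * R * R) :
  cube (fun i => coef x i * coef y i) @ \oo --> gauss_kernel x y.
Proof.
have eq1 : cube (fun i => coef x i * coef y i) = (fun N =>
    series (fun n => lambda R n * phi n x.1.1 * phi n y.1.1) N.+1 *
    series (fun n => lambda R n * phi n x.1.2 * phi n y.1.2) N.+1 *
    series (fun n => lambda R n * phi n x.2 * phi n y.2) N.+1).
  apply/funext => N; rewrite -cube_product; apply: eq_cube => i.
  rewrite /coef mulrACA -expr2 sqr_sqrtr ?mulr_ge0 ?powR_ge0//.
  by rewrite /tau /psi; ring.
have sh (s t : R) : series (fun n => lambda R n * phi n s * phi n t) N.+1
    @[N --> \oo] --> expR (- (s - t) ^+ 2).
  by rewrite cvg_shiftS; exact: kernel_expansion.
rewrite eq1 gauss_kernelE.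
by apply: cvgM; [apply: cvgM|]; exact: sh.
Qed.

Lemma cube_sum (r : nat) (g : 'I_r -> nat * nat * nat -> R) N :
  cube (fun i => \sum_(j < r) g j i) N = \sum_(j < r) cube (g j) N.
Proof.
rewrite cubeE exchange_big/=; apply: eq_bigr => j _.
by rewrite cubeE.
Qed.

Definition field_variance (r : nat) (a : 'I_r -> R) (x : 'I_r -> R * R * R) : R :=
  \sum_(j < r) \sum_(l < r) a j * a l * gauss_kernel (x j) (x l).

Lemma cvg_sum_seq (J : Type) (s : seq J) (g : J -> nat -> R) (l : J -> R) :
  (forall j, g j @ \oo --> l j) ->
  (fun N => \sum_(j <- s) g j N) @ \oo --> \sum_(j <- s) l j.
Proof.
move=> gl; elim: s => [|j s ih].
  rewrite big_nil; have -> : (fun N => \sum_(j <- [::]) g j N) = cst 0.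
    by apply/funext => N; rewrite big_nil.
  exact: cvg_cst.
rewrite big_cons; have -> : (fun N => \sum_(i <- j :: s) g i N) =
    (fun N => g j N + \sum_(i <- s) g i N).
  by apply/funext => N; rewrite big_cons.
by apply: cvgD.
Qed.

Lemma variance_cube (r : nat) (a : 'I_r -> R) (x : 'I_r -> R * R * R) :
  cube (fun i => (\sum_(j < r) a j * coef (x j) i) ^+ 2) @ \oo --> field_variance a x.
Proof.
have -> : cube (fun i => (\sum_(j < r) a j * coef (x j) i) ^+ 2) = (fun N =>
    \sum_(j < r) \sum_(l < r) a j * a l * cube (fun i => coef (x j) i * coef (x l) i) N).
  apply/funext => N.
  under [RHS]eq_bigr => j _ do under eq_bigr => l _ do rewrite -cubeZ.
  under [RHS]eq_bigr => j _ do rewrite -cube_sum.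
  rewrite -cube_sum; apply: eq_cube => i.
  rewrite expr2 big_distrl/=; apply: eq_bigr => j _.
  by rewrite big_distrr/=; apply: eq_bigr => l _; rewrite mulrACA.
apply: cvg_sum_seq => j; apply: cvg_sum_seq => l.
by apply: cvgM; [exact: cvg_cst|exact: kernel_cube].
Qed.

End cube_combinatorics.

(** * Pathwise convergence and the envelope *)

Section pathwise.
Context {R : realType}.
Variable z : nat * nat * nat -> R.
Hypothesis cvg_weight : cvgn (cube (weight z)).

Definition path_sum N (x : R * R * R) : R := cube (fun i => z i * coef x i) N.

Lemma path_sumE x : path_sum ^~ x = cube (eterm z (0, 0, 0)%N x).
Proof. by apply/funext => N; apply: eq_cube => i; rewrite coef_eigen. Qed.

Lemma path_sum_cvg x : cvgn (path_sum ^~ x).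
Proof. by rewrite path_sumE; exact: eterm_cvg. Qed.

Lemma path_sum_smooth : smooth (fun x => limn (path_sum ^~ x)).
Proof.
have -> : (fun x => limn (path_sum ^~ x)) = eigen_sum z (0, 0, 0)%N.
  by apply/funext => x; rewrite path_sumE.
exact: eigen_sum_smooth.
Qed.

(** Its square exp(|x|^2 / 2) is integrable for [theta], whose density is proportional to
    exp(-|x|^2). *)
Definition envelope (x : R * R * R) : R :=
  expR (x.1.1 ^+ 2 / 4) * expR (x.1.2 ^+ 2 / 4) * expR (x.2 ^+ 2 / 4).

(** Unlike [eterm_dominated], which works on boxes, this bound holds on the whole space, as the L_2
    estimates require: the dependence on x is confined to the envelope. *)
Lemma path_sum_envelope : exists2 C : R, 0 <= C & forall x,
  dominated (weight z) (C * envelope x) (fun i => z i * coef x i).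
Proof.
have [C C0 hC] := @weighted_phi_bound R; exists (C ^+ 3); first by rewrite exprn_ge0.
move=> x i; rewrite coef_eigen.
have h n t : `|eigen 0 n t| <= C * expR (t ^+ 2 / 4) * (19 / 20) ^+ n.
  rewrite eigen0 normrM ger0_norm//; apply: (le_trans (hC n t)).
  rewrite mulrAC; apply: ler_wpM2l; first by rewrite mulr_ge0// expR_ge0.
  by apply: lerXn2r; rewrite ?nnegrE; lra.
have := @product_dominated _ z _ _ _ _ _ _ i (h _ x.1.1) (h _ x.1.2) (h _ x.2).
move=> /le_trans; apply; rewrite le_eqVlt; apply/orP; left; apply/eqP.
by rewrite /envelope; ring.
Qed.

End pathwise.

(** * Combinations of independent standard Gaussians *)

Section independent_gaussians.
Context d (T : measurableType d) {R : realType} (P : probability T R).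
Context (I : choiceType) (Z : I -> {RV P >-> R}).
Hypothesis Z_gauss : forall i, standard_gaussian (Z i).
Hypothesis Z_indep : mutually_independent Z.
Local Notation RT := (measurableTypeR R).
Local Notation N01 := (normal_prob (0 : R) 1).
Implicit Types (s t : seq I) (c : I -> R) (B : I -> set R).
Local Open Scope ereal_scope.

Let mZ i : measurable_fun (setT : set T) (Z i : T -> RT).
Proof. exact: (measurable_funPT (Z i)). Qed.

Let event t B := \bigcap_(i in [set` t]) (Z i @^-1` B i).

Let measurable_event t B : (forall i, measurable (B i)) -> measurable (event t B).
Proof.
move=> mB; rewrite /event bigcap_seq; apply: bigsetI_measurable => i _.
by rewrite -[X in measurable X]setTI; apply: (mZ i) => //; exact: mB.
Qed.

Lemma measurable_combination s c :
  measurable_fun (setT : set T) ((fun w => \sum_(i <- s) c i * Z i w)%R : T -> RT).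
Proof.
by apply: measurable_sum => i; apply: measurable_funM => //; exact: mZ.
Qed.

Let PZ i (A : set R) : measurable A -> P (Z i @^-1` A) = N01 A.
Proof. by move=> mA; exact: Z_gauss. Qed.

(* The independence of the sum from the remaining variables is carried along
   the induction by the event; conditioning on it reduces the inductive step
   to the sum of two independent variables. *)
Lemma gaussian_combination_event s c : forall t B (A : set R), uniq (s ++ t) ->
  (forall i, measurable (B i)) -> measurable A ->
  P (((fun w => \sum_(i <- s) c i * Z i w)%R @^-1` A) `&` event t B) =
  N01 ((fun z : R => Num.sqrt (\sum_(i <- s) c i ^+ 2) * z)%R @^-1` A) * P (event t B).
Proof.
elim: s => [|k s ih] t B A.
  move=> _ mB mA.
  have [A0|A0] := boolP ((0 : R)%R \in A).
    have -> : (fun w => \sum_(i <- [::]) c i * Z i w)%R @^-1` A = setT.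
      by apply/seteqP; split => // w _ /=; rewrite big_nil; exact: set_mem.
    have -> : (fun z : R => Num.sqrt (\sum_(i <- [::]) c i ^+ 2) * z)%R @^-1` A = setT.
      apply/seteqP; split => // w _ /=; rewrite big_nil sqrtr0 mul0r; exact: set_mem.
    by rewrite setTI probability_setT mul1e.
  have -> : (fun w => \sum_(i <- [::]) c i * Z i w)%R @^-1` A = set0.
    by apply/seteqP; split => // w /=; rewrite big_nil => /mem_set; rewrite (negbTE A0).
  have -> : (fun z : R => Num.sqrt (\sum_(i <- [::]) c i ^+ 2) * z)%R @^-1` A = set0.
    apply/seteqP; split => // w /=; rewrite big_nil sqrtr0 mul0r => /mem_set.
    by rewrite (negbTE A0).
  by rewrite set0I !measure0 mul0e.
rewrite cat_cons cons_uniq => /andP[kst ust] mB mA.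
have mW := measurable_event t mB.
have kt : k \notin t by move: kst; rewrite mem_cat negb_or => /andP[].
have ut : uniq t by move: ust; rewrite cat_uniq => /and3P[].
have Wfin : P (event t B) \is a fin_num by exact: fin_num_measure.
(* A null event does not allow conditioning, but both sides are then 0. *)
have [W0|W0] := eqVneq (P (event t B)) 0.
  rewrite W0 mule0; apply/eqP; rewrite eq_le measure_ge0 andbT -W0.
  apply: le_measure; rewrite ?inE//.
  apply: measurableI => //; rewrite -[X in measurable X]setTI.
  exact: (measurable_combination (k :: s) c measurableT mA).
pose p := fine (P (event t B)).
have pE : P (event t B) = p%:E by rewrite fineK.
have p0 : (0 < p)%R by rewrite -lte_fin -pE lt_neqAle eq_sym W0 measure_ge0.
have pV0 : (0 <= p^-1)%R by rewrite invr_ge0 ltW.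
(* P conditioned on the event; [QXY] says that under Q the variables X and [Z k] are independent and
   keep their laws. *)
pose Q : {measure set T -> \bar R} := mscale (NngNum pV0) (mrestr P mW).
pose X := (fun w => \sum_(i <- s) c i * Z i w)%R.
have QXY (A' B' : set RT) : measurable A' -> measurable B' ->
    Q (X @^-1` A' `&` Z k @^-1` B') =
    N01 ((fun z : R => Num.sqrt (\sum_(i <- s) c i ^+ 2) * z)%R @^-1` A') * N01 B'.
  move=> mA' mB'.
  (* The constraint on [Z k] is moved into the event, so that the induction hypothesis applies with
     [k :: t]. *)
  pose B2 i := if i == k then B' else B i.
  have mB2 i : measurable (B2 i) by rewrite /B2; case: ifP => _; [exact: mB'|exact: mB].
  have B2t i : i \in t -> B2 i = B i.
    by move=> it; rewrite /B2; case: eqP => // ik; rewrite -ik it in kt.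
  have evE : event (k :: t) B2 = Z k @^-1` B' `&` event t B.
    rewrite /event !bigcap_seq big_cons {1}/B2 eqxx; congr (_ `&` _).
    by apply: eq_big_seq => i it; rewrite B2t.
  have ukt : uniq (k :: t) by rewrite /= kt.
  have Pev : P (event (k :: t) B2) = N01 B' * p%:E.
    rewrite /event Z_indep// big_cons {1}/B2 eqxx PZ//; congr (_ * _).
    rewrite -pE /event Z_indep//; apply: eq_big_seq => i it.
    by rewrite B2t.
  have usk : uniq (s ++ k :: t).
    by rewrite -(perm_uniq (permEl (perm_catCA [:: k] s t))) /= kst.
  have -> : Q (X @^-1` A' `&` Z k @^-1` B') =
      (p^-1)%:E * P (X @^-1` A' `&` event (k :: t) B2) by rewrite evE setIA.
  have gen (a b : \bar R) : (p^-1)%:E * (a * (b * p%:E)) = a * b.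
    by rewrite (muleA a) (muleC (a * b)) muleA -EFinM mulVf ?gt_eqF// mul1e.
  by rewrite ih// Pev gen.
have mX : measurable_fun (setT : set T) (X : T -> RT) by exact: measurable_combination.
have := gaussian_law_add (c k) (sqrtr_ge0 _) mX (mZ k) QXY.
move=> /(_ A mA) h.
have {}h : (p^-1)%:E * P ((fun w => X w + c k * Z k w)%R @^-1` A `&` event t B) =
  N01 ((fun z : R => Num.sqrt (Num.sqrt (\sum_(i <- s) c i ^+ 2) ^+ 2 + c k ^+ 2) * z)%R
    @^-1` A) := h.
rewrite sqr_sqrtr in h; last by apply: sumr_ge0 => i _; exact: sqr_ge0.
have -> : (fun w => \sum_(i <- k :: s) c i * Z i w)%R = (fun w => X w + c k * Z k w)%R.
  by apply/funext => w; rewrite big_cons addrC.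
rewrite big_cons addrC -h muleC muleA pE -EFinM divff ?mul1e// gt_eqF//.
Qed.

Lemma gaussian_law_combination s c : uniq s ->
  gaussian_law P (fun w => \sum_(i <- s) c i * Z i w)%R
    (Num.sqrt (\sum_(i <- s) c i ^+ 2)).
Proof.
move=> us A mA.
have := @gaussian_combination_event s c [::] (fun=> setT) A.
rewrite cats0 /event => /(_ us (fun=> measurableT) mA).
by rewrite set_nil bigcap_set0 setIT probability_setT mule1.
Qed.

Lemma gaussian_law_standard i : gaussian_law P (Z i) 1.
Proof.
move=> A mA; rewrite PZ//; congr (N01 _).
by apply/seteqP; split => z /=; rewrite mul1r.
Qed.

Lemma integral_abs_standard i : \int[P]_w (`|Z i w|)%:E <= 2%:E.
Proof.
have [e2 i2 _ _] := integral_gaussian_law (mZ i) (gaussian_law_standard i).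
have m2 : measurable_fun (setT : set T) (fun w => (Z i w ^+ 2)%:E).
  exact: measurable_int i2.
(* Integration of |y| <= 1 + y^2, with second moment 1. *)
apply: (@le_trans _ _ (\int[P]_w (1%:E + (Z i w ^+ 2)%:E))).
  apply: ge0_le_integral; [exact: measurableT|by move=> w _; rewrite lee_fin| | |].
  - by apply/measurable_EFinP; apply: measurableT_comp => //; exact: mZ.
  - exact: emeasurable_funD.
  - move=> w _; rewrite -EFinD lee_fin -(real_normK (num_real (Z i w))).
    by move: (`|Z i w|)%R => y; have := sqr_ge0 (y - 1)%R; have := sqr_ge0 y; nra.
rewrite ge0_integralD//; last by move=> w _; rewrite lee_fin sqr_ge0.
have -> : \int[P]_w 1%:E = 1%:E.
  transitivity (1%:E * P setT); first exact: integral_cst.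
  by rewrite mul1e; exact: probability_setT.
by rewrite e2 expr1n -EFinD lee_fin.
Qed.

End independent_gaussians.

(** * Square integrability of the envelope *)

Section envelope_norm.
Context {R : realType}.
Local Notation RT := (measurableTypeR R).
Local Open Scope ereal_scope.

(** The density of [gamma], proportional to exp(-t^2), times exp(t^2 / 2) is a multiple of the
    standard normal density. *)
Lemma integral_gamma_exp : \int[gamma R]_t (expR (t ^+ 2 / 2))%:E < +oo.
Proof.
pose s : R := ((Num.sqrt 2)^-1)%R.
have s0 : s != 0%R by rewrite invr_eq0 sqrtr_eq0 -ltNge.
have mE : measurable_fun (setT : set RT) (fun t : RT => (expR ((t : R) ^+ 2 / 2))%:E).
  apply/measurable_EFinP; apply: measurableT_comp => //.
  by apply: measurable_funM => //; exact: measurable_funX.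
rewrite (@eq_measure_integral _ _ _ _ (normal_prob 0 s)); last first.
  by move=> A mA _; exact: (congr1 (fun m => m A) (@gammaE R)).
rewrite ge0_integral_normal_prob//.
have p1 : (0 < normal_peak 1 :> R)%R by rewrite normal_peak_gt0 ?oner_eq0.
pose K : R := (normal_peak s / normal_peak 1)%R.
have -> : (\int[lebesgue_measure]_t ((expR (t ^+ 2 / 2))%:E * (normal_pdf 0 s t)%:E) =
    \int[lebesgue_measure]_t (K%:E * (normal_pdf 0 1 t)%:E)).
  apply: eq_integral => t _; rewrite -!EFinM; congr (_%:E).
  rewrite !normal_pdfE ?oner_eq0// /normal_fun !subr0 /K [RHS]mulrA divfK ?gt_eqF//.
  rewrite mulrCA; congr (_ * _)%R; rewrite -expRD; congr expR.
  have -> : (s ^+ 2 = 2^-1)%R by rewrite /s exprVn sqr_sqrtr.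
  by rewrite expr1n; field.
rewrite ge0_integralZl//.
- by rewrite integral_normal_pdf mule1 ltry.
- by apply/measurable_EFinP; exact: measurable_normal_pdf.
- by move=> t _; rewrite lee_fin normal_pdf_ge0.
- by rewrite lee_fin divr_ge0// normal_peak_ge0.
Qed.

Lemma integral_product_lty d1 d2 (T1 : measurableType d1) (T2 : measurableType d2)
    (m1 : {sigma_finite_measure set T1 -> \bar R})
    (m2 : {sigma_finite_measure set T2 -> \bar R}) (f : T1 -> R) (g : T2 -> R) :
  measurable_fun setT f -> measurable_fun setT g ->
  (forall x, 0 <= f x)%R -> (forall x, 0 <= g x)%R ->
  \int[m1]_x (f x)%:E < +oo -> \int[m2]_x (g x)%:E < +oo ->
  \int[m1 \x m2]_z (f z.1 * g z.2)%:E < +oo.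
Proof.
move=> mf mg f0 g0 foo goo.
have mfE : measurable_fun setT (fun x => (f x)%:E) by exact/measurable_EFinP.
have mgE : measurable_fun setT (fun x => (g x)%:E) by exact/measurable_EFinP.
have mfg : measurable_fun setT (fun z : T1 * T2 => (f z.1 * g z.2)%:E).
  apply/measurable_EFinP; apply: measurable_funM.
    exact: (measurableT_comp mf measurable_fst).
  exact: (measurableT_comp mg measurable_snd).
have fg0 (z : T1 * T2) : 0 <= (f z.1 * g z.2)%:E by rewrite lee_fin mulr_ge0.
rewrite (@fubini_tonelli1 _ _ T1 T2 R m1 m2 _ mfg fg0) /fubini_F /=.
under eq_integral => x _.
  under eq_integral => y _ do rewrite EFinM.
  rewrite ge0_integralZl//; last 2 first.
  - by move=> y _; rewrite lee_fin.
  - by rewrite lee_fin.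
  over.
rewrite ge0_integralZr//; last 2 first.
- by move=> x _; rewrite lee_fin.
- by apply: integral_ge0 => y _; rewrite lee_fin.
by apply: lte_mul_pinfty => //; [apply: integral_ge0 => x _; rewrite lee_fin|
  rewrite ge0_fin_numE//; apply: integral_ge0 => x _; rewrite lee_fin].
Qed.

Local Notation RT3 := (RT * RT * RT)%type.

(* The sigma-finiteness of a product measure is only canonical for products of
   subprobabilities, hence this detour. *)
Definition gamma2 : {sigma_finite_measure set (RT * RT)%type -> \bar R} :=
  (product_subprobability (gamma R : subprobability RT R, gamma R : subprobability RT R)
   : subprobability (RT * RT)%type R).

Let theta_bound : \int[theta R]_x (envelope x ^+ 2)%:E < +oo.
Proof.
have mE : measurable_fun (setT : set RT) (fun t : RT => expR ((t : R) ^+ 2 / 2)).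
  apply: measurableT_comp => //.
  by apply: measurable_funM => //; exact: measurable_funX.
have e0 (t : R) : (0 <= expR (t ^+ 2 / 2))%R by exact: expR_ge0.
have g := integral_gamma_exp.
have h := @integral_product_lty _ _ RT RT (gamma R) (gamma R) _ _ mE mE e0 e0 g g.
have mE2 : measurable_fun setT
    (fun z : RT * RT => (expR (z.1 ^+ 2 / 2) * expR (z.2 ^+ 2 / 2) : R)%R).
  apply: measurable_funM; first exact: (measurableT_comp mE measurable_fst).
  exact: (measurableT_comp mE measurable_snd).
have e20 (z : RT * RT) : (0 <= expR (z.1 ^+ 2 / 2) * expR (z.2 ^+ 2 / 2) :> R)%R.
  by rewrite mulr_ge0.
have h3 := @integral_product_lty _ _ _ RT gamma2 (gamma R) _ _ mE2 mE e20 e0 h g.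
rewrite (_ : (fun x : RT3 => (envelope x ^+ 2)%:E) = (fun z : RT3 =>
  (expR (z.1.1 ^+ 2 / 2) * expR (z.1.2 ^+ 2 / 2) * expR (z.2 ^+ 2 / 2))%R%:E))//.
apply/funext => x; congr (_%:E); rewrite /envelope !exprMn -!expRM_natl.
by congr (expR _ * expR _ * expR _)%R; field.
Qed.

Let env_norm2 : R := fine (\int[theta R]_x (envelope x ^+ 2)%:E).

Lemma measurable_envelope : measurable_fun (setT : set RT3) (envelope : RT3 -> RT).
Proof.
have mE : measurable_fun (setT : set RT) (fun t : RT => expR ((t : R) ^+ 2 / 4)).
  apply: measurableT_comp => //.
  by apply: measurable_funM => //; exact: measurable_funX.
apply: measurable_funM; [apply: measurable_funM|].
- exact: (measurableT_comp mE (measurableT_comp measurable_fst measurable_fst)).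
- exact: (measurableT_comp mE (measurableT_comp measurable_snd measurable_fst)).
- exact: (measurableT_comp mE measurable_snd).
Qed.

Lemma Lnorm_le_envelope : exists2 M : R, (0 <= M)%R & forall (f : RT3 -> R) (K : R),
  measurable_fun (setT : set RT3) (f : RT3 -> RT) -> (0 <= K)%R ->
  (forall x, `|f x| <= K * envelope x)%R ->
  'N[theta R]_2%:E[EFin \o f] <= (K * M)%:E.
Proof.
(* M is the norm of the envelope in L_2(theta), finite by [theta_bound]. *)
exists (Num.sqrt env_norm2); first exact: sqrtr_ge0.
move=> f K mf K0 fK.
have i0 : 0 <= \int[theta R]_x (envelope x ^+ 2)%:E.
  by apply: integral_ge0 => x _; rewrite lee_fin sqr_ge0.
have iE : \int[theta R]_x (envelope x ^+ 2)%:E = env_norm2%:E.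
  by rewrite fineK// ge0_fin_numE// theta_bound.
have n0 : (0 <= env_norm2)%R by rewrite -lee_fin -iE.
have mEnv : measurable_fun (setT : set RT3) (fun x : RT3 => (envelope x ^+ 2)%:E).
  by apply/measurable_EFinP; apply: measurable_funX; exact: measurable_envelope.
have mf2 : measurable_fun (setT : set RT3) (fun x : RT3 => (f x ^+ 2)%:E).
  by apply/measurable_EFinP; exact: measurable_funX.
have -> : (K * Num.sqrt env_norm2)%:E = poweR (K ^+ 2 * env_norm2)%:E (2^-1)%R.
  by rewrite poweR_EFin powR12_sqrt ?mulr_ge0 ?sqr_ge0// sqrtrM ?sqr_ge0// sqrtr_sqr ger0_norm.
rewrite unlock /=.
have -> : \int[theta R]_x poweR `|(f x)%:E| 2%R = \int[theta R]_x (f x ^+ 2)%:E.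
  apply: eq_integral => x _.
  by rewrite /= powR_mulrn ?normr_ge0// real_normK ?num_real.
have half0 : (0 <= 2^-1 :> R)%R by rewrite invr_ge0.
pose J := \int[theta R]_x (f x ^+ 2)%:E.
have J0 : J \in `[0, +oo].
  by rewrite in_itv/= leey andbT integral_ge0// => x _; rewrite lee_fin sqr_ge0.
have K2 : (K ^+ 2 * env_norm2)%:E \in `[0, +oo].
  by rewrite in_itv/= leey andbT lee_fin mulr_ge0 ?sqr_ge0.
suff JK : J <= (K ^+ 2 * env_norm2)%:E by exact: (@gt0_ler_poweR R _ half0 _ _ J0 K2 JK).
rewrite EFinM -iE /J -ge0_integralZl//; last 2 first.
+ by move=> x _; rewrite lee_fin sqr_ge0.
+ by rewrite lee_fin sqr_ge0.
apply: ge0_le_integral; [exact: measurableT|by move=> x _; rewrite lee_fin sqr_ge0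
  |exact: mf2|exact: emeasurable_funM|].
move=> x _; rewrite -EFinM lee_fin -exprMn -(real_normK (num_real (f x))).
by apply: lerXn2r; rewrite ?nnegrE// (le_trans _ (fK x)).
Qed.

End envelope_norm.

(** * The random series *)

Section gaussian_series.
Context (R : realType) (d : measure_display) (T : measurableType d) (P : probability T R).
Variable Z : nat * nat * nat -> {RV P >-> R}.
Hypothesis Z_gauss : forall i, standard_gaussian (Z i).
Hypothesis Z_indep : mutually_independent Z.
Local Notation RT := (measurableTypeR R).
Local Open Scope ereal_scope.

Let mZ i : measurable_fun (setT : set T) (Z i : T -> RT).
Proof. exact: (measurable_funPT (Z i)). Qed.

Let z w i : R := Z i w.

Lemma partial_sumE N x w : partial_sum Z N x w = path_sum (z w) N x.
Proof.
rewrite /partial_sum /path_sum /cube; apply: eq_bigr => m _.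
by apply: eq_bigr => n _; apply: eq_bigr => p _; rewrite /coef [RHS]mulrA.
Qed.

Lemma series_fieldE x w : series_field Z x w = limn (path_sum (z w) ^~ x).
Proof.
by rewrite /series_field; congr (limn _); apply/funext => N; exact: partial_sumE.
Qed.

Let q : R := (19 / 20)%R.
Let q0 : (0 <= q)%R. Proof. by rewrite /q; lra. Qed.
Let q1 : (q < 1)%R. Proof. by rewrite /q; lra. Qed.

Let measurable_weight i : measurable_fun (setT : set T) (fun w => (weight (z w) i)%:E).
Proof.
have mz : measurable_fun (setT : set T) (fun w => `|Z i w|%R : RT).
  by apply: measurableT_comp => //; exact: mZ.
apply/measurable_EFinP; apply: measurable_funM; first exact: mz.
exact: measurable_cst.
Qed.

Let weight_ge0 w i : (0 <= weight (z w) i)%R.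
Proof. by rewrite mulr_ge0// !mulr_ge0// exprn_ge0//; lra. Qed.

(** The first absolute moments are at most 2, and three geometric series of ratio q make the bound
    independent of N. *)
Lemma integral_weight_le N :
  \int[P]_w (cube (weight (z w)) N)%:E <= (2 * (1 - q)^-1 ^+ 3)%:E.
Proof.
under eq_integral => w _ do rewrite cubeE -sumEFin.
rewrite ge0_integral_sum//; last by move=> i w _; rewrite lee_fin.
apply: (@le_trans _ _ (\sum_(i <- cube_seq N)
    (2 * (q ^+ i.1.1 * q ^+ i.1.2 * q ^+ i.2))%:E)).
  apply: lee_sum => i _; rewrite /weight.
  have c0 : (0 <= q ^+ i.1.1 * q ^+ i.1.2 * q ^+ i.2)%R by rewrite !mulr_ge0// exprn_ge0.
  under eq_integral => w _ do rewrite EFinM.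
  have mz : measurable_fun (setT : set T) (fun w => (`|Z i w|)%:E).
    by apply/measurable_EFinP; apply: measurableT_comp => //; exact: mZ.
  rewrite ge0_integralZr; [|exact: measurableT|exact: mz|by move=> w _; rewrite lee_fin
    |by rewrite lee_fin].
  rewrite [leRHS]EFinM; apply: lee_wpmul2r; first by rewrite lee_fin.
  exact: (integral_abs_standard Z_gauss).
rewrite sumEFin lee_fin -cubeE cubeZ ler_pM2l//.
rewrite (cube_product (fun n => q ^+ n)%R (fun n => q ^+ n)%R (fun n => q ^+ n)%R).
have sq : (0 <= series (fun n => q ^+ n)%R N.+1 <= (1 - q)^-1)%R.
  apply/andP; split.
    by rewrite /series/= sumr_ge0// => n _; exact: exprn_ge0.
  have -> : series (fun n => (q ^+ n)%R) = series (geometric 1%R q).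
    by apply/funext => n; apply: eq_bigr => k _; rewrite /= mul1r.
  rewrite geometric_seriesE ?lt_eqF//= mul1r ler_pdivrMr ?subr_gt0//.
  by rewrite mulVf ?gt_eqF ?subr_gt0// gerBl exprn_ge0.
move: sq => /andP[s0 s1].
by rewrite !exprS expr0 mulr1 mulrA; do 2! (apply: ler_pM => //; rewrite ?mulr_ge0//).
Qed.

Lemma weights_ae : {ae P, forall w, cvgn (cube (weight (z w)))}.
Proof.
pose W N w : \bar R := (cube (weight (z w)) N)%:E.
have mW N : measurable_fun (setT : set T) (W N).
  rewrite /W; under eq_fun => w do rewrite cubeE -sumEFin.
  by apply: emeasurable_sum => i.
have ndW w : nondecreasing_seq (W ^~ w).
  by move=> m n mn; rewrite lee_fin; apply: cube_nondecreasing.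
have W0 N w : 0 <= W N w by rewrite lee_fin; exact: cube_ge0.
have cW w : cvgn (W ^~ w) by apply: ereal_nondecreasing_is_cvgn.
have lim0 w : 0 <= limn (W ^~ w) by apply: lime_ge => //; exact: nearW.
have h : \int[P]_w W N w @[N --> \oo] --> \int[P]_w limn (W ^~ w).
  by apply: cvg_monotone_convergence => // w _; exact: ndW.
have hle : \int[P]_w limn (W ^~ w) <= (2 * (1 - q)^-1 ^+ 3)%:E.
  rewrite -(cvg_lim (@ereal_hausdorff R) h); apply: lime_le.
    by apply/cvg_ex; eexists; exact: h.
  by apply: nearW => N; exact: integral_weight_le.
have mlim : measurable_fun (setT : set T) (fun w => limn (W ^~ w)).
  have -> : (fun w => limn (W ^~ w)) = (fun w => limn_esup (W ^~ w)).
    by apply/funext => w; rewrite is_cvg_limn_esupE.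
  exact: measurable_fun_limn_esup.
have ilim : P.-integrable setT (fun w => limn (W ^~ w)).
  apply/integrableP; split => //.
  under eq_integral => w _ do rewrite gee0_abs//.
  by rewrite (le_lt_trans hle)// ltry.
(* The extended limit has finite expectation, hence is almost surely finite, and it then bounds the
   nondecreasing real sequence. *)
apply: filterS (integrable_ae measurableT ilim) => w /(_ I) fin.
apply: nondecreasing_is_cvgn; first exact: cube_nondecreasing.
exists (fine (limn (W ^~ w))) => _ [N _ <-].
rewrite -lee_fin fineK//.
apply: lime_ge; first exact: cW.
near=> M; apply: (ndW w); near: M; exact: nbhs_infty_ge.
Unshelve. all: by end_near. Qed.

Lemma partial_sum_seq N x w :
  partial_sum Z N x w = (\sum_(i <- cube_seq N) coef x i * Z i w)%R.
Proof.
by rewrite partial_sumE /path_sum cubeE; apply: eq_bigr => i _; rewrite mulrC.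
Qed.

Lemma measurable_series_field x :
  measurable_fun (setT : set T) (series_field Z x : T -> RT).
Proof.
apply: (measurable_limn (u := fun N w => partial_sum Z N x w)) => N.
have -> : (fun w => partial_sum Z N x w) =
    (fun w => \sum_(i <- cube_seq N) coef x i * Z i w)%R.
  by apply/funext => w; exact: partial_sum_seq.
exact: measurable_combination.
Qed.

Lemma series_field_cvg : {ae P, forall w, forall x,
  partial_sum Z N x w @[N --> \oo] --> series_field Z x w}.
Proof.
apply: filterS weights_ae => w h x; rewrite series_fieldE.
have -> : (fun N => partial_sum Z N x w) = path_sum (z w) ^~ x.
  by apply/funext => N; exact: partial_sumE.
exact: path_sum_cvg.
Qed.

(** Regrouped by index, a combination of partial sums is a combination of the [Z i] with
    coefficients [c i]; its variances converge by [variance_cube]. *)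
Lemma series_field_law (r : nat) (a : 'I_r -> R) (x : 'I_r -> R * R * R) :
  gaussian_law P (fun w => \sum_(j < r) a j * series_field Z (x j) w)%R
    (Num.sqrt (field_variance a x)).
Proof.
pose c i : R := (\sum_(j < r) a j * coef (x j) i)%R.
apply: (@gaussian_law_limit R _ T P
  (fun N w => \sum_(i <- cube_seq N) c i * Z i w)%R _
  (fun N => Num.sqrt (\sum_(i <- cube_seq N) c i ^+ 2)%R)).
- by move=> N; exact: measurable_combination.
- apply: measurable_sum => j; apply: measurable_funM => //.
  exact: measurable_series_field.
- move=> N; apply: gaussian_law_combination => //; exact: cube_seq_uniq.
- apply: filterS series_field_cvg => w h.
  have -> : (fun N => \sum_(i <- cube_seq N) c i * Z i w)%R =
      (fun N => \sum_(j < r) a j * partial_sum Z N (x j) w)%R.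
    apply/funext => N.
    under [RHS]eq_bigr => j _ do rewrite partial_sum_seq mulr_sumr.
    rewrite exchange_big/=; apply: eq_bigr => i _; rewrite mulr_suml.
    by apply: eq_bigr => j _; rewrite mulrA.
  apply: (cvg_sum_seq (g := fun j N => a j * partial_sum Z N (x j) w)%R) => j.
  by apply: cvgM; [exact: cvg_cst|exact: h].
- have -> : (fun N => Num.sqrt (\sum_(i <- cube_seq N) c i ^+ 2)%R) =
      (fun N => Num.sqrt (cube (fun i => c i ^+ 2)%R N)).
    by apply/funext => N; rewrite cubeE.
  have h := @variance_cube R r a x.
  by apply: (cvg_comp _ Num.sqrt h); exact: sqrt_continuous.
Qed.

Lemma series_field_gaussian : gaussian_field P (series_field Z).
Proof.
move=> r x a; apply: gaussian_law_normal (series_field_law a x); first exact: sqrtr_ge0.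
apply: measurable_sum => j; apply: measurable_funM => //.
exact: measurable_series_field.
Qed.

Let kernel_diag (x : R * R * R) : gauss_kernel x x = 1%R.
Proof. by rewrite gauss_kernelE !subrr !expr0n/= !oppr0 expR0 !mulr1. Qed.

Let kernel_sym (x y : R * R * R) : gauss_kernel x y = gauss_kernel y x.
Proof.
by rewrite !gauss_kernelE -[(x.1.1 - _)%R]opprB -[(x.1.2 - _)%R]opprB
  -[(x.2 - _)%R]opprB !sqrrN.
Qed.

Lemma series_field_law1 x : gaussian_law P (series_field Z x) 1.
Proof.
have := @series_field_law 1 (fun=> 1%R) (fun=> x).
rewrite /field_variance !big_ord1 !mul1r kernel_diag sqrtr1.
have -> : (fun w => \sum_(j < 1) 1 * series_field Z x w)%R = series_field Z x.
  by apply/funext => w; rewrite big_ord1 mul1r.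
exact.
Qed.

(** Together with the unit variances, the variance 2 + 2 k(x, y) of this sum is what determines the
    covariance. *)
Lemma series_field_law2 x y : gaussian_law P
  (fun w => series_field Z x w + series_field Z y w)%R
  (Num.sqrt (2 + 2 * gauss_kernel x y)).
Proof.
pose xy (j : 'I_2) := if j == ord0 then x else y.
have := @series_field_law 2 (fun=> 1%R) xy.
rewrite /field_variance !big_ord_recl !big_ord0 /xy/= !mul1r !addr0.
rewrite !kernel_diag (kernel_sym y x).
have -> : (1 + gauss_kernel x y + (gauss_kernel x y + 1) = 2 + 2 * gauss_kernel x y)%R.
  by ring.
have -> : (fun w => \sum_(j < 2) 1 * series_field Z (if j == ord0 then x else y) w)%R =
    (fun w => series_field Z x w + series_field Z y w)%R.
  by apply/funext => w; rewrite !big_ord_recl big_ord0 /= !mul1r addr0.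
exact.
Qed.

Lemma series_field_mean x : 'E_P[series_field Z x] = 0.
Proof.
rewrite unlock.
by have [] := integral_gaussian_law (measurable_series_field x) (series_field_law1 x).
Qed.

Lemma series_field_covariance x y :
  'E_P[(fun w => (series_field Z x w * series_field Z y w)%R)] = (gauss_kernel x y)%:E.
Proof.
rewrite unlock; pose U := series_field Z.
have mxy : measurable_fun (setT : set T) ((fun w => U x w + U y w)%R : T -> RT).
  by apply: measurable_funD; exact: measurable_series_field.
have [ex ix _ _] := integral_gaussian_law (measurable_series_field x) (series_field_law1 x).
have [ey iy _ _] := integral_gaussian_law (measurable_series_field y) (series_field_law1 y).
have [exy ixy _ _] := integral_gaussian_law mxy (series_field_law2 x y).
have k0 : (0 <= 2 + 2 * gauss_kernel x y)%R.
  by rewrite addr_ge0// mulr_ge0// expR_ge0.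
rewrite sqr_sqrtr// in exy; rewrite expr1n in ex ey.
have i1 := integrableB measurableT ixy ix.
have i2 := integrableB measurableT i1 iy.
transitivity (\int[P]_w ((2^-1)%:E * (((U x w + U y w) ^+ 2)%:E - (U x w ^+ 2)%:E
    - (U y w ^+ 2)%:E))).
  apply: eq_integral => w _; rewrite -!EFinB -EFinM; congr (_%:E).
  by rewrite /U; field.
rewrite integralZl// (integralB measurableT i1 iy) (integralB measurableT ixy ix).
rewrite ex ey exy -!EFinB -EFinM; congr (_%:E).
by field.
Qed.

Local Notation RT3 := (RT * RT * RT)%type.

Let measurable_coef i : measurable_fun (setT : set RT3) ((fun x => coef x i) : RT3 -> RT).
Proof.
have me n : measurable_fun (setT : set RT) (eigen 0 n : RT -> RT).
  apply: continuous_measurable_fun => t; apply: differentiable_continuous.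
  by apply/derivable1_diffP; exact: (@ex_derive _ _ _ _ _ _ _ (is_derive_eigen 0 n t)).
have -> : (fun x => coef x i) = (fun x : RT3 =>
    eigen 0 i.1.1 x.1.1 * eigen 0 i.1.2 x.1.2 * eigen 0 i.2 x.2)%R.
  by apply/funext => x; rewrite coef_eigen.
apply: measurable_funM; [apply: measurable_funM|].
- exact: (measurableT_comp (me _) (measurableT_comp measurable_fst measurable_fst)).
- exact: (measurableT_comp (me _) (measurableT_comp measurable_snd measurable_fst)).
- exact: (measurableT_comp (me _) measurable_snd).
Qed.

Let measurable_path_sum w N :
  measurable_fun (setT : set RT3) ((fun x => path_sum (z w) N x) : RT3 -> RT).
Proof.
have -> : (fun x => path_sum (z w) N x) =
    (fun x : RT3 => \sum_(i <- cube_seq N) z w i * coef x i)%R.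
  by apply/funext => x; rewrite /path_sum cubeE.
apply: measurable_sum => i; apply: measurable_funM; first exact: measurable_cst.
exact: measurable_coef.
Qed.

(** The default value of [limn] keeps the path measurable also for the w at which the series
    diverges. *)
Let measurable_path w :
  measurable_fun (setT : set RT3) ((fun x => series_field Z x w) : RT3 -> RT).
Proof.
have -> : (fun x => series_field Z x w) = (fun x => limn (fun N => path_sum (z w) N x)).
  by apply/funext => x; exact: series_fieldE.
exact: measurable_limn (measurable_path_sum w).
Qed.

Lemma series_field_Lfun :
  {ae P, forall w, (fun x => series_field Z x w) \in Lfun (theta R) 2%:E}.
Proof.
have [M M0 hM] := @Lnorm_le_envelope R.
apply: filterS weights_ae => w h.
have [C C0 hC] := path_sum_envelope (z w).
apply/andP; split; rewrite inE; first exact: measurable_path.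
have W0 : (0 <= limn (cube (weight (z w))))%R.
  by apply: limr_ge => //; apply: nearW => N; exact: cube_ge0.
apply: (@le_lt_trans _ _ (C * limn (cube (weight (z w))) * M)%:E); last exact: ltry.
apply: hM; [exact: measurable_path|exact: mulr_ge0|] => x.
rewrite series_fieldE [leRHS]mulrAC; exact: dominated_lim_le.
Qed.

Lemma series_field_smooth : {ae P, forall w, smooth (fun x => series_field Z x w)}.
Proof.
apply: filterS weights_ae => w h.
have -> : (fun x => series_field Z x w) = (fun x => limn (path_sum (z w) ^~ x)).
  by apply/funext => x; exact: series_fieldE.
exact: path_sum_smooth.
Qed.

(** The pointwise error is at most C times the envelope times the tail of the weights, and this tail
    does not depend on x. *)
Lemma series_field_Lnorm_cvg : {ae P, forall w,
  'N[theta R]_2%:E[(fun x => (partial_sum Z N x w - series_field Z x w)%:E)]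
    @[N --> \oo] --> 0}.
Proof.
have [M M0 hM] := @Lnorm_le_envelope R.
apply: filterS weights_ae => w h.
have [C C0 hC] := path_sum_envelope (z w).
pose W := cube (weight (z w)).
have WW N : (0 <= limn W - W N)%R.
  rewrite subr_ge0; apply: nondecreasing_cvgn_le => //.
  exact: cube_nondecreasing.
apply: (@squeeze_cvge _ _ _ _ (fun=> 0) _ (fun N => (C * (limn W - W N) * M)%:E)).
- apply: nearW => N; rewrite Lnorm_ge0/=.
  apply: (hM (fun x => partial_sum Z N x w - series_field Z x w)%R).
  + apply: measurable_funB; last exact: measurable_path.
    have -> : (fun x => partial_sum Z N x w) = (fun x => path_sum (z w) N x).
      by apply/funext => x; exact: partial_sumE.
    exact: measurable_path_sum.
  + exact: mulr_ge0.
  + move=> x; rewrite distrC series_fieldE partial_sumE [leRHS]mulrAC.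
    exact: dominated_lim.
- exact: cvg_cst.
- have -> : 0 = (C * (limn W - limn W) * M)%:E :> \bar R by rewrite subrr mulr0 mul0r.
  apply: cvg_EFin; first exact: nearW.
  apply: cvgM; last exact: cvg_cst.
  apply: cvgM; first exact: cvg_cst.
  by apply: cvgB; [exact: cvg_cst|exact: h].
Qed.

End gaussian_series.

Theorem theorem1 (R : realType) (d : measure_display) (T : measurableType d)
    (P : probability T R) (Z : nat * nat * nat -> {RV P >-> R})
    (Z_gauss : forall i, standard_gaussian (Z i))
    (Z_indep : mutually_independent Z) :
  let S N x w := partial_sum Z N x w in
  let U x w := series_field Z x w in
  {ae P, forall w, forall x, S N x w @[N --> \oo] --> U x w} /\
  gaussian_field P U /\
  (forall x, 'E_P[U x] = 0)%E /\
  (forall x y, 'E_P[(fun w => (U x w * U y w)%R)] = (gauss_kernel x y)%:E)%E /\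
  {ae P, forall w, (fun x => U x w) \in Lfun (theta R) 2%:E} /\
  {ae P, forall w, smooth (fun x => U x w)} /\
  {ae P, forall w,
    'N[theta R]_2%:E[(fun x => (S N x w - U x w)%:E)]%E @[N --> \oo] --> 0%E}.
Proof.
move=> S U; split; first exact: series_field_cvg.
split; first exact: series_field_gaussian.
split; first exact: series_field_mean.
split; first exact: series_field_covariance.
split; first exact: series_field_Lfun.
split; first exact: series_field_smooth.
exact: series_field_Lnorm_cvg.
Qed.
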